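(* Let $\mathsf Z=\mathsf Z(\mathsf E)$ be a primitive Delzant zonotope with $\mathsf E$ integral. Let $\mathsf P$ be an omnitruncation of $\mathsf Z$, and let $\mathscr T$ be an indecomposable polytopal basis for the deformation space of $\mathsf Z$. Then $$\mathscr G=\left\{\mathsf G(\mathsf Z,\mathsf F) : \emptyset\subsetneq\mathsf F\subsetneq\mathsf Z,\ \operatorname{codim}(\mathsf F)>1\right\}\cup\mathscr T$$ is an indecomposable polytopal basis for the deformation space of $\mathsf P$. Moreover, if $\mathscr T$ is an integral basis for the deformation space of $\mathsf Z$, then $\mathscr G$ is an integral basis for the deformation space of $\mathsf P$.
   Context: Conventions. Let $\Lambda$ be a lattice (by default $\mathbb Z^n\subset\mathbb R^n$) and $V=\Lambda\otimes\mathbb R$. Polytopes live in $V$; normal vectors live in $V^*\supset\Lambda^*$ (dual lattice). $h(\mathsf P,u)=\min_{x\in\mathsf P}u\cdot x$. For a nonempty face $\mathsf F$ of $\mathsf P$, its normal cone is $\{u : u\cdot x=h(\mathsf P,u)\ \forall x\in\mathsf F\}$; the normal fan $\Sigma(\mathsf P)$ is the collection of normal cones of nonempty faces. A fan coarsens another if each of its cones is a union of cones of the other. Zonotopes. For a finite collection $\mathsf E$ of (nondegenerate, distinct) line segments in $V$, $\mathsf Z(\mathsf E)=\sum_{s\in\mathsf E}s$ (Minkowski sum). $\mathsf E$ is integral if all segments have endpoints in $\Lambda$. A full-dimensional polytope with vertices in $\Lambda$ is Delzant if at every vertex the primitive lattice vectors along the incident edges form a basis of $\Lambda$, and primitive Delzant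 if moreover each edge contains no lattice points besides its endpoints. Truncations. Let $\mathsf S$ be a full-dimensional simple polytope. For a facet $\mathsf G$, $u_{\mathsf G}\in\Lambda^*$ is its primitive inner normal; for a nonempty proper face $\mathsf F$, $u_{\mathsf F}=\sum_{\mathsf G\supseteq\mathsf F}u_{\mathsf G}$ over facets containing $\mathsf F$. A vertex $y\notin\mathsf F$ is a neighbor of $\mathsf F$ if it is joined by an edge to a vertex of $\mathsf F$; $\delta_{\mathsf F}=\min\{u_{\mathsf F}\cdot y-h(\mathsf S,u_{\mathsf F}) : y\text{ a neighbor of }\mathsf F\}$ (equal to $1$ for $\mathsf S$ primitive Delzant). For a face $\mathsf F$ and $u$ in the relative interior of its normal cone, $\operatorname{Tr}^u_\epsilon[\mathsf S,\mathsf F]=\{x\in\mathsf S : u\cdot x\ge h(\mathsf S,u)+\epsilon\}$ (this definition applies to any polytope), and $\operatorname{Tr}_\epsilon=\operatorname{Tr}^{u_{\mathsf F}}_\epsilon$; it is shallow if $0<\epsilon<\delta_{\mathsf F}$. The polytopes $\mathsf G(\mathsf Z,\mathsf F)$. Write a nonempty proper face of $\mathsf Z(\mathsf E)$ as $\mathsf F=\mathsf Z(\mathsf W)+p$ with $\mathsf W\subseteq\mathsf E$ and $p$ the corresponding vertex of $\mathsf Z(\mathsf E\setminus\mathsf W)$; write $p=\sum_{s\in\mathsf E\setminus\mathsf W}p(s)$ with $p(s)$ the endpoint of $s$ selected by $p$. Let $\mathsf U\subseteq\mathsf E\setminus\mathsf W$ be the set of segments parallel to edges of $\mathsf Z(\mathsf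 E\setminus\mathsf W)$ incident to $p$, and $p_{\mathsf U}=\sum_{s\in\mathsf U}p(s)$, a vertex of $\mathsf Z(\mathsf U)$. With $u_{\mathsf F}$ and $\delta_{\mathsf F}$ those of $\mathsf F$ as a face of $\mathsf Z(\mathsf E)$, set $$\mathsf G(\mathsf Z,\mathsf F)=\operatorname{Tr}^{u_{\mathsf F}}_{\delta_{\mathsf F}}[\mathsf Z(\mathsf U),p_{\mathsf U}]=\{x\in\mathsf Z(\mathsf U) : u_{\mathsf F}\cdot x\ge u_{\mathsf F}\cdot p_{\mathsf U}+\delta_{\mathsf F}\}.$$ Omnitruncation. List the nonempty proper faces of $\mathsf S$ as $\mathsf F_1,\dots,\mathsf F_m$ in an order extending inclusion (smaller faces first), let $\mathsf S_0=\mathsf S$, and for numbers $\epsilon_{\mathsf F}>0$ let $\mathsf S_i=\operatorname{Tr}_{\epsilon_{\mathsf F_i}}[\mathsf S_{i-1},\mathsf F_i\cap\mathsf S_{i-1}]$ (direction $u_{\mathsf F_i}$). If each truncation is shallow, $\mathsf S_m$ is an omnitruncation of $\mathsf S$. Deformations. A deformation of $\mathsf P$ is a polytope whose normal fan coarsens $\Sigma(\mathsf P)$. The deformation space of $\mathsf P$ is the vector space $\operatorname{PL}(\Sigma(\mathsf P))$ of functions on $V^*$ linear on each cone of $\Sigma(\mathsf P)$. A polytopal basis for it is a collection of deformations of $\mathsf P$ whose support functions form a basis. It is integral if the support functions generate over $\mathbb Z$ the subgroup of functions whose restriction to each cone is given by an element of $\Lambda$. A polytope is indecomposable if each of its deformations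 is a point or a translate of a positive dilate of it; a polytopal basis is indecomposable if all its elements are. *)

(* Defs.v *)
From HB Require Import structures.
From mathcomp Require Import all_boot all_order all_algebra.
From mathcomp Require Import all_classical all_reals.

Set Implicit Arguments.
Unset Strict Implicit.
Unset Printing Implicit Defensive.

Import Order.TTheory GRing.Theory Num.Theory.

Local Open Scope classical_set_scope.
Local Open Scope ring_scope.

(* V = R^n and its dual V^* are both 'rV[R]_n, paired by dot; the first
   argument of dot is the element of V^*. *)

Section LinearAlgebra.
Variables (R : realType).

Definition lspan (M : lmodType R) (S : set M) : set M :=
  [set f | exists k (g : 'I_k -> M) (c : 'I_k -> R),
     (forall i, S (g i)) /\ f = \sum_i c i *: g i].

Definition lfree (M : lmodType R) (S : set M) : Prop :=
  forall k (g : 'I_k -> M) (c : 'I_k -> R), injective g ->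
    (forall i, S (g i)) -> \sum_i c i *: g i = 0 -> forall i, c i = 0.

Definition lbasis (M : lmodType R) (S X : set M) : Prop :=
  lfree S /\ lspan S = X.

Definition zspan (M : zmodType) (S : set M) : set M :=
  [set f | exists k (g : 'I_k -> M) (c : 'I_k -> int),
     (forall i, S (g i)) /\ f = \sum_i g i *~ c i].

Definition zfree (M : zmodType) (S : set M) : Prop :=
  forall k (g : 'I_k -> M) (c : 'I_k -> int), injective g ->
    (forall i, S (g i)) -> \sum_i g i *~ c i = 0 -> forall i, c i = 0.

Definition zbasis (M : zmodType) (S X : set M) : Prop :=
  zfree S /\ zspan S = X.

End LinearAlgebra.

Section Polytopes.
Variables (R : realType) (n : nat).
Local Notation V := 'rV[R]_n.
Implicit Types (P Q F G e A : set V) (u v w x y p : V) (L : set V).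

Definition dot u x : R := \sum_i u 0 i * x 0 i.

Definition lattice L : Prop :=
  exists2 B : 'M[R]_n, B \in unitmx &
    L = [set map_mx intr z *m B | z in [set: 'rV[int]_n]].

Definition dual L : set V :=
  [set u | forall x, L x -> dot u x \is a Num.int].

Definition primitive L w : Prop :=
  [/\ L w, w != 0 & forall t : R, 0 < t < 1 -> ~ L (t *: w)].

Definition conv_hull k (g : 'I_k -> V) : set V :=
  [set x | exists c : 'I_k -> R,
     [/\ forall i, 0 <= c i, \sum_i c i = 1 & x = \sum_i c i *: g i]].

Definition polytope P : Prop :=
  P !=set0 /\ exists k (g : 'I_k -> V), P = conv_hull g.

(* affine dimension; 0 on the empty set *)
Definition affdim A : nat :=
  \max_(d < n.+1 | `[< exists (x0 : V) (M : 'M[R]_(d, n)),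
     [/\ A x0, row_free M & forall i, A (x0 + row i M)] >]) d.

(* support function, with the min convention *)
Definition h P u : R := inf [set dot u x | x in P].

Definition face P u : set V := [set x | P x /\ dot u x = h P u].

(* nonempty faces, P itself included (u = 0) *)
Definition is_face P F : Prop := F !=set0 /\ exists u, F = face P u.

Definition proper_face P F : Prop := is_face P F /\ F <> P.

Definition vertex P v : Prop := is_face P [set v].

Definition edge P e : Prop := is_face P e /\ affdim e = 1%N.

Definition facet P G : Prop := is_face P G /\ (affdim G).+1 = n.

Definition normal_cone P F : set V :=
  [set u | forall x, F x -> dot u x = h P u].

Definition normal_fan P : set (set V) :=
  [set C | exists2 F, is_face P F & C = normal_cone P F].

Definition coarsens (S S' : set (set V)) : Prop :=
  forall C, S C -> exists2 B, B `<=` S' & C = \bigcup_(D in B) D.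

Definition deformation P Q : Prop :=
  polytope Q /\ coarsens (normal_fan Q) (normal_fan P).

Definition indecomposable P : Prop :=
  forall Q, deformation P Q ->
    (exists x, Q = [set x]) \/
    (exists (t : R) (x : V), 0 < t /\ Q = [set t *: y + x | y in P]).

Definition PL (S : set (set V)) : set (V -> R^o) :=
  [set f | forall C, S C -> exists x, forall u, C u -> f u = dot u x].

Definition PLint L (S : set (set V)) : set (V -> R^o) :=
  [set f | forall C, S C ->
     exists2 x, L x & forall u, C u -> f u = dot u x].

Definition support_functions (T : set (set V)) : set (V -> R^o) :=
  [set (h Q : V -> R^o) | Q in T].

Definition polytopal_basis P (T : set (set V)) : Prop :=
  T `<=` deformation P /\ lbasis (support_functions T) (PL (normal_fan P)).

Definition indecomposable_basis P (T : set (set V)) : Prop :=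
  polytopal_basis P T /\ T `<=` indecomposable.

Definition integral_basis L P (T : set (set V)) : Prop :=
  polytopal_basis P T /\
  zspan (support_functions T) = PLint L (normal_fan P).

Definition edge_vectors L P v : set V :=
  [set w | primitive L w /\
     exists e, [/\ edge P e, e v & exists2 t : R, 0 < t & e (v + t *: w)]].

Definition delzant L P : Prop :=
  [/\ polytope P, affdim P = n, forall v, vertex P v -> L v &
      forall v, vertex P v -> zbasis (edge_vectors L P v) L].

Definition primitive_delzant L P : Prop :=
  delzant L P /\ forall e x, edge P e -> e x -> L x -> vertex P x.

Definition facet_normal L P G : V :=
  xget 0 [set u | primitive (dual L) u /\ face P u = G].

Definition face_normal L P F : V :=
  \sum_(G \in [set G | facet P G /\ F `<=` G]) facet_normal L P G.

Definition neighbor P F y : Prop :=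
  [/\ vertex P y, ~ F y &
      exists v e, [/\ vertex P v, F v, edge P e, e v & e y]].

Definition gap P F u : R :=
  inf [set dot u y - h P u | y in neighbor P F].

Definition delta L P F : R := gap P F (face_normal L P F).

(* Tr^u_eps[P, F], where F = face P u is determined by u *)
Definition truncation P u (eps : R) : set V :=
  [set x | P x /\ h P u + eps <= dot u x].

(* Shallowness of the i-th truncation is measured on the current polytope
   S i, at its face F i `&` S i; the direction is that of F i in S 0. *)
Definition omnitruncation L P Q : Prop :=
  exists (m : nat) (F : 'I_m -> set V) (eps : 'I_m -> R) (S : nat -> set V),
    [/\ injective F,
        range F = proper_face P,
        forall i j, F i `<=` F j -> (i <= j)%N,
        S 0%N = P /\ Q = S m &
        forall i : 'I_m,
          let u := face_normal L P (F i) in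
          0 < eps i < gap (S i) (F i `&` S i) u /\
          S i.+1 = truncation (S i) u (eps i)].

End Polytopes.

Section Zonotopes.
Variables (R : realType) (n : nat) (I : finType).
Local Notation V := 'rV[R]_n.
Implicit Types (E : I -> V * V) (W : {set I}) (F A : set V).

Definition segment (s : V * V) : set V :=
  [set (1 - t) *: s.1 + t *: s.2 | t in [set t : R | 0 <= t <= 1]].

Definition zonotope E W : set V :=
  [set x | exists y : I -> V, (forall i, i \in W -> segment (E i) (y i)) /\
     x = \sum_(i in W) y i].

Definition segment_family E : Prop :=
  (forall i, (E i).1 != (E i).2) /\ injective (fun i => segment (E i)).

Definition integral (L : set V) E : Prop := forall i, L (E i).1 /\ L (E i).2.

Definition parallel (s : V * V) A : Prop :=
  forall x y, A x -> A y -> exists c : R, y - x = c *: (s.2 - s.1).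

(* X is the polytope G(Z, F), Z = Z(E), where F = Z(W) + p; the endpoints
   p(s) are given by q.  For Z primitive Delzant and E integral, no two
   segments are parallel, so W, p and (outside W) q are determined by F. *)
Definition is_G (L : set V) E F (X : set V) : Prop :=
  let Z := zonotope E [set: I] in
  exists (W : {set I}) (q : I -> V),
    let p := \sum_(i in ~: W) q i in
    let U := [set i in ~: W | `[< exists e : set V,
               [/\ edge (zonotope E (~: W)) e, e p & parallel (E i) e] >]]%SET in
    let pU := \sum_(i in U) q i in
    let u := face_normal L Z F in
    [/\ forall i, i \notin W -> q i = (E i).1 \/ q i = (E i).2,
        vertex (zonotope E (~: W)) p,
        F = [set x + p | x in zonotope E W] &
        X = [set x | zonotope E U x /\ dot u pU + delta L Z F <= dot u x]].

Definition G_family (L : set V) E : set (set V) :=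
  [set X | exists F, [/\ proper_face (zonotope E [set: I]) F,
     (1 < n - affdim F)%N & is_G L E F X]].

End Zonotopes.

(* Main.v *)
Require Import Defs.
From mathcomp Require Import all_boot all_order all_algebra.
From mathcomp Require Import all_classical all_reals.
From mathcomp Require Import ring lra.
From mathcomp Require Import fintype finset.

Set Implicit Arguments.
Unset Strict Implicit.
Unset Printing Implicit Defensive.
Import Order.TTheory GRing.Theory Num.Theory.
Local Open Scope classical_set_scope.
Local Open Scope ring_scope.

(** Every shallow truncation subdivides the normal fan at the normal of the
    truncated face ([stellar_system]). So the normal fan of [P] is a barycentric
    subdivision of the one of [Z]: its rays are spanned by the normals u_K of all
    proper faces K of [Z], its maximal cones by chains of faces through a vertex
    ([omnitruncation_system]). A function that is linear on the cones of [P] is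
    determined by its values at the u_K; one that is linear on the cones of [Z]
    by its values at the normals of the facets, which are arbitrary since [Z] is
    simple ([PL_interpolation]).

    Let w_s, s in U, be the edge vectors of Z(U) at p_U. At each vertex of [Z] the
    edges are segments that form a basis of the lattice ([frame_exists]), whence
    u_F . w_s = 1 ([incident_height]), and G(Z, F) is the set of the points
    p_U + sum_s t_s w_s with 0 <= t_s <= 1 and sum_s t_s >= 1. Its support function
    is the sum of a function that is linear on the cones of [Z] and of the face
    part phi_F(u) = max(0, min_s u . w_s). On the cone of a chain, phi_F adds up the
    coefficients of the u_K with K inside F ([face_part_chain]). Therefore
    G(Z, F) is a deformation of [P] ([deformation_of_PL]), and phi_F(u_K) is 1 if
    K is inside F and 0 otherwise. These values form a unitriangular matrix, whose
    rows at facets K are those of the identity. Thus a function that is linear on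
    the cones of [P] is, in a unique way, the sum of one that is linear on the
    cones of [Z], with the same values at the facets, and of a combination of the
    phi_F with F of codimension greater than one, which is integral if the values
    are ([PL_decomposition], [basis_free]).

    In a deformation of G(Z, F), the edge corresponding to the one from
    p_U + sum_(r in A) w_r in direction w_s is a multiple of w_s. As these
    edges form parallelograms, the multiple depends on s only; and it does not
    depend on s either, because the points p_U + w_s all minimize u_F. So G(Z, F) is
    indecomposable ([truncated_zonotope_indecomposable]).

    All convexity rests on Farkas' lemma ([farkas]), and the existence of edges
    on its consequence [extreme_generators]. *)

(** * The pairing and the support function *)

Section Pairing.
Variables (R : realType) (n : nat).
Local Notation V := 'rV[R]_n.
Implicit Types (u v w x y : V) (P S Q : set V).

Lemma dotE u x : dot u x = (u *m x^T) 0 0.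
Proof. by rewrite /dot !mxE; apply: eq_bigr => i _; rewrite !mxE. Qed.

Lemma dotC u x : dot u x = dot x u.
Proof. by apply: eq_bigr => i _; rewrite mulrC. Qed.

Lemma dotDl u v x : dot (u + v) x = dot u x + dot v x.
Proof. by rewrite !dotE mulmxDl !mxE. Qed.

Lemma dotDr u x y : dot u (x + y) = dot u x + dot u y.
Proof. by rewrite dotC dotDl !(dotC u). Qed.

Lemma dotZl a u x : dot (a *: u) x = a * dot u x.
Proof. by rewrite !dotE -scalemxAl mxE. Qed.

Lemma dotZr a u x : dot u (a *: x) = a * dot u x.
Proof. by rewrite dotC dotZl dotC. Qed.

Lemma dotNl u x : dot (- u) x = - dot u x.
Proof. by rewrite -scaleN1r dotZl mulN1r. Qed.

Lemma dotNr u x : dot u (- x) = - dot u x.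
Proof. by rewrite dotC dotNl dotC. Qed.

Lemma dot0l x : dot 0 x = 0.
Proof. by rewrite -(scale0r (0 : V)) dotZl mul0r. Qed.

Lemma dot0r u : dot u 0 = 0.
Proof. by rewrite dotC dot0l. Qed.

Lemma dot_suml (J : Type) (r : seq J) (p : pred J) (f : J -> V) x :
  dot (\sum_(j <- r | p j) f j) x = \sum_(j <- r | p j) dot (f j) x.
Proof. by elim/big_rec2: _ => [|j a b _ <-]; rewrite ?dot0l ?dotDl. Qed.

Lemma dot_sumr (J : Type) (r : seq J) (p : pred J) (f : J -> V) u :
  dot u (\sum_(j <- r | p j) f j) = \sum_(j <- r | p j) dot u (f j).
Proof. by rewrite dotC dot_suml; apply: eq_bigr => j _; rewrite dotC. Qed.

Definition dotBE := (dotDl, dotDr, dotNl, dotNr, dotZl, dotZr, dot0l, dot0r).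

Lemma dot_self_ge0 x : 0 <= dot x x.
Proof. by apply: sumr_ge0 => i _; rewrite -expr2 sqr_ge0. Qed.

Lemma dot_self_eq0 x : dot x x = 0 -> x = 0.
Proof.
move=> xx0; apply/rowP => i; rewrite mxE.
have /psumr_eq0P/(_ xx0 i isT)/eqP : forall i, true -> 0 <= x 0 i * x 0 i.
  by move=> j _; rewrite -expr2 sqr_ge0.
by rewrite mulf_eq0 orbb => /eqP.
Qed.

Lemma dot_inj x y : (forall u, dot u x = dot u y) -> x = y.
Proof.
move=> xy; apply/eqP; rewrite -subr_eq0; apply/eqP/dot_self_eq0.
by rewrite dotDr dotNr xy subrr.
Qed.

(** The common form of all perturbations below: inequalities that are strict at a
    point, or tight there and improving in some direction, hold further on. *)
Lemma small_step (I : finType) (p r : I -> R) :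
  (forall i, 0 < p i \/ p i = 0 /\ 0 < r i) ->
  exists2 e : R, 0 < e & forall i, 0 < p i + e * r i.
Proof.
move=> pr.
have bnd i : exists2 e : R, 0 < e & forall e', 0 < e' <= e -> 0 < p i + e' * r i.
  case: (pr i) => [p0 | [-> r0]]; last first.
    by exists 1 => // e /andP[e0 _]; rewrite add0r mulr_gt0.
  have q0 : 0 < 1 + `|r i| by rewrite ltr_pwDl.
  exists (p i / (1 + `|r i|)); first by rewrite divr_gt0.
  move=> e /andP[e0]; rewrite ler_pdivlMr // mulrDr mulr1 => le.
  have := ler_norm (- r i); rewrite normrN => /(ler_wpM2l (ltW e0)).
  by rewrite mulrN; lra.
have /choice[e eP] : forall i, exists e : R,
    0 < e /\ forall e', 0 < e' <= e -> 0 < p i + e' * r i.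
  by move=> i; have [e e0 he] := bnd i; exists e.
have [s s0 sP] : exists2 s : R, 0 < s & forall i, s <= e i.
  exists (\big[Num.min/1]_i e i); last by move=> i; exact: bigmin_le_cond.
  by elim/big_ind: _ => // [x y x0 y0|i _]; [rewrite lt_min x0 | case: (eP i)].
by exists s => // i; case: (eP i) => _; apply; rewrite s0 sP.
Qed.

Lemma h_le P u x c : (forall y, P y -> c <= dot u y) -> P x -> h P u <= dot u x.
Proof.
by move=> cP Px; apply: ge_inf; [exists c => _ [y Py <-]; exact: cP | exists x].
Qed.

Lemma h_min P u x : P x -> (forall y, P y -> dot u x <= dot u y) ->
  h P u = dot u x.
Proof.
move=> Px xmin; apply/le_anti/andP; split; first exact: (h_le xmin).
by apply: lb_le_inf; [exists (dot u x), x | move=> _ [y Py <-]; exact: xmin].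
Qed.

Definition attains P := forall u, exists2 x, P x & forall y, P y -> dot u x <= dot u y.

Lemma attains_h P u x : attains P -> P x -> h P u <= dot u x.
Proof. by move=> /(_ u)[y _ ymin] Px; exact: (h_le ymin). Qed.

Lemma attains_face P u : attains P -> exists x, face P u x.
Proof. by move=> /(_ u)[x Px xmin]; exists x; split=> //; rewrite (h_min Px). Qed.

Lemma faceP P u x : attains P ->
  face P u x <-> P x /\ forall y, P y -> dot u x <= dot u y.
Proof.
move=> aP; split=> [[Px ->]|[Px xmin]]; last by split; rewrite ?(h_min Px xmin).
by split=> // y Py; exact: attains_h.
Qed.

Lemma face_eq P u x y : face P u x -> P y -> dot u y = dot u x -> face P u y.
Proof. by move=> [_ uh] Py uy; split=> //; rewrite uy. Qed.

Lemma attains_is_face P u : attains P -> is_face P (face P u).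
Proof. by move=> aP; split; [exact: attains_face | exists u]. Qed.

End Pairing.

(** * Separation *)

Section Separation.
Variables (R : realType).

(** Farkas' lemma, by removing one generator [a j]: a functional [u] that
    separates [b] from the other generators either does not separate [a j] and
    we are done, or allows to project everything along [a j] onto the
    hyperplane [u = 0]. *)
Lemma farkas n (I : finType) (W : {set I}) (a : I -> 'rV[R]_n) (b : 'rV[R]_n) :
  (exists2 l : I -> R, (forall i, i \in W -> 0 <= l i) &
     b = \sum_(i in W) l i *: a i) \/
  (exists2 u, (forall i, i \in W -> 0 <= dot u (a i)) & dot u b < 0).
Proof.
have [k] := ubnP #|W|; elim: k => // k IH in W a b *; rewrite ltnS => Wk.
have [->|[j jW]] := set_0Vmem W.
  have [->|b0] := eqVneq b 0.
    by left; exists (fun=> 0) => [i|]; rewrite ?inE // big_set0.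
  right; exists (- b) => [i|]; first by rewrite inE.
  rewrite dotNl oppr_lt0 lt_def dot_self_ge0 andbT.
  by apply: contraNneq b0 => /dot_self_eq0 ->.
have Wj : (#|W :\ j| < k)%N by rewrite (cardsD1 j) jW in Wk.
have [[l l0 ->]|[u ua ub]] := IH _ a b Wj.
  left; exists (fun i => if i == j then 0 else l i) => [i iW|].
    by case: eqVneq => // ij; apply: l0; rewrite !inE ij.
  rewrite [RHS](big_setD1 j) //= eqxx scale0r add0r.
  by apply: eq_bigr => i; rewrite !inE => /andP[/negbTE -> _].
have [uj|uj] := leP 0 (dot u (a j)).
  right; exists u => // i iW; have [-> //|ij] := eqVneq i j.
  by apply: ua; rewrite !inE ij.
pose pr x := x - (dot u x / dot u (a j)) *: a j.
have [[l l0 lb]|[v va vb]] := IH _ (pr \o a) (pr b) Wj.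
  left; pose c := dot u b / dot u (a j)
    - \sum_(i in W :\ j) l i * (dot u (a i) / dot u (a j)).
  exists (fun i => if i == j then c else l i) => [i iW|].
    case: eqVneq => ij; last by apply: l0; rewrite !inE ij.
    rewrite subr_ge0 (@le_trans _ _ 0) //; last first.
      by apply: mulr_le0; rewrite ?invr_le0 ltW.
    apply: sumr_le0 => m mW; rewrite mulr_ge0_le0 ?l0 //.
    by rewrite mulr_ge0_le0 ?ua // invr_le0 ltW.
  rewrite [RHS](big_setD1 j) //= eqxx.
  rewrite (eq_bigr (fun i => l i *: a i)); last first.
    by move=> i; rewrite !inE => /andP[/negbTE -> _].
  have -> : b = pr b + (dot u b / dot u (a j)) *: a j by rewrite subrK.
  rewrite lb scalerBl [RHS]addrC addrA addrAC; congr +%R.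
  rewrite scaler_suml -sumrB; apply: eq_bigr => i _.
  by rewrite scalerBr scalerA.
right; exists (v - (dot v (a j) / dot u (a j)) *: u) => [i iW|]; last first.
  by move: vb; rewrite !dotBE; lra.
have [->|ij] := eqVneq i j.
  by rewrite !dotBE divfK ?subrr // lt_eqF.
have : 0 <= dot v (pr (a i)) by apply: va; rewrite !inE ij.
by rewrite !dotBE; lra.
Qed.

Lemma dot_row_mx n m (u x : 'rV[R]_n) (v y : 'rV[R]_m) :
  dot (row_mx u v) (row_mx x y) = dot u x + dot v y.
Proof. by rewrite !dotE tr_row_mx mul_row_col mxE. Qed.

(** Farkas' lemma for the points [g i] lifted to height one. *)
Lemma conv_hull_separation n k (g : 'I_k -> 'rV[R]_n) (y : 'rV[R]_n) :
  ~ conv_hull g y -> exists u, forall i, dot u y < dot u (g i).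
Proof.
move=> gy; pose lift (x : 'rV[R]_n) : 'rV[R]_(1 + n) := row_mx 1%:M x.
have [[l l0 yl]|[u ua ub]] := farkas [set: 'I_k] (lift \o g) (lift y).
  case: gy; exists l; split=> [i||]; first by apply: l0; rewrite inE.
    have := congr1 (fun z : 'rV[R]_(1 + n) => lsubmx z 0 0) yl.
    rewrite row_mxKl mxE eqxx mulr1n => ->; rewrite linear_sum summxE.
    by apply: eq_big => i; rewrite ?inE //= linearZ /= row_mxKl !mxE mulr1.
  have := congr1 (fun z : 'rV[R]_(1 + n) => rsubmx z) yl.
  rewrite row_mxKr => ->; rewrite linear_sum.
  by apply: eq_big => i; rewrite ?inE //= linearZ /= row_mxKr.
move: ua ub; rewrite -(hsubmxK u) => ua ub; exists (rsubmx u) => i.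
have := ua i; rewrite inE => /(_ isT); move: ub; rewrite !dot_row_mx /=.
by lra.
Qed.

End Separation.

Section Polytopes.
Variables (R : realType) (n : nat).
Local Notation V := 'rV[R]_n.
Implicit Types (u v w x y : V) (P S Q : set V).

Lemma conv_hull_gen k (g : 'I_k -> V) i : conv_hull g (g i).
Proof.
exists (fun j => (j == i)%:R); split=> [j||]; first by rewrite ler0n.
  by rewrite -natr_sum (bigD1 i) //= eqxx big1 // => j /negbTE ->.
rewrite (bigD1 i) //= eqxx scale1r big1 ?addr0 // => j /negbTE ->.
by rewrite scale0r.
Qed.

Lemma conv_hull_dot_le k (g : 'I_k -> V) u c x :
  (forall i, c <= dot u (g i)) -> conv_hull g x -> c <= dot u x.
Proof.
move=> gc [l [l0 l1 ->]]; rewrite dot_sumr -[c]mul1r -l1 mulr_suml.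
by apply: ler_sum => i _; rewrite dotZr ler_wpM2l.
Qed.

Lemma conv_hull_min k (g : 'I_k -> V) u : conv_hull g !=set0 ->
  exists i, forall y, conv_hull g y -> dot u (g i) <= dot u y.
Proof.
move=> [x [l [l0 l1 _]]].
have [i0] : exists i : 'I_k, true.
  apply: contrapT => /forallNP k0; move: l1; rewrite big1 => [/eqP|i _].
    by rewrite eq_sym oner_eq0.
  by case: (k0 i).
move=> _; have [i _ imin] := Order.TotalTheory.arg_minP (fun i => dot u (g i)) (erefl : xpredT i0).
by exists i => y; apply: conv_hull_dot_le => j; exact: imin.
Qed.

Lemma polytope_attains P : polytope P -> attains P.
Proof.
move=> [P0 [k [g Pg]]] u; rewrite Pg in P0 *.
by have [i imin] := conv_hull_min u P0; exists (g i) => //; exact: conv_hull_gen.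
Qed.

Lemma polytope_halfspaces P y : polytope P ->
  P y <-> forall u, h P u <= dot u y.
Proof.
move=> pP; have aP := polytope_attains pP; split=> [Py u|yh].
  exact: attains_h.
have [_ [k [g Pg]]] := pP; rewrite Pg; apply: contrapT => /conv_hull_separation[u uy].
have [x [Px xh]] := attains_face u aP; have := yh u; rewrite -xh leNgt => /negP; apply.
have [i imin] : exists i, forall y, P y -> dot u (g i) <= dot u y.
  by rewrite Pg; apply: conv_hull_min; rewrite -Pg; exists x.
exact: lt_le_trans (uy i) (imin _ Px).
Qed.

(** A point of [P] outside the convex hull would be separated from all the
    [g i], one of which is minimal for the separating functional. *)
Lemma polytope_of_minimizers P k (g : 'I_k -> V) : P !=set0 ->
  conv_hull g `<=` P ->
  (forall u x, P x -> exists i, dot u (g i) <= dot u x) -> polytope P.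
Proof.
move=> P0 gP gmin; split=> //; exists k, g; apply/seteqP; split=> // x Px.
apply: contrapT => /conv_hull_separation[u ux].
by have [i] := gmin u x Px; rewrite leNgt ux.
Qed.

End Polytopes.

(** * Dimension, and a criterion for coarsening *)

Section Fans.
Variables (R : realType) (n : nat).
Local Notation V := 'rV[R]_n.
Implicit Types (u v w x y : V) (A P S Q : set V).

Lemma affdim_ge A d x0 (M : 'M[R]_(d, n)) : A x0 -> row_free M ->
  (forall i, A (x0 + row i M)) -> (d <= affdim A)%N.
Proof.
move=> Ax0 fM AM; have dn : (d < n.+1)%N.
  by rewrite ltnS -(eqP fM) rank_leq_col.
apply: (@leq_bigmax_cond _ _ (@nat_of_ord n.+1) (Ordinal dn)).
by apply/asboolP; exists x0, M.
Qed.

Lemma affdim_span A d x0 (M : 'M[R]_(d, n)) : A x0 -> row_free M ->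
  (forall i, A (x0 + row i M)) -> (forall y, A y -> (y - x0 <= M)%MS) ->
  affdim A = d.
Proof.
move=> Ax0 fM AM Asub; apply/eqP; rewrite eqn_leq (affdim_ge Ax0 fM AM) andbT.
apply/bigmax_leqP => -[k kn] /asboolP[/= x1 [N [Ax1 fN AN]]].
rewrite -(eqP fM) -(eqP fN); apply: mxrankS; apply/row_subP => i.
have -> : row i N = (x1 + row i N - x0) - (x1 - x0).
  by rewrite opprB addrA subrK addrAC subrr add0r.
by rewrite addmx_sub ?eqmx_opp ?Asub.
Qed.

Lemma affdim_line A x d : A x -> A (x + d) -> d != 0 ->
  (forall y, A y -> exists s : R, y = x + s *: d) -> affdim A = 1%N.
Proof.
move=> Ax Ad d0 Aline; apply: (affdim_span (x0 := x) (M := d)) => //.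
- by rewrite /row_free rank_rV d0.
- by move=> i; rewrite (ord1 i) row_id.
- by move=> y /Aline[s ->]; rewrite addrC addKr scalemx_sub.
Qed.

Definition finitely_attained P := exists (K : finType) (g : K -> V),
  (forall i, P (g i)) /\ forall u, exists i, forall y, P y -> dot u (g i) <= dot u y.

Lemma finitely_attained_attains P : finitely_attained P -> attains P.
Proof. by move=> [K [g [gP gmin]]] u; have [i imin] := gmin u; exists (g i). Qed.

Lemma normal_cone_face_self P u : normal_cone P (face P u) u.
Proof. by move=> x []. Qed.

(** The vector [u] lies in the relative interior of the normal cone of the face
    it selects. *)
Lemma normal_cone_face_interior P u w : finitely_attained P ->
  normal_cone P (face P u) w ->
  exists2 e : R, 0 < e & normal_cone P (face P u) (u - e *: w).
Proof.
move=> fP Nw; have aP := finitely_attained_attains fP.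
have [K [g [gP gmin]]] := fP.
have [z [Pz uz]] := attains_face u aP.
pose p i := if `[< face P u (g i) >] then 1 else dot u (g i) - h P u.
pose r i := if `[< face P u (g i) >] then 0 else h P w - dot w (g i).
have [i|e e0 eP] := small_step (p := p) (r := r).
  rewrite /p /r; case: asboolP => [_|ngi]; left; rewrite ?ltr01 // subr_gt0.
  rewrite lt_def attains_h // andbT; apply/eqP => ugi; exact: ngi.
exists e => // x ux; have [Px uxh] := ux.
apply/esym/h_min => // y Py; have [i imin] := gmin (u - e *: w) .
apply: le_trans (imin _ Py); rewrite !dotBE.
have := eP i; rewrite /p /r; case: asboolP => [ugi|ngi].
  by rewrite uxh ugi.2 (Nw _ ux) (Nw _ ugi).
by rewrite uxh (Nw _ ux); lra.
Qed.

(** If the support function of [Q] is linear on the cone [D] of the normal fan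
    of [P] having [u] in its relative interior, and [x] minimizes [u] on [Q],
    then [w |-> w . x - h Q w] is linear and nonnegative on [D] and vanishes at
    [u], hence everywhere on [D]. *)
Lemma deformation_of_PL P Q : finitely_attained P -> polytope Q ->
  PL (normal_fan P) (h Q) -> deformation P Q.
Proof.
move=> fP pQ lQ; have aP := finitely_attained_attains fP.
have aQ := polytope_attains pQ.
split=> // C [F [F0 [z Fz]] ->].
exists [set D | exists2 u, normal_cone Q F u & D = normal_cone P (face P u)].
  by move=> D [u _ ->]; exists (face P u) => //; exact: attains_is_face.
apply/seteqP; split=> [u Fu|w [D [u Fu ->] Dw]].
  by exists (normal_cone P (face P u)); [exists u | exact: normal_cone_face_self].
have [|x0 hQ] := lQ (normal_cone P (face P u)).
  by exists (face P u) => //; exact: attains_is_face.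
have [e e0 De] := normal_cone_face_interior fP Dw.
move=> y Fy; have Qy : Q y by rewrite Fz in Fy; case: Fy.
have uy := Fu y Fy; rewrite hQ in uy; last exact: normal_cone_face_self.
have := attains_h (u - e *: w) aQ Qy; rewrite hQ //.
have := attains_h w aQ Qy; rewrite !hQ // => wy.
rewrite !dotBE uy => ey; apply/eqP; rewrite eq_le wy andbT.
by rewrite -(ler_pM2l e0); lra.
Qed.

End Fans.

(** * Simple polytopes given by their facet inequalities *)

Section SimpleSystems.
Variables (R : realType) (n : nat) (L : set 'rV[R]_n) (J : finType).
Variable (u : J -> 'rV[R]_n).
Local Notation V := 'rV[R]_n.
Implicit Types (v w x y : V) (A c sig : {set J}) (b : J -> R) (S : set V).
Implicit Types (C : set {set J}).

Definition cone c : set V :=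
  [set w | exists2 l : J -> R, (forall j, j \in c -> 0 <= l j) &
     w = \sum_(j in c) l j *: u j].

(** A vertex [x] of the polytope given by the inequalities [b j <= u j . x],
    [j] in [A]: exactly those of [c] are tight at [x], their normals form a
    basis, and [d] is the dual basis, so that [d k] spans the edge of [x] on
    which all inequalities of [c] but the [k]-th stay tight. *)
Record cell A b c x (d : J -> V) : Prop := Cell {
  cell_sub : c \subset A;
  cell_dual : forall j k, j \in c -> k \in c -> dot (u j) (d k) = (j == k)%:R;
  cell_span : forall w, w = \sum_(j in c) dot w (d j) *: u j;
  cell_lattice : forall j, j \in c -> L (d j);
  cell_tight : forall j, j \in c -> dot (u j) x = b j;
  cell_strict : forall j, j \in A -> j \notin c -> b j < dot (u j) x }.

Record simple_system A b C S : Prop := SimpleSystem {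
  system_set : S = [set x | forall j, j \in A -> b j <= dot (u j) x];
  system_cell : forall c, C c -> exists x d, cell A b c x d;
  system_cover : forall w, exists2 c, C c & cone c w }.

Section Cell.
Variables (A : {set J}) (b : J -> R) (c : {set J}) (x : V) (d : J -> V).
Hypothesis cl : cell A b c x d.

Lemma cell_le j : j \in A -> b j <= dot (u j) x.
Proof.
move=> jA; have [jc|jc] := boolP (j \in c); first by rewrite (cell_tight cl).
exact/ltW/(cell_strict cl).
Qed.

Lemma cell_tight_in j : j \in A -> dot (u j) x = b j -> j \in c.
Proof.
by move=> jA jx; apply/negPn/negP => /(cell_strict cl jA); rewrite jx ltxx.
Qed.

Lemma coneP w : cone c w <-> forall j, j \in c -> 0 <= dot w (d j).
Proof.
split=> [[l l0 ->] k kc|wd]; last first.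
  by exists (fun j => dot w (d j)) => //; exact: (cell_span cl).
rewrite dot_suml (bigD1 k) //= dotZl (cell_dual cl) // eqxx mulr1 big1 ?addr0 ?l0 //.
move=> j /andP[jc jk].
by rewrite dotZl (cell_dual cl) // (negbTE jk) mulr0.
Qed.

Lemma cone_gen j : j \in c -> cone c (u j).
Proof. by move=> jc; apply/coneP => k kc; rewrite (cell_dual cl) // ler0n. Qed.

Lemma cell_dot w y : dot w y = \sum_(j in c) dot w (d j) * dot (u j) y.
Proof.
rewrite {1}(cell_span cl w) dot_suml.
by apply: eq_bigr => j _; rewrite dotZl.
Qed.

Lemma cone_cell_le w y : cone c w ->
  (forall j, j \in A -> b j <= dot (u j) y) -> dot w x <= dot w y.
Proof.
move=> /coneP wc yA; rewrite !(cell_dot w); apply: ler_sum => j jc.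
rewrite ler_wpM2l ?wc // (cell_tight cl) // yA //.
exact: (subsetP (cell_sub cl) _ jc).
Qed.

Lemma cone_linear_interpolation (f : V -> R) :
  (exists y, forall w, cone c w -> f w = dot w y) ->
  forall w, cone c w -> f w = \sum_(j in c) dot w (d j) * f (u j).
Proof.
move=> [y fy] w wc; rewrite (fy _ wc) (cell_dot w); apply: eq_bigr => j jc.
by rewrite fy //; exact: cone_gen.
Qed.

Lemma cell_expand y : y = \sum_(j in c) dot (u j) y *: d j.
Proof.
apply: dot_inj => w; rewrite (cell_dot w) dot_sumr; apply: eq_bigr => j _.
by rewrite dotZr mulrC.
Qed.

End Cell.

Section System.
Variables (A : {set J}) (b : J -> R) (C : set {set J}) (S : set V).
Hypothesis sys : simple_system A b C S.

Lemma systemP y : S y <-> forall j, j \in A -> b j <= dot (u j) y.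
Proof. by rewrite (system_set sys). Qed.

Lemma cell_mem c x d : cell A b c x d -> S x.
Proof. by move=> cl; apply/systemP => j; exact: (cell_le cl). Qed.

Lemma cone_min c x d w y : cell A b c x d -> cone c w -> S y -> dot w x <= dot w y.
Proof. by move=> cl wc /systemP; exact: (cone_cell_le cl wc). Qed.

Lemma system_finitely_attained : finitely_attained S.
Proof.
have /choice[x xP] (c : {set J}) : exists x, C c -> exists d, cell A b c x d.
  have [Cc|nC] := pselect (C c); last by exists 0.
  by have [x [d cl]] := system_cell sys Cc; exists x => _; exists d.
pose K : finType := {c : {set J} | `[< C c >]}.
exists K, (fun c : K => x (sval c)); split=> [[c /= /asboolP Cc]|w].
  by have [d cl] := xP c Cc; exact: (cell_mem cl).
have [c Cc wc] := system_cover sys w.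
exists (exist _ c (asboolT Cc)) => y Sy /=.
by have [d cl] := xP c Cc; exact: (cone_min cl wc Sy).
Qed.

Let aS := finitely_attained_attains system_finitely_attained.

(** A sum of functionals that have a common minimizer attains the sum of their
    minima exactly where each of them is minimal. *)
Lemma face_sum sig x0 : sig \subset A -> S x0 ->
  (forall j, j \in sig -> dot (u j) x0 = b j) ->
  h S (\sum_(j in sig) u j) = \sum_(j in sig) b j /\
  forall y, face S (\sum_(j in sig) u j) y <->
    S y /\ forall j, j \in sig -> dot (u j) y = b j.
Proof.
move=> sA Sx0 tx0; set w := \sum_(j in sig) u j.
have tw y : (forall j, j \in sig -> dot (u j) y = b j) ->
    dot w y = \sum_(j in sig) b j.
  by move=> ty; rewrite dot_suml; apply: eq_bigr.
have hw : h S w = \sum_(j in sig) b j.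
  rewrite -(tw _ tx0); apply: h_min => // y /systemP yA.
  rewrite tw // dot_suml; apply: ler_sum => j js; apply: yA.
  exact: (subsetP sA _ js).
split=> // y; split=> [[Sy yw]|[Sy ty]]; last by split; rewrite // hw tw.
split=> // j js; have /systemP yA := Sy.
have z0 : \sum_(k in sig) (dot (u k) y - b k) = 0.
  by rewrite sumrB -dot_suml yw hw subrr.
apply/eqP; rewrite -subr_eq0; apply/eqP.
apply: (psumr_eq0P _ z0) => // k ks; rewrite subr_ge0; apply: yA.
exact: (subsetP sA _ ks).
Qed.

Lemma cell_face c x d : cell A b c x d -> face S (\sum_(j in c) u j) = [set x].
Proof.
move=> cl; have [|||_ fP] := @face_sum c x; first exact: (cell_sub cl).
- exact: (cell_mem cl).
- exact: (cell_tight cl).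
apply/seteqP; split=> [y /fP[_ ty]|_ ->] /=; last first.
  by apply/fP; split; [exact: (cell_mem cl) | exact: (cell_tight cl)].
apply: dot_inj => w; rewrite !(cell_dot cl w); apply: eq_bigr => j jc.
by rewrite ty // (cell_tight cl).
Qed.

Lemma cell_is_face c x d : cell A b c x d -> is_face S [set x].
Proof. by move=> cl; rewrite -(cell_face cl); exact: attains_is_face. Qed.

Lemma vertex_cell y : vertex S y -> exists c d, C c /\ cell A b c y d.
Proof.
move=> [_ [w yw]]; have [c Cc wc] := system_cover sys w.
have [x [d cl]] := system_cell sys Cc; suff <- : x = y by exists c, d.
suff : [set y] x by [].
by rewrite yw; apply/faceP => //; split=> [|z]; [exact: (cell_mem cl) | exact: (cone_min cl wc)].
Qed.

(** The inequalities outside [c] are strict at [x], so a functional minimized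
    at [x] cannot decrease along an edge direction. *)
Lemma cell_normal_cone c x d : cell A b c x d -> normal_cone S [set x] = cone c.
Proof.
move=> cl; apply/seteqP; split=> [w Nw|w wc _ ->]; last first.
  by apply/esym/h_min => [|y]; [exact: (cell_mem cl) | exact: (cone_min cl wc)].
apply/(coneP cl) => k kc.
pose p j := if j \in A :\: c then dot (u j) x - b j else 1.
have [j|e e0 eP] := small_step (p := p) (r := fun j => dot (u j) (d k)).
  left; rewrite /p; case: ifP => //; rewrite inE => /andP[jc jA].
  by rewrite subr_gt0 (cell_strict cl).
have Se : S (x + e *: d k).
  apply/systemP => j jA; rewrite dotDr dotZr; have [jc|jc] := boolP (j \in c).
    by rewrite (cell_tight cl) // (cell_dual cl) // lerDl mulr_ge0 ?ler0n // ltW.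
  by have := eP j; rewrite /p inE jc jA /=; lra.
have := attains_h w aS Se; rewrite -(Nw x erefl) dotDr dotZr.
by rewrite lerDl pmulr_rge0.
Qed.

(** Every cone of the normal fan lies in the cone of a vertex, so linearity on
    the fan has to be checked there only. *)
Lemma normal_fan_cells (Phi : set V -> Prop) :
  (forall D D', D' `<=` D -> Phi D -> Phi D') ->
  (forall D, normal_fan S D -> Phi D) <-> (forall c, C c -> Phi (cone c)).
Proof.
move=> mono; split=> PhiP.
  move=> c Cc; have [x [d cl]] := system_cell sys Cc; apply: PhiP.
  by exists [set x]; [exact: cell_is_face cl | rewrite (cell_normal_cone cl)].
move=> _ [F [_ [w Fw]] ->]; have [c Cc wc] := system_cover sys w.
have [x [d cl]] := system_cell sys Cc; apply: mono (PhiP _ Cc).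
rewrite -(cell_normal_cone cl) => v Nv _ ->; apply: Nv; rewrite Fw.
by apply/faceP => //; split=> [|z]; [exact: (cell_mem cl) | exact: (cone_min cl wc)].
Qed.

Lemma PL_cells f : PL (normal_fan S) f <->
  forall c, C c -> exists y, forall w, cone c w -> f w = dot w y.
Proof.
apply: (normal_fan_cells (Phi := fun D => exists y, forall w, D w -> f w = dot w y)).
by move=> D D' DD [y fy]; exists y => w /DD; exact: fy.
Qed.

Lemma PLint_cells f : PLint L (normal_fan S) f <->
  forall c, C c -> exists2 y, L y & forall w, cone c w -> f w = dot w y.
Proof.
apply: (normal_fan_cells
  (Phi := fun D => exists2 y, L y & forall w, D w -> f w = dot w y)).
by move=> D D' DD [y Ly fy]; exists y => // w /DD; exact: fy.
Qed.

(** The edge leaving [x] in direction [d k] ends where the first inequality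
    that decreases along it becomes tight; some inequality decreases because
    [- d k] is a nonnegative combination of normals. *)
Lemma cell_edge c x d k : cell A b c x d -> k \in c ->
  exists t : R, [/\ 0 < t, S (x + t *: d k), vertex S (x + t *: d k) &
    exists e, [/\ edge S e, e x & e (x + t *: d k)]].
Proof.
move=> cl kc; have Sx := cell_mem cl.
pose M := [pred j | (j \in A) && (dot (u j) (d k) < 0)].
have dk0 : d k != 0.
  apply/eqP => dk0; have := cell_dual cl kc kc.
  by rewrite dk0 dot0r eqxx => /eqP; rewrite eq_sym oner_eq0.
have [j0 j0M] : exists j, M j.
  apply: contrapT => /forallNP nM.
  have [c' Cc' [l l0 dl]] := system_cover sys (- d k).
  have [x' [d' cl']] := system_cell sys Cc'.
  case/eqP: dk0; apply: dot_self_eq0; apply/eqP.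
  rewrite eq_le dot_self_ge0 andbT -oppr_ge0 -dotNl dl dot_suml.
  apply: sumr_ge0 => j jc'; rewrite dotZl mulr_ge0 ?l0 // leNgt.
  by apply/negP => jd; apply: (nM j); rewrite /M /= (subsetP (cell_sub cl') _ jc').
pose q j := (dot (u j) x - b j) / - dot (u j) (d k).
have [j1 /andP[j1A j1d] j1min] := Order.TotalTheory.arg_minP q j0M.
have j1c : j1 \notin c.
  by apply: contraTN j1d => j1c; rewrite (cell_dual cl) // -leNgt ler0n.
set t := q j1; have t0 : 0 < t.
  by rewrite divr_gt0 ?oppr_gt0 // subr_gt0 (cell_strict cl).
have tE : dot (u j1) (x + t *: d k) = b j1.
  by rewrite dotDr dotZr /t /q invrN mulrN mulNr divfK ?lt_eqF //; lra.
have Sy : S (x + t *: d k).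
  apply/systemP => j jA; rewrite dotDr dotZr; have [jd|jd] := leP 0 (dot (u j) (d k)).
    by rewrite (le_trans (cell_le cl jA)) // lerDl mulr_ge0 // ltW.
  have : t <= q j by apply: j1min; rewrite /M /= jA.
  by rewrite /q ler_pdivlMr ?oppr_gt0 //; lra.
pose c1 := c :\ k.
have c1A : c1 \subset A by rewrite (subset_trans _ (cell_sub cl)) // subsetDl.
have tline s : forall j, j \in c1 -> dot (u j) (x + s *: d k) = b j.
  move=> j; rewrite !inE => /andP[jk jc].
  by rewrite dotDr dotZr (cell_tight cl) // (cell_dual cl) // (negbTE jk) mulr0 addr0.
have tx : forall j, j \in c1 -> dot (u j) x = b j.
  by move=> j; rewrite !inE => /andP[_ jc]; exact: (cell_tight cl jc).
have line z : (forall j, j \in c1 -> dot (u j) z = b j) ->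
    z = x + (dot (u k) z - dot (u k) x) *: d k.
  move=> tz; rewrite -[LHS](subrK x) addrC {1}(cell_expand cl (z - x)).
  rewrite (big_setD1 k kc) /= big1 ?addr0 ?dotDr ?dotNr // => j jc1.
  by rewrite dotDr dotNr tz // tx // subrr scale0r.
exists t; split=> //.
  have [] := @face_sum (j1 |: c1) (x + t *: d k).
  - by apply/subsetP => j; rewrite in_setU1 => /predU1P[->|/(subsetP c1A)].
  - by [].
  - by move=> j; rewrite in_setU1 => /predU1P[->//|/(tline t)].
  move=> _ fP; split; first by exists (x + t *: d k).
  exists (\sum_(j in j1 |: c1) u j); apply/seteqP; split=> [_ ->|z /fP[_ tz]] /=.
    by apply/fP; split=> // j; rewrite in_setU1 => /predU1P[->//|/tline].
  have zE := line z (fun j jc1 => tz j (setU1r j1 jc1)).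
  have := tz j1 (setU11 _ _); rewrite -tE zE !dotDr !dotZr => /addrI.
  by move=> /(mulIf (negbT (lt_eqF j1d))) ->.
have [//|//|//|_ fP] := @face_sum c1 x.
exists (face S (\sum_(j in c1) u j)); split; [|by apply/fP|apply/fP; split=> //; exact: tline].
split; first exact: attains_is_face.
apply: (@affdim_line _ _ _ x (t *: d k)); first by apply/fP.
- by apply/fP; split=> //; exact: tline.
- by rewrite scaler_eq0 gt_eqF.
- move=> y /fP[_ ty]; exists ((dot (u k) y - dot (u k) x) / t).
  by rewrite scalerA divfK ?gt_eqF //; exact: line.
Qed.

End System.
End SimpleSystems.

(** * Truncating a face of a simple polytope *)

Section Stellar.
Variables (R : realType) (n : nat) (L : set 'rV[R]_n) (J : finType).
Variable (u : J -> 'rV[R]_n).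
Local Notation V := 'rV[R]_n.
Implicit Types (v w x y : V) (c : {set J}).

Lemma vertex_mem (S : set V) z : vertex S z -> S z.
Proof. by move=> [_ [v zv]]; have [] : face S v z by rewrite -zv. Qed.

Lemma gap_le (S F : set V) w y : attains S -> neighbor S F y ->
  gap S F w <= dot w y - h S w.
Proof.
move=> aS Fy; apply: ge_inf; last by exists y.
exists 0 => _ [z [Vz _ _] <-]; rewrite subr_ge0.
by apply: attains_h => //; exact: vertex_mem.
Qed.

Variables (A : {set J}) (b : J -> R) (C : set {set J}) (S F : set V).
Variables (sig c0 : {set J}) (f : J) (eps : R).
Hypothesis sys : simple_system L u A b C S.
Hypotheses (LB : forall x y, L x -> L y -> L (x - y)).
Hypotheses (Cc0 : C c0) (sc0 : sig \subset c0) (sig0 : sig != set0).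
Hypothesis uf : u f = \sum_(j in sig) u j.
(* A new normal, except when a facet is truncated: then its inequality is
   replaced by a stronger one. *)
Hypothesis fA : f \notin A \/ sig = [set f]%SET.
Hypothesis FP : forall y, F y <-> S y /\ forall j, j \in sig -> dot (u j) y = b j.
Hypothesis eps_gap : 0 < eps < gap S F (u f).

Definition stellar_cells : set {set J} := [set c |
  (C c /\ ~~ (sig \subset c)) \/
  exists c1 g, [/\ C c1, sig \subset c1, g \in sig & c = f |: (c1 :\ g)]].

Definition stellar_offset j := if j == f then \sum_(i in sig) b i + eps else b j.

Let aS := finitely_attained_attains (system_finitely_attained sys).

Let sA : sig \subset A.
Proof.
have [x [d cl]] := system_cell sys Cc0.
exact: subset_trans sc0 (cell_sub cl).
Qed.

Lemma stellar_h : h S (u f) = \sum_(j in sig) b j.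
Proof.
have [x [d cl]] := system_cell sys Cc0; rewrite uf.
have [|j js|//] := face_sum sys (sig := sig) (x0 := x) sA.
  exact: (cell_mem sys cl).
by rewrite (cell_tight cl) // (subsetP sc0).
Qed.

Lemma cell_unique c x d x' d' : cell L u A b c x d -> cell L u A b c x' d' -> x = x'.
Proof.
move=> cl cl'; apply: dot_inj => w; rewrite !(cell_dot cl w).
by apply: eq_bigr => j jc; rewrite (cell_tight cl) // (cell_tight cl').
Qed.

Lemma cell_mem_face c x d : cell L u A b c x d -> F x <-> sig \subset c.
Proof.
move=> cl; split=> [/FP[_ tx]|sc]; last first.
  apply/FP; split=> [|j js]; first exact: (cell_mem sys cl).
  by rewrite (cell_tight cl) // (subsetP sc).
apply/subsetP => j js.
by apply: (cell_tight_in cl); [exact: (subsetP sA) | exact: tx].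
Qed.

(** As in the simplex method: a vertex off the face has an edge along which
    [u f] decreases; the lowest vertex off the face is therefore adjacent to
    the face, and [gap] bounds the height of every vertex off the face. *)
Lemma stellar_gap c x d : C c -> cell L u A b c x d -> ~~ (sig \subset c) ->
  h S (u f) + gap S F (u f) <= dot (u f) x.
Proof.
have /choice[X XP] (c' : {set J}) : exists x, C c' -> exists d, cell L u A b c' x d.
  have [Cc|nC] := pselect (C c'); last by exists 0.
  by have [z [e cl]] := system_cell sys Cc; exists z => _; exists e.
pose off (c' : {set J}) := `[< C c' >] && ~~ (sig \subset c').
suff low c' : off c' -> h S (u f) + gap S F (u f) <= dot (u f) (X c').
  move=> Cc cl sc; have [d' cl'] := XP c Cc; rewrite (cell_unique cl cl').
  by apply: low; apply/andP; split=> //; apply/asboolP.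
move=> offc; have := Order.TotalTheory.arg_minP (fun c' => dot (u f) (X c')) offc.
move=> [m /andP[/asboolP Cm sm] mmin]; apply: le_trans (mmin _ offc).
have [dm cl] := XP m Cm; set y := X m in cl mmin *.
have [x1 [d1 cl1]] := system_cell sys Cc0.
have hx1 : h S (u f) = dot (u f) x1.
  rewrite stellar_h uf dot_suml; apply: eq_bigr => j js.
  by rewrite (cell_tight cl1) // (subsetP sc0).
have nFy : ~ F y by move/(cell_mem_face cl); rewrite (negbTE sm).
have hy : h S (u f) < dot (u f) y.
  rewrite lt_def (attains_h (u f) aS (cell_mem sys cl)) andbT; apply/eqP => yh; apply: nFy.
  apply/FP; split=> [|j js]; first exact: (cell_mem sys cl).
  have [i i_s|_ fP] := face_sum sys sA (cell_mem sys cl1).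
    by rewrite (cell_tight cl1) // (subsetP sc0).
  have : face S (u f) y by split=> //; exact: (cell_mem sys cl).
  by rewrite uf => /fP[_]; exact.
have [k kc kd] : exists2 k, k \in m & dot (u f) (dm k) < 0.
  apply: contrapT => nk; have : cone u m (u f).
    apply/(coneP cl) => k km; rewrite leNgt; apply/negP => kd; apply: nk.
    by exists k.
  move=> /(cone_min sys cl)/(_ (cell_mem sys cl1)).
  by rewrite -hx1 leNgt hy.
have [t [t0 Sz Vz [e [ee ey ez]]]] := cell_edge sys cl kc.
set z := y + t *: dm k in Sz Vz ez.
have zy : dot (u f) z < dot (u f) y.
  by rewrite dotDr dotZr gtrDl pmulr_rlt0.
have [c2 [d2 [Cc2 cl2]]] := vertex_cell sys Vz.
have [sc2|sc2] := boolP (sig \subset c2); last first.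
  have off2 : off c2 by apply/andP; split=> //; apply/asboolP.
  have := mmin _ off2; have [d3 cl3] := XP c2 Cc2.
  by rewrite -(cell_unique cl2 cl3) leNgt zy.
rewrite -lerBrDl; apply: gap_le => //; split=> //.
  by have := cell_is_face sys cl.
by exists z, e; split=> //; apply/(cell_mem_face cl2).
Qed.

(** Replacing [g] by [f] in [c] amounts to sliding the vertex along the edge
    [d g] until the new inequality becomes tight; the dual basis changes by an
    integral triangular transformation. *)
Lemma stellar_cell c x d g : C c -> cell L u A b c x d -> sig \subset c -> g \in sig ->
  cell L u (f |: A) stellar_offset (f |: (c :\ g)) (x + eps *: d g)
    (fun k => if k == f then d g else d k - (k \in sig)%:R *: d g).
Proof.
move=> Cc cl sc gs; have gc := subsetP sc _ gs.
have [eps0 eps_lt] := andP eps_gap.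
have [t [t0 Sy Vy [e [ee ex ey]]]] := cell_edge sys cl gc.
have ufd k : k \in c -> dot (u f) (d k) = (k \in sig)%:R.
  move=> kc; rewrite uf dot_suml; have [ks|ks] := boolP (k \in sig).
    rewrite (bigD1 k) //= (cell_dual cl) // eqxx big1 ?addr0 // => j /andP[js jk].
    by rewrite (cell_dual cl (subsetP sc _ js) kc) (negbTE jk).
  rewrite big1 // => j js; rewrite (cell_dual cl (subsetP sc _ js) kc).
  by case: eqVneq => // jk; rewrite -jk js in ks.
have ufx : dot (u f) x = \sum_(j in sig) b j.
  rewrite uf dot_suml; apply: eq_bigr => j js.
  by rewrite (cell_tight cl) // (subsetP sc).
have eps_t : eps < t.
  have nFy : ~ F (x + t *: d g).
    move=> /FP[_ /(_ _ gs)/eqP]; rewrite dotDr dotZr (cell_tight cl) //.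
    by rewrite (cell_dual cl) // eqxx mulr1 eq_sym addrC -subr_eq subrr lt_eqF.
  have : neighbor S F (x + t *: d g).
    split=> //; exists x, e; split=> //; first by have := cell_is_face sys cl.
    exact/(cell_mem_face cl).
  move=> /(gap_le (u f) aS); rewrite stellar_h dotDr dotZr ufx ufd // gs mulr1.
  by rewrite addrC addKr; exact: lt_le_trans.
have fc1 : f \notin c :\ g.
  case: fA => [fA'|sf]; last by rewrite sf inE in gs; rewrite (eqP gs) !inE eqxx.
  by rewrite !inE negb_and (contra (subsetP (cell_sub cl) _) fA') orbT.
have c1f j : j \in c :\ g -> [/\ j != g, j \in c & (j == f) = false].
  move=> jc; move: (jc); rewrite !inE => /andP[jg jc']; split=> //.
  by apply: contraNF fc1 => /eqP <-.
split.
- apply: setUS; apply: subset_trans (cell_sub cl); exact: subsetDl.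
- move=> j k; rewrite !in_setU1 => /orP[/eqP -> | jc] /orP[/eqP -> | kc].
  + by rewrite !eqxx ufd // gs.
  + have [kg kc' kf] := c1f _ kc; rewrite kf eq_sym kf dotDr dotNr dotZr !ufd // gs.
    by rewrite mulr1 subrr.
  + have [jg jc' jf] := c1f _ jc.
    by rewrite eqxx jf (cell_dual cl) // (negbTE jg).
  + have [jg jc' jf] := c1f _ jc; have [kg kc' kf] := c1f _ kc.
    rewrite kf dotDr dotNr dotZr !(cell_dual cl) // (negbTE jg).
    by rewrite mulr0 subr0.
- move=> w; rewrite big_setU1 //= eqxx.
  rewrite (eq_bigr (fun k => dot w (d k) *: u k -
      dot w (d g) *: ((k \in sig)%:R *: u k))); last first.
    move=> k /c1f[_ _ kf]; rewrite kf dotDr dotNr dotZr scalerBl; congr (_ - _).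
    by rewrite scalerA mulrC.
  rewrite sumrB -scaler_sumr addrCA -scalerBr.
  have -> : u f - \sum_(k in c :\ g) (k \in sig)%:R *: u k = u g.
    apply/eqP; rewrite subr_eq; apply/eqP; rewrite uf (big_setD1 g gs) /=.
    congr +%R; rewrite big_mkcond [RHS]big_mkcond /=; apply: eq_bigr => k _.
    rewrite !inE; case: (k == g) => //=; case: (boolP (k \in sig)) => [ks|_].
      by rewrite (subsetP sc) // scale1r.
    by rewrite scale0r if_same.
  by rewrite addrC [LHS](cell_span cl w) (big_setD1 g gc).
- move=> k; rewrite in_setU1 => /orP[/eqP -> | kc].
    by rewrite eqxx; exact: (cell_lattice cl).
  have [kg kc' ->] := c1f _ kc; case: (k \in sig).
    by rewrite scale1r; apply: LB; exact: (cell_lattice cl).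
  by rewrite scale0r subr0; exact: (cell_lattice cl).
- move=> k; rewrite /stellar_offset in_setU1 dotDr dotZr => /orP[/eqP -> | kc].
    by rewrite eqxx ufx ufd // gs mulr1.
  have [kg kc' ->] := c1f _ kc.
  by rewrite (cell_tight cl) // (cell_dual cl) // (negbTE kg) mulr0 addr0.
- move=> j; rewrite /stellar_offset !inE negb_or.
  case: (eqVneq j f) => //= jf jA; rewrite negb_and negbK dotDr dotZr.
  have [->|jg] //= := eqVneq j g.
    by rewrite (cell_tight cl) // (cell_dual cl) // eqxx mulr1 ltrDl.
  move=> jc; have lo := cell_strict cl jA jc.
  have /(systemP sys)/(_ j jA) := Sy; rewrite dotDr dotZr => hi; rewrite -subr_gt0 -(pmulr_rgt0 _ t0).
  have : 0 < (t - eps) * (dot (u j) x - b j).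
    by apply: mulr_gt0; rewrite subr_gt0.
  have : 0 <= eps * (dot (u j) x + t * dot (u j) (d g) - b j).
    by apply: mulr_ge0; rewrite ?subr_ge0 // ltW.
  by lra.
Qed.

Lemma stellar_system :
  simple_system L u (f |: A) stellar_offset stellar_cells (truncation S (u f) eps).
Proof.
have [eps0 eps_lt] := andP eps_gap.
split.
- apply/seteqP; split=> y; rewrite /truncation /= stellar_h /stellar_offset.
    move=> [Sy fy] j; rewrite in_setU1 => /orP[/eqP -> | jA]; first by rewrite eqxx.
    by case: eqVneq => [-> // | _]; have /(systemP sys) := Sy; exact.
  move=> yA; have fy := yA f (setU11 _ _); rewrite eqxx in fy; split=> //.
  apply/(systemP sys) => j jA; have := yA j (setU1r _ jA).
  case: eqVneq => // jf; case: fA => [|sf]; first by rewrite -jf jA.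
  by rewrite sf big_set1 -jf; apply: le_trans; rewrite lerDl ltW.
- move=> c [[Cc sc]|[c1 [g [Cc1 sc1 gs ->]]]]; last first.
    have [x [d cl]] := system_cell sys Cc1.
    by exists (x + eps *: d g); eexists; exact: (stellar_cell Cc1 cl).
  have [x [d cl]] := system_cell sys Cc; exists x, d.
  have cf j : j \in c -> (j == f) = false.
    move=> jc; apply/negP => /eqP jf; rewrite jf in jc.
    case: fA => [/negP|sf]; first by apply; exact: (subsetP (cell_sub cl)).
    by rewrite sf sub1set jc in sc.
  case: (cl) => cs cd cw cL ct cst; split=> //.
  + by apply: subset_trans cs _; exact: subsetUr.
  + by move=> j jc; rewrite /stellar_offset cf // ct.
  + move=> j; rewrite /stellar_offset in_setU1.
    case: eqVneq => /= [-> _ _|_ jA]; last exact: cst.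
    have := stellar_gap Cc cl sc; rewrite stellar_h; apply: lt_le_trans.
    by rewrite ltrD2l.
- move=> w; have [c Cc wc] := system_cover sys w.
  have [sc|sc] := boolP (sig \subset c); last by exists c => //; left.
  have [x [d cl]] := system_cell sys Cc.
  have [g0 g0s] := set0Pn _ sig0.
  have [g gs gmin] := Order.TotalTheory.arg_minP (fun j => dot w (d j)) g0s.
  exists (f |: (c :\ g)); first by right; exists c, g.
  have wd := coneP cl w; have {wd}wd := wd.1 wc.
  apply/(coneP (stellar_cell Cc cl sc gs)) => k; case: eqVneq => [_ _|kf].
    by apply: wd; exact: (subsetP sc).
  rewrite !inE (negbTE kf) /= => /andP[kg kc]; rewrite dotDr dotNr dotZr.
  have [ks|_] := boolP (k \in sig); first by rewrite mul1r subr_ge0; exact: gmin.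
  by rewrite mul0r subr0 wd.
Qed.

End Stellar.

(** * Extreme generators of pointed cones *)

Section Extreme.
Variables (R : realType) (n : nat) (I : finType).
Local Notation V := 'rV[R]_n.
Implicit Types (x y z f : V) (w : I -> V) (W K : {set I}).

Lemma coneD w K x y : cone w K x -> cone w K y -> cone w K (x + y).
Proof.
move=> [l l0 ->] [m m0 ->]; exists (fun i => l i + m i) => [i iK|].
  by rewrite addr_ge0 ?l0 ?m0.
by rewrite -big_split; apply: eq_bigr => i _; rewrite scalerDl.
Qed.

Lemma coneZ w K (a : R) x : 0 <= a -> cone w K x -> cone w K (a *: x).
Proof.
move=> a0 [l l0 ->]; exists (fun i => a * l i) => [i iK|].
  by rewrite mulr_ge0 ?l0.
by rewrite scaler_sumr; apply: eq_bigr => i _; rewrite scalerA.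
Qed.

Lemma cone_mem w K i : i \in K -> cone w K (w i).
Proof.
move=> iK; exists (fun j => (j == i)%:R) => [j _|]; first by rewrite ler0n.
rewrite (bigD1 i) //= eqxx scale1r big1 ?addr0 // => j /andP[_ /negbTE ->].
by rewrite scale0r.
Qed.

Lemma cone_trans w K K' x :
  (forall k, k \in K -> cone w K' (w k)) -> cone w K x -> cone w K' x.
Proof.
move=> KK' [l l0 ->]; elim/big_ind: _ => [|y z|k kK]; first last.
- by apply: coneZ; [exact: l0 | exact: KK'].
- exact: coneD.
- by exists (fun=> 0) => //; rewrite big1 // => i _; rewrite scale0r.
Qed.

Lemma cone_dot_ge0 w K z x : (forall k, k \in K -> 0 <= dot z (w k)) ->
  cone w K x -> 0 <= dot z x.
Proof.
move=> z0 [l l0 ->]; rewrite dot_sumr; apply: sumr_ge0 => k kK.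
by rewrite dotZr mulr_ge0 ?l0 ?z0.
Qed.

Lemma cone_inhabited w K x : cone w K x -> x != 0 -> exists k, k \in K.
Proof.
move=> [l _ ->] x0; apply: contrapT => nK; case/eqP: x0; rewrite big1 // => k kK.
by case: nK; exists k.
Qed.

(** In a combination that lies on the supporting hyperplane, the generators off
    this hyperplane have coefficient zero. *)
Lemma cone_support w K z x : (forall k, k \in K -> 0 <= dot z (w k)) ->
  cone w K x -> dot z x = 0 -> cone w [set k in K | dot z (w k) == 0]%SET x.
Proof.
move=> z0 [l l0 ->]; rewrite dot_sumr => s0.
have term k : k \in K -> 0 <= dot z (l k *: w k).
  by move=> kK; rewrite dotZr mulr_ge0 ?l0 ?z0.
exists l => [k|]; first by rewrite inE => /andP[kK _]; exact: l0.
rewrite big_mkcond [RHS]big_mkcond; apply: eq_bigr => k _; rewrite inE.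
case: (boolP (k \in K)) => //= kK; case: eqP => // zk.
have /eqP := psumr_eq0P term s0 kK.
by rewrite dotZr mulf_eq0 (introF eqP zk) orbF => /eqP ->; rewrite scale0r.
Qed.

Lemma cone_support_inhabited w K z x : (forall k, k \in K -> 0 <= dot z (w k)) ->
  cone w K x -> dot z x = 0 -> x != 0 -> exists2 k, k \in K & dot z (w k) = 0.
Proof.
move=> z0 xK zx /(cone_inhabited (cone_support z0 xK zx))[k].
by rewrite inE => /andP[kK /eqP zk]; exists k.
Qed.

(** A minimal generating subset works: no generator in it lies in the cone of
    the others, so Farkas' lemma separates it from them, and adding a multiple
    of [f] makes the separating functional vanish on it. *)
Lemma extreme_generators w W f : (forall i, i \in W -> 0 < dot f (w i)) ->
  exists K, [/\ K \subset W, forall i, i \in W -> cone w K (w i) &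
    forall j, j \in K -> exists z, [/\ dot z (w j) = 0,
      forall i, i \in W -> 0 <= dot z (w i) &
      forall i, i \in W -> dot z (w i) = 0 -> exists c, w i = c *: w j]].
Proof.
move=> fW.
pose gens K := (K \subset W) && `[< forall i, i \in W -> cone w K (w i) >].
have gW : gens W.
  by rewrite /gens subxx; apply/asboolP => i; exact: cone_mem.
have [K gK Kmin] := arg_minnP (fun K : {set I} => #|K|) gW.
have [KW /asboolP Kgen] := andP gK; exists K; split=> // j jK.
have nj : ~ cone w (K :\ j) (w j).
  move=> cj; have : gens (K :\ j).
    apply/andP; split; first exact: subset_trans (subsetDl _ _) KW.
    apply/asboolP => i /Kgen; apply: cone_trans => k kK.
    have [-> //|kj] := eqVneq k j.
    by apply: cone_mem; rewrite !inE kj.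
  by move=> /Kmin; rewrite (cardsD1 j K) jK ltnn.
have [//|[v vK vj]] := farkas (K :\ j) w (w j).
have fj : 0 < dot f (w j) by apply: fW; exact: (subsetP KW).
pose s := - dot v (w j) / dot f (w j); pose z := v + s *: f.
have s0 : 0 < s by rewrite divr_gt0 // oppr_gt0.
have zj : dot z (w j) = 0 by rewrite !dotBE divfK ?gt_eqF // subrr.
have zK k : k \in K -> k != j -> 0 < dot z (w k).
  move=> kK kj; rewrite !dotBE ltr_wpDl ?vK ?inE ?kj // mulr_gt0 // fW //.
  exact: (subsetP KW).
have zK0 k : k \in K -> 0 <= dot z (w k).
  by move=> kK; have [->|/(zK _ kK)/ltW //] := eqVneq k j; rewrite zj.
exists z; split=> // [i /Kgen|i /Kgen Ki zi]; first exact: cone_dot_ge0.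
have [l _ ->] := cone_support zK0 Ki zi; exists (l j); apply: big_pred1 => k.
rewrite inE /=; have [->|kj] := eqVneq k j; first by rewrite jK zj eqxx.
by apply: contraNF kj => /andP[kK zk]; apply: contraLR zk => kj; rewrite gt_eqF ?zK.
Qed.

Lemma generic_functional w : (forall i, w i != 0) ->
  exists f, forall i, dot f (w i) != 0.
Proof.
move=> w0; suff [f fP] : exists f, forall i, i \in enum I -> dot f (w i) != 0.
  by exists f => i; apply: fP; rewrite mem_enum.
elim: (enum I) => [|j s [f fs]]; first by exists 0.
have [fj|fj] := eqVneq (dot f (w j)) 0; last first.
  by exists f => i; rewrite inE => /orP[/eqP ->|/fs].
have [i|e e0 eP] := @small_step R I
    (fun i => if i \in s then `|dot f (w i)| else 1)
    (fun i => if i \in s then - `|dot (w j) (w i)| else 0).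
  by left; case: ifP => // /fs; rewrite normr_gt0.
exists (f + e *: w j) => i; rewrite inE !dotBE => /orP[/eqP ->|i_s].
  rewrite fj add0r mulf_neq0 ?gt_eqF //.
  by rewrite lt_def dot_self_ge0 andbT; apply: contraNneq (w0 j) => /dot_self_eq0 ->.
apply: contraTneq (eP i); rewrite i_s => /eqP; rewrite addr_eq0 => /eqP ->.
by rewrite normrN normrM gtr0_norm // mulrN subrr ltxx.
Qed.

End Extreme.

(** * Faces of zonotopes *)

Section Zonotope.
Variables (R : realType) (n : nat) (I : finType) (E : I -> 'rV[R]_n * 'rV[R]_n).
Local Notation V := 'rV[R]_n.
Implicit Types (u v x y z f : V) (a b W : {set I}).

(** A set [a] of segments encodes a choice of one endpoint [en a i] of every
    segment; [wv a i] points from it to the other endpoint. *)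
Definition en a i : V := if i \in a then (E i).2 else (E i).1.
Definition wv a i : V := if i \in a then (E i).1 - (E i).2 else (E i).2 - (E i).1.
Definition vtx a W : V := \sum_(i in W) en a i.

(** [u] attains its minimum over the zonotope of [W] at [vtx a W] only. *)
Definition selects u a W := forall i, i \in W -> 0 < dot u (wv a i).
Definition weakly_selects u a W := forall i, i \in W -> 0 <= dot u (wv a i).

Lemma selectsW u a W : selects u a W -> weakly_selects u a W.
Proof. by move=> ua i /ua/ltW. Qed.

Lemma wv_same a b i : (i \in a) = (i \in b) -> wv a i = wv b i.
Proof. by rewrite /wv => ->. Qed.

Lemma wv_opp a b i : (i \in a) != (i \in b) -> wv a i = - wv b i.
Proof. by rewrite /wv; case: (i \in a); case: (i \in b); rewrite //= opprB. Qed.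

Lemma wv_eq_or_opp a b i : wv a i = wv b i \/ wv a i = - wv b i.
Proof.
have [/wv_same|/wv_opp] := eqVneq (i \in a) (i \in b); by [left | right].
Qed.

Lemma segmentP a i x :
  segment (E i) x <-> exists2 t : R, 0 <= t <= 1 & x = en a i + t *: wv a i.
Proof.
rewrite /segment /en /wv; case: (i \in a); split=> [[t /= t01 <-]|[t t01 ->]] /=.
- exists (1 - t); first by move: t01 => /andP[t0 t1]; apply/andP; split; lra.
  by apply/rowP => j; rewrite !mxE; ring.
- exists (1 - t); first by move: t01 => /andP[t0 t1]; apply/andP; split; lra.
  by apply/rowP => j; rewrite !mxE; ring.
- by exists t => //; apply/rowP => j; rewrite !mxE; ring.
- by exists t => //; apply/rowP => j; rewrite !mxE; ring.
Qed.

Lemma zonotopeP a W x : zonotope E W x <-> exists t : I -> R,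
  (forall i, i \in W -> 0 <= t i <= 1) /\ x = vtx a W + \sum_(i in W) t i *: wv a i.
Proof.
split=> [[y [yW ->]]|[t [tW ->]]].
  have /choice[t tP] : forall i, exists t : R, i \in W ->
      0 <= t <= 1 /\ y i = en a i + t *: wv a i.
    move=> i; have [iW|iW] := boolP (i \in W); last by exists 0.
    by have /(segmentP a)[t t01 ->] := yW i iW; exists t.
  exists t; split=> [i /tP[]//|]; rewrite /vtx -big_split.
  by apply: eq_bigr => i /tP[].
exists (fun i => en a i + t i *: wv a i); split=> [i iW|]; last by rewrite big_split.
by apply/(segmentP a); exists (t i); rewrite ?tW.
Qed.

Lemma zonotope_vtx a W : zonotope E W (vtx a W).
Proof.
apply/(zonotopeP a); exists (fun=> 0); split=> [i _|]; first by rewrite lexx ler01.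
by rewrite big1 ?addr0 // => i _; rewrite scale0r.
Qed.

Lemma zonotope_vtx_wv a W i (t : R) : i \in W -> 0 <= t <= 1 ->
  zonotope E W (vtx a W + t *: wv a i).
Proof.
move=> iW t01; apply/(zonotopeP a); exists (fun j => if j == i then t else 0).
split=> [j _|]; first by case: ifP; rewrite ?t01 // lexx ler01.
rewrite (bigD1 i) //= eqxx big1 ?addr0 // => j /andP[_ /negbTE ->].
by rewrite scale0r.
Qed.

Lemma zonotope_vtx_min u a W y : weakly_selects u a W -> zonotope E W y ->
  dot u (vtx a W) <= dot u y.
Proof.
move=> ua /(zonotopeP a)[t [t01 ->]]; rewrite dotDr lerDl dot_sumr.
apply: sumr_ge0 => i iW; rewrite dotZr mulr_ge0 ?ua //.
by have /andP[] := t01 i iW.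
Qed.

Lemma zonotope_h u a W : weakly_selects u a W ->
  h (zonotope E W) u = dot u (vtx a W).
Proof.
by move=> ua; apply: h_min => [|y]; [exact: zonotope_vtx | exact: zonotope_vtx_min].
Qed.

Lemma zonotope_face u a W x : weakly_selects u a W ->
  face (zonotope E W) u x <-> exists t : I -> R,
   [/\ forall i, i \in W -> 0 <= t i <= 1,
       forall i, i \in W -> t i * dot u (wv a i) = 0 &
       x = vtx a W + \sum_(i in W) t i *: wv a i].
Proof.
move=> ua; rewrite /face /= (zonotope_h ua); split=> [[/(zonotopeP a)[t [t01 xt]] xu]|].
  exists t; split=> // i iW.
  have : dot u (\sum_(i in W) t i *: wv a i) = 0.
    by move: xu; rewrite xt dotDr; lra.
  rewrite dot_sumr => /psumr_eq0P/(_ i iW); rewrite dotZr; apply=> j jW.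
  by rewrite dotZr mulr_ge0 ?ua //; have /andP[] := t01 j jW.
move=> [t [t01 t0 ->]]; split; first by apply/(zonotopeP a); exists t.
rewrite dotDr [X in _ + X]dot_sumr big1 ?addr0 // => i iW.
by rewrite dotZr t0.
Qed.

Definition orient u : {set I} := [set i | dot u ((E i).2 - (E i).1) < 0]%SET.

Lemma orient_selects u W : weakly_selects u (orient u) W.
Proof.
move=> i _; rewrite /wv inE; case: ltP => // /ltW.
by rewrite -oppr_ge0 -dotNr opprB.
Qed.

Lemma zonotope_finitely_attained W : finitely_attained (zonotope E W).
Proof.
exists {set I}, (fun a => vtx a W); split=> [a|u]; first exact: zonotope_vtx.
by exists (orient u) => y; apply: zonotope_vtx_min; exact: orient_selects.
Qed.

Lemma zonotope_attains W : attains (zonotope E W).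
Proof. exact: finitely_attained_attains (zonotope_finitely_attained W). Qed.

Lemma selects_face u a W : selects u a W -> face (zonotope E W) u = [set vtx a W].
Proof.
move=> ua; apply/seteqP; split=> [x /(zonotope_face _ (selectsW ua))|_ ->].
  move=> [t [_ t0 ->]] /=; rewrite big1 ?addr0 // => i iW.
  have /eqP := t0 i iW; rewrite mulf_eq0 (gt_eqF (ua i iW)) orbF => /eqP ->.
  by rewrite scale0r.
by split; [exact: zonotope_vtx | rewrite (zonotope_h (selectsW ua))].
Qed.

Lemma selects_vertex u a W : selects u a W -> vertex (zonotope E W) (vtx a W).
Proof.
move=> ua; rewrite /vertex -(selects_face ua); apply: attains_is_face.
exact: zonotope_attains.
Qed.

Lemma face_weakly_selects u a W :
  face (zonotope E W) u (vtx a W) -> weakly_selects u a W.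
Proof.
move=> /(faceP _ _ (zonotope_attains W))[_ vmin] i iW.
have := vmin _ (zonotope_vtx_wv a iW (t := 1) _).
by rewrite ler01 lexx scale1r dotDr lerDl; exact.
Qed.

Lemma weakly_selects_face u a W :
  weakly_selects u a W -> face (zonotope E W) u (vtx a W).
Proof. by move=> ua; split; [exact: zonotope_vtx | rewrite (zonotope_h ua)]. Qed.

Lemma wv_neq0 a i : (E i).1 != (E i).2 -> wv a i != 0.
Proof. by rewrite /wv; case: ifP; rewrite subr_eq0 // eq_sym. Qed.

Hypothesis E_nondeg : forall i, (E i).1 != (E i).2.

Lemma vertex_selects v W : vertex (zonotope E W) v ->
  exists a u, selects u a W /\ v = vtx a W.
Proof.
move=> [_ [u vu]]; have ua := @orient_selects u W; set a := orient u in ua.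
have va : vtx a W = v.
  suff : [set v] (vtx a W) by [].
  by rewrite vu; exact: weakly_selects_face.
exists a, u; split=> // i iW; rewrite lt_def ua // andbT; apply/eqP => ui.
have : face (zonotope E W) u (vtx a W + 1 *: wv a i).
  apply: (face_eq (x := vtx a W)); first exact: weakly_selects_face.
    by apply: zonotope_vtx_wv; rewrite // ler01 lexx.
  by rewrite dotDr dotZr ui mulr0 addr0.
rewrite -vu va scale1r /= -[X in _ = X]addr0 => /addrI/eqP.
by apply/negP; exact: wv_neq0.
Qed.

(** Every functional is a limit of functionals that select a vertex. *)
Lemma weakly_selects_chamber u : exists a f,
  selects f a [set: I] /\ weakly_selects u a [set: I].
Proof.
have [f fP] := @generic_functional _ _ _ (wv set0) (fun i => wv_neq0 _ (E_nondeg i)).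
pose a : {set I} := [set i | (dot u (wv set0 i) < 0) ||
  (dot u (wv set0 i) == 0) && (dot f (wv set0 i) < 0)]%SET.
have w0 i : wv set0 i = (E i).2 - (E i).1 by rewrite /wv inE.
have ua i : 0 < dot u (wv a i) \/ dot u (wv a i) = 0 /\ 0 < dot f (wv a i).
  have := fP i; rewrite w0; set d := (E i).2 - (E i).1.
  have -> : wv a i = if (dot u d < 0) || (dot u d == 0) && (dot f d < 0) then - d else d.
    by rewrite /wv inE !w0 opprB.
  case: (ltgtP (dot u d) 0) => [ud|ud|ud] /= fd.
  - by left; rewrite dotNr oppr_gt0.
  - by left.
  - case: (ltgtP (dot f d) 0) fd => // fd _; right; rewrite ?dotNr ?oppr_gt0 ud ?oppr0 //.
have [e e0 eP] := small_step ua; exists a, (u + e *: f); split=> i _.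
  by rewrite !dotBE.
by case: (ua i) => [/ltW//|[->]].
Qed.

End Zonotope.

Section ZonotopeEdges.
Variables (R : realType) (n : nat) (I : finType) (E : I -> 'rV[R]_n * 'rV[R]_n).
Local Notation V := 'rV[R]_n.
Implicit Types (u v x y z f : V) (a b W K : {set I}).

Lemma vertex_strict (S : set V) x : attains S -> vertex S x ->
  exists u, forall y, S y -> y != x -> dot u x < dot u y.
Proof.
move=> aS [_ [u xu]]; exists u => y Sy yx.
have [Sx xh] : face S u x by rewrite -xu.
rewrite lt_def xh attains_h // andbT; apply: contraNneq yx => yh.
by have : [set x] y by [rewrite xu]; move=> ->.
Qed.

Lemma sum_subset (M : nmodType) (A K : {set I}) (G : I -> M) : A \subset K ->
  \sum_(i in A) G i = \sum_(i in K) (if i \in A then G i else 0).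
Proof.
move=> AK; rewrite -big_mkcondr; apply: eq_bigl => i.
by have [iA|_] := boolP (i \in A); rewrite ?andbF // (subsetP AK _ iA).
Qed.

Lemma zonotope_vtx_sum a W K : K \subset W ->
  zonotope E W (vtx E a W + \sum_(i in K) wv E a i).
Proof.
move=> KW; apply/(zonotopeP _ a); exists (fun i => (i \in K)%:R); split=> [i _|].
  by case: (i \in K); rewrite ?lexx ?ler01.
rewrite (sum_subset _ KW); congr +%R; apply: eq_bigr => i _.
by case: (i \in K); rewrite ?scale1r ?scale0r.
Qed.

Lemma zonotope_edge a W z j : (forall i, (E i).1 != (E i).2) ->
  j \in W -> weakly_selects E z a W -> dot z (wv E a j) = 0 ->
  (forall i, i \in W -> dot z (wv E a i) = 0 -> exists c, wv E a i = c *: wv E a j) ->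
  [/\ edge (zonotope E W) (face (zonotope E W) z),
     face (zonotope E W) z (vtx E a W),
     face (zonotope E W) z (vtx E a W + wv E a j) &
     forall y, face (zonotope E W) z y ->
       exists s, y = vtx E a W + s *: wv E a j].
Proof.
move=> E0 jW za zj zW; have zv := weakly_selects_face za.
have zvj : face (zonotope E W) z (vtx E a W + wv E a j).
  apply: (face_eq zv); last by rewrite dotDr zj addr0.
  by rewrite -[wv E a j]scale1r; apply: zonotope_vtx_wv; rewrite // ler01 lexx.
have zl y : face (zonotope E W) z y -> exists s, y = vtx E a W + s *: wv E a j.
  move=> /(zonotope_face _ za)[t [t01 t0 ->]].
  have /choice[c cP] : forall i, exists c, i \in W -> t i *: wv E a i = c *: wv E a j.
    move=> i; have [iW|iW] := boolP (i \in W); last by exists 0.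
    have /eqP := t0 i iW; rewrite mulf_eq0 => /orP[/eqP ->|/eqP /(zW i iW)[c ->]].
      by exists 0; rewrite !scale0r.
    by exists (t i * c); rewrite scalerA.
  by exists (\sum_(i in W) c i); rewrite scaler_suml; congr +%R; exact: eq_bigr.
split=> //; split; first exact/attains_is_face/zonotope_attains.
exact: affdim_line zv zvj (wv_neq0 _ (E0 j)) zl.
Qed.

Lemma edge_parallel a W z i j : weakly_selects E z a W ->
  affdim (face (zonotope E W) z) = 1%N -> i \in W -> j \in W ->
  dot z (wv E a i) = 0 -> dot z (wv E a j) = 0 -> wv E a j != 0 ->
  exists c, wv E a i = c *: wv E a j.
Proof.
move=> za d1 iW jW zi zj j0; apply/sub_rVP/negPn/negP => nij.
pose M := col_mx (wv E a j) (wv E a i).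
have zw m : m \in W -> dot z (wv E a m) = 0 ->
    face (zonotope E W) z (vtx E a W + wv E a m).
  move=> mW zm; apply: (face_eq (weakly_selects_face za)); last first.
    by rewrite dotDr zm addr0.
  by rewrite -[wv E a m]scale1r; apply: zonotope_vtx_wv; rewrite // ler01 lexx.
have fM : row_free M.
  rewrite /row_free eqn_leq rank_leq_row -addsmxE.
  have : (wv E a j < wv E a j + wv E a i)%MS.
    by rewrite ltmxE addsmxSl /= addsmx_sub submx_refl.
  by rewrite ltmxErank rank_rV j0 => /andP[].
suff : (1 + 1 <= affdim (face (zonotope E W) z))%N by rewrite d1.
apply: (affdim_ge (weakly_selects_face za) fM) => k.
by case: (split_ordP k) => l ->; rewrite ?rowKu ?rowKd row_id; exact: zw.
Qed.

End ZonotopeEdges.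

(** * Bases of a lattice and their dual bases *)

Section Lattice.
Variables (R : realType) (n : nat) (L : set 'rV[R]_n).
Local Notation V := 'rV[R]_n.
Implicit Types (x y w : V).
Hypothesis latL : lattice L.

Lemma latticeB x y : L x -> L y -> L (x - y).
Proof.
have [B _ ->] := latL => -[z _ <-] [t _ <-]; exists (z - t) => //.
by rewrite map_mxB mulmxBl.
Qed.

Lemma lattice0 : L 0.
Proof. by have [B _ ->] := latL; exists 0; rewrite // map_mx0 mul0mx. Qed.

Lemma latticeN x : L x -> L (- x).
Proof. by move=> Lx; rewrite -[- x]add0r; apply: latticeB => //; exact: lattice0. Qed.

Lemma latticeD x y : L x -> L y -> L (x + y).
Proof. by move=> Lx Ly; rewrite -[y]opprK; apply: latticeB => //; exact: latticeN. Qed.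

Lemma lattice_sum (J : Type) (r : seq J) (p : pred J) (f : J -> V) :
  (forall j, p j -> L (f j)) -> L (\sum_(j <- r | p j) f j).
Proof. by move=> Lf; elim/big_ind: _ => //; [exact: lattice0 | exact: latticeD]. Qed.

Lemma latticeMz x (c : int) : L x -> L (x *~ c).
Proof.
move=> Lx; have Ln m : L (x *+ m).
  by elim: m => [|m IH]; rewrite ?mulr0n ?mulrS; [exact: lattice0 | exact: latticeD].
by case: c => m; [exact: Ln | rewrite NegzE mulrNz; exact/latticeN/Ln].
Qed.

Lemma primitive_ray w w' (c : R) : primitive L w -> primitive L w' -> 0 < c ->
  w = c *: w' -> w = w'.
Proof.
move=> [Lw w0 wp] [Lw' w'0 w'p] c0 wE; case: (ltgtP c 1) => [c1|c1|c1].
- by case: (w'p c); rewrite ?c0 // -wE.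
- case: (wp c^-1); rewrite ?invr_gt0 ?c0 ?invf_lt1 //.
  by rewrite wE scalerA mulVf ?gt_eqF // scale1r.
- by rewrite wE c1 scale1r.
Qed.

(** Expressing the two bases in terms of each other gives integral matrices that
    are inverse to each other: one composite is the identity because the rows of
    [B] are independent, the other because [w] is free over the integers. *)
Lemma zbasis_dual k (w : 'I_k -> V) : injective w -> zbasis (range w) L ->
  k = n /\ exists g : 'I_k -> V,
    [/\ forall i j, dot (g i) (w j) = (i == j)%:R, forall i, dual L (g i) &
      forall x, x = \sum_i dot (g i) x *: w i].
Proof.
move=> winj [wfree wspan]; have [B Bu LB] := latL.
have Lw i : L (w i).
  rewrite -wspan; exists 1%N, (fun=> w i), (fun=> 1); split=> [_|]; first by exists i.
  by rewrite big_ord1.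
have /choice[C CP] i : exists z : 'rV[int]_n, w i = map_mx intr z *m B.
  by have := Lw i; rewrite LB => -[z _ <-]; exists z.
have span x : L x -> exists z : 'rV[int]_k, x = \sum_j w j *~ z 0 j.
  rewrite -wspan => -[m [h [c [hw ->]]]].
  have /choice[s sP] : forall i, exists j, w j = h i.
    by move=> i; have [j _ <-] := hw i; exists j.
  exists (\row_j \sum_(i | s i == j) c i).
  rewrite (partition_big s xpredT) //=; apply: eq_bigr => j _.
  by rewrite mxE mulrz_sumr; apply: eq_bigr => i /eqP <-; rewrite sP.
pose M : 'M[R]_(k, n) := \matrix_i w i.
have intM (z : 'rV[int]_k) : map_mx intr z *m M = \sum_j w j *~ z 0 j.
  rewrite mulmx_sum_row; apply: eq_bigr => j _.
  by rewrite mxE rowK scaler_int.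
have /choice[A AP] i : exists z : 'rV[int]_k, row i B = map_mx intr z *m M.
  have [|z zB] := span (row i B); last by exists z; rewrite intM.
  rewrite LB; exists (delta_mx 0 i) => //.
  by rewrite map_delta_mx rowE.
pose Am : 'M[int]_(n, k) := \matrix_i A i; pose Cm : 'M[int]_(k, n) := \matrix_i C i.
have BE : B = map_mx intr Am *m M.
  by apply/row_matrixP => i; rewrite row_mul -map_row rowK AP.
have ME : M = map_mx intr Cm *m B.
  by apply/row_matrixP => i; rewrite row_mul -map_row !rowK CP.
have CA1 : Cm *m Am = 1%:M.
  apply/eqP; rewrite -subr_eq0; apply/eqP/row_matrixP => i; rewrite row0.
  have z0 : \sum_j w j *~ (row i (Cm *m Am - 1%:M)) 0 j = 0.
    rewrite -intM map_row -row_mul map_mxB map_mxM map_mx1 mulmxBl mul1mx.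
    by rewrite -mulmxA -BE -ME subrr row0.
  apply/rowP => j; rewrite [RHS]mxE; move: j.
  exact: (wfree k w (fun j => row i (Cm *m Am - 1%:M) 0 j) winj).
pose N : 'M[R]_(n, k) := invmx B *m map_mx intr Am.
have MN : M *m N = 1%:M.
  by rewrite ME -mulmxA (mulmxA B) mulmxV // mul1mx -map_mxM CA1 map_mx1.
have NM : N *m M = 1%:M by rewrite -mulmxA -BE mulVmx.
split; first by apply/eqP; rewrite eqn_leq (mulmx1_min MN) (mulmx1_min NM).
have gx x i : dot (col i N)^T x = (x *m N) 0 i.
  by rewrite dotC dotE trmxK colE mulmxA -colE mxE.
exists (fun i => (col i N)^T); split=> [i j|i x|x].
- by rewrite gx -[w j](rowK w j) -/M -row_mul MN mxE mxE eq_sym.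
- rewrite LB => -[z _ <-]; rewrite gx /N mulmxA mulmxK // -map_mxM mxE.
  by apply/intrP; eexists.
- rewrite -{1}[x]mulmx1 -NM mulmxA mulmx_sum_row.
  by apply: eq_bigr => i _; rewrite gx rowK.
Qed.

End Lattice.

(** * Zonotopes truncated at a vertex *)

Lemma set1_neq0 (I : finType) (s : I) : [set s]%SET != set0.
Proof. by apply/set0Pn; exists s; rewrite inE. Qed.

Section TruncatedZonotope.
Variables (R : realType) (n : nat) (I : finType).
Local Notation V := 'rV[R]_n.
Variables (w : I -> V) (U : {set I}) (p u : V).
Implicit Types (x y z k : V) (A B N K : {set I}).

(** The zonotope with vertex [p] and edge vectors [w i], without its part below
    the hyperplane through the points [p + w i]. *)
Definition truncated_zonotope : set V := [set x | exists t : I -> R,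
  [/\ forall i, i \in U -> 0 <= t i <= 1, 1 <= \sum_(i in U) t i &
     x = p + \sum_(i in U) t i *: w i]].
Local Notation T := truncated_zonotope.

Definition corner A : V := p + \sum_(i in A) w i.

Lemma corner_mem A : A \subset U -> A != set0 -> T (corner A).
Proof.
move=> AU /set0Pn[s sA]; exists (fun i => (i \in A)%:R).
have AE : \sum_(i in U) (i \in A)%:R *: w i = \sum_(i in A) w i.
  rewrite (sum_subset _ AU); apply: eq_bigr => i _.
  by case: (i \in A); rewrite ?scale1r ?scale0r.
split=> [i _||]; last by rewrite AE.
  by case: (i \in A); rewrite ?lexx ?ler01.
rewrite (bigD1 s) ?(subsetP AU) //= sA lerDl.
by apply: sumr_ge0 => i _; rewrite ler0n.
Qed.

(** A functional that is nonpositive on some edge vector takes its minimum over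
    the whole zonotope at a vertex other than [p], which is not cut off. *)
Lemma corner_min z A x : A \subset U ->
  (forall i, i \in A -> dot z (w i) <= 0) ->
  (forall i, i \in U -> i \notin A -> 0 <= dot z (w i)) ->
  T x -> dot z (corner A) <= dot z x.
Proof.
move=> AU zA znA [t [t01 _ ->]].
rewrite !dotDr lerD2l [leRHS](_ : _ = dot z (\sum_(i in A) t i *: w i) + dot z (\sum_(i in U :\: A) t i *: w i)); last first.
  by rewrite -dotDr [in LHS](big_setID A) /= (setIidPr AU).
rewrite -[dot z (\sum_(i in A) w i)]addr0 lerD // dot_sumr.
  rewrite dot_sumr; apply: ler_sum => i iA; rewrite dotZr ler_niMl ?zA //.
  by have /andP[] := t01 i (subsetP AU _ iA).
apply: sumr_ge0 => i /setDP[iU iA]; rewrite dotZr mulr_ge0 ?znA //.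
by have /andP[] := t01 i iU.
Qed.

Lemma h_corner z A : A \subset U -> A != set0 ->
  (forall i, i \in A -> dot z (w i) <= 0) ->
  (forall i, i \in U -> i \notin A -> 0 <= dot z (w i)) ->
  h T z = dot z (corner A).
Proof.
move=> AU A0 zA znA; apply: h_min => [|x]; first exact: corner_mem.
exact: corner_min.
Qed.

Lemma corner1_min z s x : s \in U ->
  (forall i, i \in U -> i != s -> 0 <= dot z (w i)) ->
  (forall i, i \in U -> dot z (w s) <= dot z (w i)) ->
  T x -> dot z (corner [set s]) <= dot z x.
Proof.
move=> sU z0 zs; have [s0|s0] := leP (dot z (w s)) 0.
  apply: corner_min => [|i|i iU]; rewrite ?sub1set ?inE //.
    by move=> /eqP ->.
  exact: z0.
move=> [t [t01 t1 ->]].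
rewrite !dotDr lerD2l big_set1 dot_sumr.
apply: (@le_trans _ _ (dot z (w s) * \sum_(i in U) t i)).
  by rewrite -[leLHS]mulr1 ler_wpM2l // ltW.
rewrite mulr_sumr; apply: ler_sum => i iU; rewrite dotZr mulrC ler_wpM2l ?zs //.
by have /andP[] := t01 i iU.
Qed.

Lemma h_corner1 z s : s \in U ->
  (forall i, i \in U -> i != s -> 0 <= dot z (w i)) ->
  (forall i, i \in U -> dot z (w s) <= dot z (w i)) ->
  h T z = dot z (corner [set s]).
Proof.
move=> sU z0 zs; apply: h_min => [|x]; last exact: corner1_min.
by apply: corner_mem; [rewrite sub1set | exact: set1_neq0].
Qed.

Lemma corner_cases z : U != set0 ->
  (exists A, [/\ A \subset U, A != set0, forall i, i \in A -> dot z (w i) <= 0 &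
     forall i, i \in U -> i \notin A -> 0 < dot z (w i)]) \/
  exists s, [/\ s \in U, forall i, i \in U -> 0 < dot z (w i) &
     forall i, i \in U -> dot z (w s) <= dot z (w i)].
Proof.
move=> /set0Pn[s0 s0U].
pose A := [set i in U | dot z (w i) <= 0]%SET.
have pos i : i \in U -> i \notin A -> 0 < dot z (w i).
  by move=> iU; rewrite inE iU /= -ltNge.
have [A0|A0] := eqVneq A set0; last first.
  by left; exists A; split=> // [|i]; [apply/subsetP => i|]; rewrite inE => /andP[].
have [s sU smin] := Order.TotalTheory.arg_minP (fun i => dot z (w i)) s0U.
by right; exists s; split=> // i iU; rewrite pos // A0 inE.
Qed.

Lemma truncated_zonotope_min z : U != set0 ->
  exists A, [/\ A \subset U, A != set0 &
    forall x, T x -> dot z (corner A) <= dot z x].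
Proof.
move=> /(corner_cases z)[[A [AU A0 neg pos]]|[s [sU pos smin]]].
  by exists A; split=> // x; apply: corner_min => // i iU /pos-/(_ iU)/ltW.
exists [set s]%SET; split; rewrite ?sub1set ?set1_neq0 // => x.
by apply: corner1_min => // i iU _; exact/ltW/pos.
Qed.

Lemma truncated_zonotope_polytope : U != set0 -> polytope T.
Proof.
move=> U0; pose ok A := (A \subset U) && (A != set0).
pose g (i : 'I_#|{set I}|) := if ok (enum_val i) then corner (enum_val i) else corner U.
have okU : T (corner U) by exact: corner_mem.
have gT i : T (g i) by rewrite /g; case: ifP => // /andP[]; exact: corner_mem.
apply: (polytope_of_minimizers (g := g)); first by exists (corner U).
  move=> _ [c [c0 c1 ->]]; have /choice[t tP] : forall i, exists t : I -> R,
      [/\ forall i, i \in U -> 0 <= t i <= 1, 1 <= \sum_(i in U) t i &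
      g i = p + \sum_(i in U) t i *: w i] by move=> i; exact: gT.
  exists (fun j => \sum_i c i * t i j); split=> [j jU||].
  - apply/andP; split.
      apply: sumr_ge0 => i _; have [/(_ j jU)/andP[t0 _] _ _] := tP i.
      by rewrite mulr_ge0.
    rewrite -c1; apply: ler_sum => i _; have [/(_ j jU)/andP[_ t1] _ _] := tP i.
    by rewrite ler_piMr.
  - rewrite exchange_big /= -c1; apply: ler_sum => i _; rewrite -mulr_sumr.
    by rewrite ler_peMr //; have [] := tP i.
  - rewrite -[p in RHS]scale1r -c1 scaler_suml.
    under [X in _ = _ + X]eq_bigr do rewrite scaler_suml.
    rewrite exchange_big -big_split /=; apply: eq_bigr => i _.
    have [_ _ ->] := tP i; rewrite scalerDr scaler_sumr; congr +%R.
    by apply: eq_bigr => j _; rewrite scalerA.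
move=> z x Tx; have [A [AU A0 Amin]] := truncated_zonotope_min z U0.
exists (enum_rank A); rewrite /g enum_rankK /ok AU A0; exact: Amin.
Qed.

End TruncatedZonotope.

(** * Indecomposability of truncated zonotopes *)

(** The cone of [z0] in the fan of [Q] is a union of cones of the fan of [P]; the
    only face of [P] whose cone contains [z0] is [x], so the cone of [x] is in it. *)
Lemma deformation_vertex (R : realType) (n : nat) (P Q : set 'rV[R]_n) z0 x :
  deformation P Q -> face P z0 = [set x] ->
  exists y, forall z, normal_cone P [set x] z -> h Q z = dot z y.
Proof.
move=> [pQ PQ] xz; have aQ := polytope_attains pQ.
have [|B BP CB] := PQ (normal_cone Q (face Q z0)).
  by exists (face Q z0) => //; exact: attains_is_face.
have : normal_cone Q (face Q z0) z0 by exact: normal_cone_face_self.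
rewrite CB => -[D BD Dz0]; have [F' [[y F'y] [v F'v]] DF] := BP _ BD.
have F'x : F' = [set x].
  have sub : F' `<=` [set x].
    rewrite -xz => y' F'y'; split; last by move: Dz0; rewrite DF; exact.
    by rewrite F'v in F'y'; case: F'y'.
  by apply/seteqP; split=> // _ ->; rewrite -(sub _ F'y).
have [y' Qy'] := attains_face z0 aQ; exists y' => z Nz.
have : normal_cone Q (face Q z0) z by rewrite CB; exists D; rewrite // DF F'x.
by move=> /(_ _ Qy').
Qed.

Section Indecomposable.
Variables (R : realType) (n : nat) (I : finType).
Local Notation V := 'rV[R]_n.
Variables (w : I -> V) (U : {set I}) (p u : V) (f : I -> V) (Q : set V).
Implicit Types (x y z k : V) (A B N K M : {set I}).
Local Notation T := (truncated_zonotope w U p).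
Local Notation corner := (corner w p).
Local Notation psi := (h Q).

Hypothesis hu : forall i, i \in U -> dot u (w i) = 1.
Hypothesis f0 : forall s, s \in U -> dot (f s) (w s) = 0.
Hypothesis fpos : forall s r, s \in U -> r \in U -> r != s -> 0 < dot (f s) (w r).
Hypothesis U2 : (1 < #|U|)%N.
Hypothesis defQ : deformation T Q.

(** The functionals that are minimal exactly on the face of the truncated
    zonotope from [corner A] to [corner (A :|: N)], if [A] is nonempty. *)
Definition signs A N z := forall i, i \in U ->
  if i \in A then dot z (w i) < 0
  else if i \in N then dot z (w i) == 0 else 0 < dot z (w i).

Lemma signs_perturb A N B N' z y : signs A N z -> B \subset N -> N' \subset N ->
  (forall i, i \in U -> i \in N -> if i \in B then dot y (w i) < 0
     else if i \in N' then dot y (w i) == 0 else 0 < dot y (w i)) ->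
  exists2 e : R, 0 < e & signs (A :|: B) N' (z + e *: y).
Proof.
move=> zs BN N'N ys.
pose s (i : I) := if i \in A :|: B then -1 else 1 : R.
pose keep i := (i \in U) && ((i \in A :|: B) || (i \notin N')).
have [i|e e0 eP] := @small_step R I
    (fun i => if keep i then s i * dot z (w i) else 1)
    (fun i => if keep i then s i * dot y (w i) else 0).
  rewrite /keep; have [iU|iU] := boolP (i \in U); last by left.
  have := zs i iU; have := ys i iU; rewrite /s in_setU.
  have [iA|iA] /= := boolP (i \in A); first by move=> _ zi; left; lra.
  have [iN|iN] /= := boolP (i \in N).
    move=> /(_ isT); have [iB|iB] /= := boolP (i \in B).
      by move=> yi /eqP ->; right; rewrite mulr0; split=> //; lra.
    have [iN'|iN'] /= := boolP (i \in N'); first by left.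
    by move=> yi /eqP ->; right; rewrite mulr0; split=> //; lra.
  have -> : (i \in B) = false by apply: contraNF iN; exact: (subsetP BN).
  have -> : (i \in N') = false by apply: contraNF iN; exact: (subsetP N'N).
  by rewrite /= => _ zi; left; lra.
exists e => // i iU; have := eP i; rewrite /keep /s iU in_setU !dotBE /=.
have := zs i iU; have := ys i iU.
have [iA|iA] /= := boolP (i \in A); first by move=> _ _; lra.
have [iB|iB] /= := boolP (i \in B); first by move=> _ _; lra.
have [iN'|iN'] /= := boolP (i \in N'); last by move=> _ _; lra.
by rewrite (subsetP N'N _ iN') => /(_ isT)/eqP -> /eqP -> _; rewrite mulr0 addr0.
Qed.

Lemma signs_cone A N A' z : signs A N z -> A \subset A' -> A' \subset A :|: N ->
  (forall i, i \in A' -> i \in U -> dot z (w i) <= 0) /\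
  (forall i, i \in U -> i \notin A' -> 0 <= dot z (w i)).
Proof.
move=> zs AA' A'N; split=> i => [iA' iU|iU iA']; have := zs i iU.
  have := subsetP A'N _ iA'; rewrite in_setU.
  by have [_ _ /ltW|_ /= -> /eqP ->] := boolP (i \in A).
have -> : (i \in A) = false by apply: contraNF iA'; exact: (subsetP AA').
by case: ifP => [_ /eqP ->|_ /ltW].
Qed.

Lemma signs_normal A N A' z : signs A N z -> A \subset A' -> A' \subset A :|: N ->
  A' \subset U -> A' != set0 -> normal_cone T [set corner A'] z.
Proof.
move=> zs AA' A'N A'U A'0 _ ->; have [neg pos] := signs_cone zs AA' A'N.
apply/esym/h_corner => // i iA'; apply: neg => //.
exact: (subsetP A'U).
Qed.

Lemma signs_face A z : signs A set0 z -> A \subset U -> A != set0 ->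
  face T z = [set corner A].
Proof.
move=> zs AU A0; have [||neg pos] := signs_cone zs (A' := A); rewrite ?subsetUl //.
have hA : h T z = dot z (corner A).
  by apply: h_corner => // i iA; apply: neg => //; exact: (subsetP AU).
apply/seteqP; split=> [_ [[t [t01 _ ->]]]|_ ->]; last by split; rewrite ?hA //; exact: corner_mem.
rewrite hA !dotDr => /addrI; rewrite !dot_sumr => zE /=; congr (p + _).
have term i : i \in U -> 0 <= dot z (t i *: w i) -
    (if i \in A then dot z (w i) else 0).
  move=> iU; have /andP[t0 t1] := t01 i iU; have := zs i iU; rewrite dotZr inE.
  case: ifP => _ zi; last by rewrite subr0 mulr_ge0 // ltW.
  by rewrite subr_ge0 ler_niMl // ltW.
rewrite (sum_subset _ AU); apply: eq_bigr => i iU.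
move/eqP: zE; rewrite (sum_subset _ AU) -subr_eq0 -sumrB => /eqP zE.
have /eqP := psumr_eq0P term zE iU; have := zs i iU; rewrite dotZr inE.
case: ifP => _ zi.
  by rewrite -[X in _ - X]mul1r -mulrBl mulf_eq0 (lt_eqF zi) orbF subr_eq0 => /eqP ->; rewrite scale1r.
by rewrite subr0 mulf_eq0 (gt_eqF zi) orbF => /eqP ->; rewrite scale0r.
Qed.

Lemma signs_up A N z : signs A N z -> exists z', signs A set0 z'.
Proof.
move=> zs; have [i iU iN|e e0 zs'] := signs_perturb (B := set0)
    (N' := set0) (y := u) zs (sub0set _) (sub0set _).
  by rewrite !inE hu // ltr01.
by exists (z + e *: u); rewrite setU0 in zs'.
Qed.

Lemma signs_down A N z : signs A N z -> exists z', signs (A :|: N) set0 z'.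
Proof.
move=> zs; have [i iU iN|e e0 zs'] := signs_perturb (B := N)
    (N' := set0) (y := - u) zs (subxx _) (sub0set _).
  by rewrite iN dotNl hu // oppr_lt0 ltr01.
by exists (z - e *: u); rewrite -scalerN.
Qed.

(** The vertices [Y A] of [Q] that correspond to the vertices [corner A] of the
    truncated zonotope. *)
Variable Y : {set I} -> V.
Hypothesis YP : forall A z, signs A set0 z -> A \subset U -> A != set0 ->
  forall z', normal_cone T [set corner A] z' -> psi z' = dot z' (Y A).

Lemma psi_up A N z : signs A N z -> A \subset U -> A != set0 ->
  psi z = dot z (Y A).
Proof.
move=> zs AU A0; have [z' zs'] := signs_up zs; apply: (YP zs') => //.
exact: (signs_normal zs (subxx _) (subsetUl _ _)).
Qed.

Lemma psi_down A N z : signs A N z -> A :|: N \subset U -> A :|: N != set0 ->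
  psi z = dot z (Y (A :|: N)).
Proof.
move=> zs AU A0; have [z' zs'] := signs_down zs; apply: (YP zs') => //.
exact: (signs_normal zs (subsetUl _ _) (subxx _)).
Qed.

(** Two vertices of [Q] whose normal cones share a wall in the hyperplane
    orthogonal to [w s] differ by a multiple of [w s]. *)
Lemma wall_jump A s z : signs A [set s]%SET z -> A \subset U -> A != set0 ->
  s \in U -> exists c, Y (A :|: [set s]%SET) - Y A = c *: w s.
Proof.
move=> zs AU A0 sU; set D := _ - _.
have AsU : A :|: [set s]%SET \subset U by rewrite subUset AU sub1set.
have As0 : A :|: [set s]%SET != set0.
  by apply/set0Pn; exists s; rewrite !inE eqxx orbT.
have Dz z' : signs A [set s]%SET z' -> dot z' D = 0.
  move=> zs'; rewrite dotDr dotNr -(psi_up zs') // -(psi_down zs') //.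
  by rewrite subrr.
have Dk k : dot k (w s) = 0 -> dot k D = 0.
  move=> ks; have [i iU|e e0 zs'] := signs_perturb (B := set0)
      (N' := [set s]%SET) (y := k) zs (sub0set _) (subxx _).
    by rewrite !inE => /eqP ->; rewrite eqxx ks.
  rewrite setU0 in zs'; have := Dz _ zs'.
  by rewrite dotDl dotZl Dz // add0r => /eqP; rewrite mulf_eq0 gt_eqF //= => /eqP.
exists (dot u D); apply: dot_inj => k; rewrite dotZr.
have /Dk : dot (k - dot k (w s) *: u) (w s) = 0.
  by rewrite dotDl dotNl dotZl hu // mulr1 subrr.
by rewrite dotDl dotNl dotZl; lra.
Qed.

(** The functional [f] of the middle one of three collinear points would have
    opposite signs at the other two. *)
Lemma w_not_collinear s r r0 c : s \in U -> r \in U -> r0 \in U ->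
  s != r -> s != r0 -> r != r0 -> w r - w s = c *: (w r0 - w s) -> False.
Proof.
move=> sU rU r0U sr sr0 rr0 E.
have fE k : dot k (w r) - dot k (w s) = c * (dot k (w r0) - dot k (w s)).
  by rewrite -!dotNr -!dotDr E dotZr.
have c0 : 0 < c.
  have := fE (f s); rewrite (f0 sU) !subr0 => H.
  have := fpos sU rU; rewrite eq_sym => /(_ sr); rewrite H.
  by rewrite pmulr_lgt0 // fpos // eq_sym.
have c1 : c < 1.
  have := fE (f r0); rewrite (f0 r0U) sub0r => H.
  have : 0 < dot (f r0) (w r) by rewrite fpos.
  have -> : dot (f r0) (w r) = (1 - c) * dot (f r0) (w s) by lra.
  by rewrite pmulr_lgt0 ?subr_gt0 // fpos.
have := fE (f r); rewrite (f0 rU) sub0r => H.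
have a0 : 0 < dot (f r) (w s) by rewrite fpos.
have b0 : 0 < dot (f r) (w r0) by rewrite fpos // eq_sym.
have : 0 < (1 - c) * dot (f r) (w s) by rewrite mulr_gt0 // subr_gt0.
have : 0 < c * dot (f r) (w r0) by rewrite mulr_gt0.
by lra.
Qed.

(** From a point of the wall of [w s] one moves along [- f s], inside the wall,
    until other vectors become orthogonal. An extreme ray of the cone they span
    modulo [w s] is a single one of them, since no three of the vectors [w i],
    which lie on the hyperplane [u = 1], are collinear. *)
Lemma wall_corner A s z : signs A [set s]%SET z -> A \subset U -> s \in U ->
  s \notin A -> A :|: [set s]%SET != U -> exists r z', [/\ r \in U, r \notin A, r != s &
    signs A [set s; r]%SET z'].
Proof.
move=> zs AU sU sA AsU.
pose free := [pred r | (r \in U) && (r \notin A :|: [set s]%SET)].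
have [r1 r1P] : exists r, free r.
  apply: contrapT => /forallNP nr; case/eqP: AsU; apply/eqP.
  rewrite eqEsubset subUset AU sub1set sU /=.
  by apply/subsetP => r rU; apply/negPn/negP => rA; apply: (nr r); rewrite /free /= rU.
have [q /andP[qU qA] qmin] := Order.TotalTheory.arg_minP
  (fun r => dot z (w r) / dot (f s) (w r)) r1P.
have out r : r \in U -> r \notin A -> r != s -> 0 < dot z (w r) /\ 0 < dot (f s) (w r).
  move=> rU rA rs; have := zs r rU; rewrite (negbTE rA) inE (negbTE rs) => zr.
  by split=> //; apply: fpos.
have [qnA qs] : q \notin A /\ q != s.
  by move: qA; rewrite !inE negb_or => /andP[].
pose t := dot z (w q) / dot (f s) (w q); pose z1 := z - t *: f s.
have [zq fq] := out q qU qnA qs; have t0 : 0 < t by rewrite divr_gt0.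
pose M := [set r in U | [&& r \notin A, r != s & dot z1 (w r) == 0]]%SET.
have qM : q \in M by rewrite inE qU qnA qs /z1 !dotBE divfK ?subrr ?eqxx // gt_eqF.
have z1s : signs A (s |: M) z1.
  move=> i iU; have := zs i iU; have [iA|iA] := boolP (i \in A).
    move=> zi; rewrite /z1 !dotBE.
    have fi : 0 < dot (f s) (w i).
      by apply: fpos => //; apply: contraNneq sA => <-.
    by have := mulr_gt0 t0 fi; lra.
  rewrite !inE iU iA /=; have [->|is_] := eqVneq i s.
    by rewrite /= /z1 !dotBE f0 // mulr0 subr0.
  rewrite /= => _; case: ifP => // z1i.
  rewrite lt_def z1i /z1 !dotBE subr_ge0 /=.
  have [_ fi] := out i iU iA is_; rewrite -ler_pdivlMr //.
  by apply: qmin; rewrite /free /= iU !inE negb_or iA.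
have MP r : r \in M -> [/\ r \in U, r \notin A & r != s].
  by rewrite inE => /and4P[].
have [r /MP[rU rA rs]|K [KM Kgen Kext]] :=
    @extreme_generators _ _ _ (fun r => w r - w s) M (f s).
  by rewrite dotDr dotNr f0 // subr0; have [] := out r rU rA rs.
have [|r rK] := cone_inhabited (Kgen q qM).
  rewrite subr_eq0; apply: contraTneq fq => ->.
  by rewrite f0 // ltxx.
have rM := subsetP KM _ rK; have [rU rA rs] := MP _ rM.
have [k [kr kM kext]] := Kext r rK.
pose y := k - dot k (w s) *: u.
have yw i : i \in U -> dot y (w i) = dot k (w i - w s).
  by move=> iU; rewrite /y !dotBE hu // mulr1.
have ysign i : i \in U -> i \in s |: M -> if i \in set0 then dot y (w i) < 0
    else if i \in [set s; r]%SET then dot y (w i) == 0 else 0 < dot y (w i).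
  move=> iU isM; rewrite inE; case: ifPn; rewrite in_set2.
    by move=> /orP[]/eqP ->; rewrite yw // ?subrr ?dot0r ?kr.
  rewrite negb_or => /andP[is_ ir].
  have iM : i \in M by move: isM; rewrite in_setU1 (negbTE is_).
  rewrite yw // lt_def kM // andbT; apply/eqP => /(kext i iM)[c].
  by apply: w_not_collinear; rewrite // eq_sym.
have [||e e0] := signs_perturb z1s _ _ ysign; first exact: sub0set.
  apply/subsetP => i; rewrite in_set2 in_setU1.
  by move=> /orP[->//|/eqP ->]; rewrite rM orbT.
by rewrite setU0 => ?; exists r, (z1 + e *: y).
Qed.

Definition length s := dot u (Y U - Y (U :\ s)).

(** Around a point orthogonal to exactly [w s] and [w r] the four vertices of
    [Q] form a parallelogram. *)
Lemma wall_length A s z : signs A [set s]%SET z -> A \subset U -> A != set0 ->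
  s \in U -> s \notin A -> Y (A :|: [set s]%SET) - Y A = length s *: w s.
Proof.
have [m] := ubnP #|U :\: A|; elim: m => // m IH in A z *; rewrite ltnS => Um.
move=> zs AU A0 sU sA; have [AsU|AsU] := eqVneq (A :|: [set s]%SET) U.
  have [c cE] := wall_jump zs AU A0 sU; rewrite cE; congr (_ *: _).
  have AE : A = U :\ s.
    apply/setP => i; rewrite -AsU !inE; have [->|_] := eqVneq i s; last by rewrite orbF.
    exact/negbTE.
  by rewrite /length -AE -{1}AsU cE dotZr hu // mulr1.
have [r [z' [rU rA rs zs']]] := wall_corner zs AU sU sA AsU.
have sr : s != r by rewrite eq_sym.
have sub1 : [set s]%SET \subset [set s; r]%SET by exact: subsetUl.
have sub2 : [set r]%SET \subset [set s; r]%SET by exact: subsetUr.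
have wallr : exists z1, signs (A :|: [set r]%SET) [set s]%SET z1.
  have [i iU|e _ zs1] := signs_perturb (B := [set r]%SET) (N' := [set s]%SET) (y := - f s)
      zs' sub2 sub1; last by exists (z' + e *: - f s).
  rewrite !inE => /orP[]/eqP ->; rewrite ?eqxx ?(negbTE sr) dotNl.
    by rewrite f0 // oppr0.
  by rewrite oppr_lt0 fpos.
have wall1 : exists z1, signs A [set r]%SET z1.
  have [i iU|e _ zs1] := signs_perturb (B := set0) (N' := [set r]%SET) (y := f r)
      zs' (sub0set _) sub2.
    rewrite !inE => /orP[]/eqP ->; rewrite ?eqxx ?(negbTE sr); last by rewrite f0.
    by rewrite fpos.
  by exists (z' + e *: f r); rewrite setU0 in zs1.
have wall2 : exists z1, signs (A :|: [set s]%SET) [set r]%SET z1.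
  have [i iU|e _ zs1] := signs_perturb (B := [set s]%SET) (N' := [set r]%SET) (y := - f r)
      zs' sub1 sub2; last by exists (z' + e *: - f r).
  rewrite !inE => /orP[]/eqP ->; rewrite ?eqxx ?(negbTE rs) dotNl.
    by rewrite oppr_lt0 fpos.
  by rewrite f0 // oppr0.
have [[z1 zs1] [[z2 zs2] [z3 zs3]]] := (wallr, (wall1, wall2)).
have sub B i : B \subset U -> i \in U -> B :|: [set i]%SET \subset U.
  by move=> BU iU; rewrite subUset BU sub1set.
have neq0 B i : B :|: [set i]%SET != set0.
  by apply/set0Pn; exists i; rewrite !inE eqxx orbT.
have lt : (#|U :\: (A :|: [set r]%SET)| < m)%N.
  by rewrite (leq_trans _ Um) // -setDDl [ltnRHS](cardsD1 r) !inE rA rU.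
have sAr : s \notin A :|: [set r]%SET by rewrite !inE negb_or sA.
have big := IH _ _ lt zs1 (sub _ _ AU rU) (neq0 _ _) sU sAr.
have [a aE] := wall_jump zs2 AU A0 rU.
have [b bE] := wall_jump zs3 (sub _ _ AU sU) (neq0 _ _) rU.
have [c cE] := wall_jump zs AU A0 sU.
rewrite cE; congr (_ *: _); apply/eqP; rewrite -subr_eq0.
have : (c - length s) *: w s = (a - b) *: w r.
  rewrite !scalerBl -aE -bE -cE -big setUAC.
  by apply/rowP => i; rewrite !mxE; ring.
move=> /(congr1 (dot (f r))); rewrite !dotZr f0 // mulr0 => /eqP.
by rewrite mulf_eq0 (gt_eqF (fpos _ _ _)) // orbF.
Qed.

(** Moving along [- u] makes all the vectors negative one by one. *)
Lemma vertex_formula A z : signs A set0 z -> A \subset U -> A != set0 ->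
  Y A = Y U - \sum_(i in U :\: A) length i *: w i.
Proof.
have [m] := ubnP #|U :\: A|; elim: m => // m IH in A z *; rewrite ltnS => Um.
move=> zs AU A0; have [UA|[r1 r1P]] := set_0Vmem (U :\: A).
  rewrite UA big_set0 subr0; congr Y; apply/eqP; rewrite eqEsubset AU.
  by rewrite -setD_eq0 UA eqxx.
have zpos i : i \in U :\: A -> 0 < dot z (w i).
  move=> /setDP[iU iA]; have := zs i iU.
  by rewrite (negbTE iA) in_set0.
have [r rP rmin] := Order.TotalTheory.arg_minP (fun i => dot z (w i)) r1P.
have /setDP[rU rA] := rP.
pose t := dot z (w r); pose z1 := z - t *: u.
pose M := [set i in U :\: A | dot z1 (w i) == 0]%SET.
have rM : r \in M by rewrite !inE rA rU /= /z1 !dotBE hu // mulr1 subrr.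
have z1s : signs A M z1.
  move=> i iU; have := zs i iU; rewrite /z1 !inE iU !dotBE hu // mulr1.
  have t0 : 0 < t by exact: zpos.
  have [iA|iA] /= := boolP (i \in A); first by lra.
  move=> zi; case: ifP => // z1i; rewrite lt_def z1i subr_ge0 /=.
  by apply: rmin; apply/setDP.
have rM1 : [set r]%SET \subset M by rewrite sub1set.
have [i iU iM|e e0 zs'] := signs_perturb (B := set0) (N' := [set r]%SET)
    (y := f r) z1s (sub0set _) rM1.
  rewrite !inE; have [->|ir] := eqVneq i r; first by rewrite f0.
  by rewrite fpos.
rewrite setU0 in zs'; have step := wall_length zs' AU A0 rU rA.
have [z2 zs2] := signs_down zs'.
have lt : (#|U :\: (A :|: [set r]%SET)| < m)%N.
  by rewrite (leq_trans _ Um) // -setDDl [ltnRHS](cardsD1 r) !inE rA rU.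
have := IH _ _ lt zs2; rewrite subUset AU sub1set rU => /(_ isT).
have -> : A :|: [set r]%SET != set0.
  by apply/set0Pn; exists r; rewrite !inE eqxx orbT.
move=> /(_ isT) YAr; rewrite (big_setD1 r rP) /= opprD addrCA addrC.
have -> : (U :\: A) :\ r = U :\: (A :|: [set r]%SET) by rewrite setDDl.
by rewrite -YAr -step opprB addrC subrK.
Qed.

Let y0 := Y U - \sum_(i in U) length i *: w i.

(** The cones of the points [corner [set s]] all contain [u], so the lengths
    agree. *)
Lemma vertex1 s : s \in U -> Y [set s]%SET = y0 + length s *: w s /\
  forall z, (forall i, i \in U -> i != s -> 0 <= dot z (w i)) ->
    (forall i, i \in U -> dot z (w s) <= dot z (w i)) -> psi z = dot z (Y [set s]%SET).
Proof.
move=> sU; have sU1 : [set s]%SET \subset U by rewrite sub1set.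
have fs : signs set0 [set s]%SET (f s).
  move=> i iU; rewrite !inE; have [->|is_] := eqVneq i s; first by rewrite f0.
  by rewrite fpos.
have [z zs] := signs_down fs; rewrite set0U in zs; split.
  rewrite (vertex_formula zs sU1 (set1_neq0 s)) /y0 (big_setD1 s sU) /=.
  by rewrite opprD addrA addrAC subrK.
move=> z' z0 zmin; apply: (YP zs) => //; first exact: set1_neq0.
by move=> _ ->; rewrite (h_corner1 p sU z0 zmin).
Qed.

Definition common_length := psi u - dot u y0.

Lemma length_common s : s \in U -> length s = common_length.
Proof.
move=> sU; have [Ys psis] := vertex1 sU; rewrite /common_length psis ?Ys.
- by rewrite dotDr dotZr hu // mulr1 addrC addKr.
- by move=> i iU _; rewrite hu // ler01.
- by move=> i iU; rewrite !hu.
Qed.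

Lemma psi_formula z : psi z = common_length * h T z + dot z (y0 - common_length *: p).
Proof.
have YU : Y U = y0 + common_length *: \sum_(i in U) w i.
  rewrite /y0 scaler_sumr -addrA; apply/eqP; rewrite eq_sym -subr_eq0 addrAC subrr add0r.
  rewrite addrC -sumrB big1 // => i iU; by rewrite length_common // subrr.
have U0 : U != set0 by rewrite -card_gt0 ltnW.
have [[A [AU A0 neg pos]]|[s [sU zpos smin]]] := corner_cases w z U0; last first.
  have z0 i : i \in U -> i != s -> 0 <= dot z (w i) by move=> iU _; exact/ltW/zpos.
  have [Ys ->] := vertex1 sU; rewrite ?Ys // (h_corner1 p sU z0 smin).
  by rewrite length_common // /corner big_set1 !dotBE; ring.
have pos0 i iU iA := ltW (pos i iU iA).
pose A1 := [set i in A | dot z (w i) < 0]%SET.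
pose N := [set i in A | dot z (w i) == 0]%SET.
have zs : signs A1 N z.
  move=> i iU; rewrite !inE; have [iA|/(pos i iU)//] := boolP (i \in A).
  by have := neg i iA; case: ltgtP.
have AE : A1 :|: N = A.
  apply/setP => i; rewrite !inE -andb_orr; have [iA|//] := boolP (i \in A).
  by have := neg i iA; case: ltgtP.
have := psi_down zs; rewrite AE => -> //.
have [z' zs'] := signs_down zs; rewrite AE in zs'.
rewrite (vertex_formula zs' AU A0) YU (h_corner p AU A0 neg pos0) /corner.
have -> : \sum_(i in U :\: A) length i *: w i = common_length *: \sum_(i in U :\: A) w i.
  rewrite scaler_sumr; apply: eq_bigr => i /setDP[iU _].
  by rewrite length_common.
have -> : \sum_(i in U) w i = \sum_(i in A) w i + \sum_(i in U :\: A) w i.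
  by rewrite [LHS](big_setID A) /= (setIidPr AU).
by rewrite !dotBE; ring.
Qed.

Lemma common_length_ge0 : 0 <= common_length.
Proof.
have aQ : attains Q by case: defQ => /polytope_attains.
have U0 : U != set0 by rewrite -card_gt0 ltnW.
have [y Qy] := attains_face 0 aQ; have Qy' : Q y by case: Qy.
have [s sU] := set0Pn _ U0.
have hu1 : h T u = dot u p + 1.
  rewrite (h_corner1 p sU) => [||i iU]; rewrite ?hu //.
    by rewrite /corner big_set1 dotDr hu.
  by move=> i iU _; rewrite hu // ler01.
have hu2 : h T (- u) = - dot u p - #|U|%:R.
  rewrite (h_corner p (subxx _) U0) => [|i iU|i iU]; last by rewrite iU.
    rewrite dotNl /corner dotDr opprD; congr (_ - _).
    by rewrite dot_sumr (eq_bigr (fun=> 1)) // sumr_const.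
  by rewrite dotNl hu // oppr_le0 ler01.
have := attains_h u aQ Qy'; have := attains_h (- u) aQ Qy'.
rewrite !psi_formula hu1 hu2 !dotNl => le1 le2.
have : 0 <= common_length * (#|U|%:R - 1) by lra.
by rewrite pmulr_lge0 // subr_gt0 ltr1n.
Qed.

Lemma deformation_shape : (exists x, Q = [set x]) \/
  exists (t : R) x, 0 < t /\ Q = [set t *: y + x | y in T].
Proof.
have [pQ _] := defQ; have := common_length_ge0; rewrite le_eqVlt => /orP[/eqP c0|c0].
  left; exists y0; apply/seteqP; split=> y; last first.
    move=> ->; apply/polytope_halfspaces => // z; rewrite psi_formula -c0.
    by rewrite mul0r add0r scale0r subr0.
  move=> /polytope_halfspaces yh; apply: dot_inj => z; apply/eqP.
  have := yh pQ z; have := yh pQ (- z); rewrite !psi_formula -c0 !mul0r !add0r.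
  by rewrite scale0r subr0 !dotNl lerN2 eq_le => -> ->.
right; exists common_length, (y0 - common_length *: p); split=> //.
have U0 : U != set0 by rewrite -card_gt0 ltnW.
have pT := truncated_zonotope_polytope w p U0.
set x := y0 - _; apply/seteqP; split=> y.
  move=> /polytope_halfspaces yh; exists (common_length^-1 *: (y - x)).
    apply/polytope_halfspaces => // z; rewrite dotZr ler_pdivlMl //.
    by have := yh pQ z; rewrite psi_formula -/x [dot z (y - x)]dotDr dotNr; lra.
  by rewrite scalerA mulfV ?gt_eqF // scale1r subrK.
move=> [y' Ty' <-]; apply/polytope_halfspaces => // z; rewrite psi_formula -/x [leRHS]dotDr lerD2r.
rewrite dotZr ler_pM2l //; exact: (polytope_halfspaces _ pT).1.
Qed.

End Indecomposable.

(** A deformation has the support function [common_length * h T], up to a linear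
    function ([psi_formula]), and is determined by it. *)
Theorem truncated_zonotope_indecomposable (R : realType) (n : nat) (I : finType)
    (w : I -> 'rV[R]_n) (U : {set I}) (p u : 'rV[R]_n) :
  (forall i, i \in U -> dot u (w i) = 1) -> (1 < #|U|)%N ->
  (forall s, s \in U -> exists f, dot f (w s) = 0 /\
     forall r, r \in U -> r != s -> 0 < dot f (w r)) ->
  indecomposable (truncated_zonotope w U p).
Proof.
move=> hu U2 /= ext Q defQ.
have /choice[f fP] s : exists f, s \in U -> dot f (w s) = 0 /\
    forall r, r \in U -> r != s -> 0 < dot f (w r).
  have [/ext[f fs]|sU] := boolP (s \in U); last by exists 0.
  by exists f.
have /choice[Y YP] A : exists y, forall z, signs w U A set0 z -> A \subset U ->
    A != set0 -> forall z', normal_cone (truncated_zonotope w U p)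
      [set corner w p A] z' -> h Q z' = dot z' y.
  have [[z [zs AU A0]]|nz] := pselect (exists z,
      [/\ signs w U A set0 z, A \subset U & A != set0]); last first.
    by exists 0 => z zs AU A0; case: nz; exists z.
  have [y yP] := deformation_vertex defQ (signs_face p zs AU A0).
  by exists y => _ _ _ _; exact: yP.
apply: (deformation_shape hu _ _ U2 defQ (f := f) (Y := Y)).
- by move=> s /fP[].
- by move=> s r /fP[_]; exact.
- by move=> A z; exact: YP.
Qed.

(** * Piecewise linear functions on the fan of a simple polytope *)

Section Interpolation.
Variables (R : realType) (n : nat) (L : set 'rV[R]_n) (J : finType).
Variable (u : J -> 'rV[R]_n).
Local Notation V := 'rV[R]_n.
Implicit Types (w x y z : V) (c : {set J}).
Variables (A : {set J}) (b : J -> R) (C : set {set J}) (S : set V).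
Hypothesis sys : simple_system L u A b C S.
Hypothesis latL : lattice L.

(** A functional in the cones of two vertices is minimized at both, so only
    generators common to both cones contribute to it. *)
Lemma cone_overlap (v : J -> R) c1 x1 d1 c2 x2 d2 y1 y2 z :
  cell L u A b c1 x1 d1 -> cell L u A b c2 x2 d2 -> cone u c1 z -> cone u c2 z ->
  (forall j, j \in c1 -> dot (u j) y1 = v j) ->
  (forall j, j \in c2 -> dot (u j) y2 = v j) -> dot z y1 = dot z y2.
Proof.
move=> cl1 cl2 zc1 zc2 y1v y2v.
have x12 : dot z x1 = dot z x2.
  apply/le_anti; rewrite (cone_min sys cl1 zc1 (cell_mem sys cl2)).
  by rewrite (cone_min sys cl2 zc2 (cell_mem sys cl1)).
have /(coneP cl1) zd := zc1.
have term j : j \in c1 -> 0 <= dot z (d1 j) * (dot (u j) x2 - b j).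
  move=> jc; rewrite mulr_ge0 ?zd // subr_ge0 (cell_le cl2) //.
  exact: (subsetP (cell_sub cl1)).
have s0 : \sum_(j in c1) dot z (d1 j) * (dot (u j) x2 - b j) = 0.
  under eq_bigr do rewrite mulrBr.
  rewrite sumrB -(cell_dot cl1) -x12 (cell_dot cl1 z x1) -sumrB big1 // => j jc.
  by rewrite (cell_tight cl1) // subrr.
rewrite !(cell_dot cl1 z); apply: eq_bigr => j jc.
have /eqP := psumr_eq0P term s0 jc; rewrite mulf_eq0 => /orP[/eqP ->|].
  by rewrite !mul0r.
rewrite subr_eq0 => /eqP xb; rewrite y1v // y2v //.
apply: (cell_tight_in cl2) => //; exact: (subsetP (cell_sub cl1)).
Qed.

(** The interpolations on the cones of the vertices agree where these overlap;
    they are integral because the dual bases consist of lattice vectors. *)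
Lemma PL_interpolation (v : J -> R) : exists g : V -> R^o,
  [/\ PL (normal_fan S) g, forall c j, C c -> j \in c -> g (u j) = v j &
     (forall j, v j \is a Num.int) -> PLint L (normal_fan S) g].
Proof.
have /choice[Y YP] c : exists y, C c -> (forall j, j \in c -> dot (u j) y = v j) /\
    ((forall j, v j \is a Num.int) -> L y).
  have [Cc|nC] := pselect (C c); last by exists 0.
  have [x [d cl]] := system_cell sys Cc.
  exists (\sum_(j in c) v j *: d j) => _; split=> [j jc|vint].
    rewrite dot_sumr (bigD1 j) //= dotZr (cell_dual cl) // eqxx mulr1 big1 ?addr0 //.
    move=> i /andP[ic ij]; rewrite dotZr (cell_dual cl) // eq_sym (negbTE ij).
    by rewrite mulr0.
  apply: lattice_sum => // j jc; have /intrP[t ->] := vint j.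
  by rewrite scaler_int; apply: latticeMz => //; exact: (cell_lattice cl).
have /choice[cc ccP] z : exists c, C c /\ cone u c z.
  by have [c Cc zc] := system_cover sys z; exists c.
pose g (z : V) : R^o := dot z (Y (cc z)).
have gE c z : C c -> cone u c z -> g z = dot z (Y c).
  move=> Cc zc; have [Cz zz] := ccP z.
  have [x1 [d1 cl1]] := system_cell sys Cz; have [x2 [d2 cl2]] := system_cell sys Cc.
  have [Yz _] := YP _ Cz; have [Yc _] := YP _ Cc.
  exact: cone_overlap cl1 cl2 zz zc Yz Yc.
exists g; split.
- by apply/(PL_cells sys) => c Cc; exists (Y c) => z; exact: gE.
- move=> c j Cc jc; have [x [d cl]] := system_cell sys Cc.
  by rewrite (gE c) //; [have [-> //] := YP _ Cc | exact: cone_gen cl _ jc].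
- move=> vint; apply/(PLint_cells sys) => c Cc; have [_ Yint] := YP _ Cc.
  by exists (Y c); [exact: Yint | move=> z; exact: gE].
Qed.

Lemma PL_ext (f g : V -> R^o) : PL (normal_fan S) f -> PL (normal_fan S) g ->
  (forall j, j \in A -> f (u j) = g (u j)) -> f = g.
Proof.
move=> /(PL_cells sys) fP /(PL_cells sys) gP fg; apply/funext => z.
have [c Cc zc] := system_cover sys z; have [x [d cl]] := system_cell sys Cc.
rewrite (cone_linear_interpolation cl (fP c Cc) zc).
rewrite (cone_linear_interpolation cl (gP c Cc) zc); apply: eq_bigr => j jc.
by rewrite fg //; exact: (subsetP (cell_sub cl)).
Qed.

Lemma PLint_of_values (f : V -> R^o) : PL (normal_fan S) f ->
  (forall j, j \in A -> f (u j) \is a Num.int) -> PLint L (normal_fan S) f.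
Proof.
move=> /(PL_cells sys) fP fint; apply/(PLint_cells sys) => c Cc.
have [x [d cl]] := system_cell sys Cc.
exists (\sum_(j in c) f (u j) *: d j).
  apply: lattice_sum => // j jc.
  have /intrP[t ->] := fint j (subsetP (cell_sub cl) _ jc).
  by rewrite scaler_int; apply: latticeMz => //; exact: (cell_lattice cl).
move=> z zc; rewrite (cone_linear_interpolation cl (fP c Cc) zc) dot_sumr.
by apply: eq_bigr => j _; rewrite dotZr mulrC.
Qed.

Lemma PLint_int (f : V -> R^o) w : PLint L (normal_fan S) f -> dual L w ->
  f w \is a Num.int.
Proof.
move=> /(PLint_cells sys) fP Lw; have [c Cc wc] := system_cover sys w.
by have [y Ly ->] := fP c Cc; rewrite ?Lw.
Qed.

Lemma PLint_PL (f : V -> R^o) : PLint L (normal_fan S) f -> PL (normal_fan S) f.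
Proof. by move=> fP D /fP[y _ fy]; exists y. Qed.

End Interpolation.

(** * Linear combinations *)

Section Spans.
Variables (R : realType) (M : lmodType R).
Implicit Types (S X : set M).

Lemma lspan_gen S x : S x -> lspan S x.
Proof.
move=> Sx; exists 1%N, (fun=> x), (fun=> 1); split=> //.
by rewrite big_ord1 scale1r.
Qed.

Lemma lspan_mono S X : S `<=` X -> lspan S `<=` lspan X.
Proof. by move=> SX _ [k [g [c [gS ->]]]]; exists k, g, c; split=> // i; exact: SX. Qed.

Lemma lspanZ S (a : R) x : lspan S x -> lspan S (a *: x).
Proof.
move=> [k [g [c [gS ->]]]]; exists k, g, (fun i => a * c i); split=> //.
by rewrite scaler_sumr; apply: eq_bigr => i _; rewrite scalerA.
Qed.

Lemma lspanD S x y : lspan S x -> lspan S y -> lspan S (x + y).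
Proof.
move=> [k [g [c [gS ->]]]] [l [g' [c' [gS' ->]]]].
exists (k + l)%N, (fun i => match split i with inl j => g j | inr j => g' j end),
  (fun i => match split i with inl j => c j | inr j => c' j end).
split=> [i|]; first by case: (split i).
rewrite big_split_ord; congr +%R; apply: eq_bigr => i _.
  by rewrite (unsplitK (inl i)).
by rewrite (unsplitK (inr i)).
Qed.

Lemma lspan_sum S (J : Type) (r : seq J) (p : pred J) (F : J -> M) :
  (forall j, p j -> lspan S (F j)) -> lspan S (\sum_(j <- r | p j) F j).
Proof.
move=> SF; elim/big_ind: _ => //; last exact: lspanD.
by exists 0%N, (fun=> 0), (fun=> 0); split=> [[]//|]; rewrite big_ord0.
Qed.

(** Freeness in terms of subfamilies that need not be indexed by an initial
    segment. *)
Lemma lfree_family S k (g : 'I_k -> M) (c : 'I_k -> R) (A : {set 'I_k}) :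
  lfree S -> injective g -> (forall i, i \in A -> S (g i)) ->
  \sum_(i in A) c i *: g i = 0 -> forall i, i \in A -> c i = 0.
Proof.
move=> frS ginj gS; rewrite big_enum_val => s0 i iA.
have := frS _ (fun i : 'I_#|A| => g (enum_val i)) (fun i => c (enum_val i)).
move=> /(_ _ _ s0 (enum_rank_in iA i)); rewrite enum_rankK_in //; apply.
  by move=> j l /ginj/enum_val_inj.
by move=> j; apply: gS; exact: enum_valP.
Qed.

Lemma zspan_gen S x : S x -> zspan S x.
Proof. by move=> Sx; exists 1%N, (fun=> x), (fun=> 1); split=> //; rewrite big_ord1. Qed.

Lemma zspan_mono S X : S `<=` X -> zspan S `<=` zspan X.
Proof. by move=> SX _ [k [g [c [gS ->]]]]; exists k, g, c; split=> // i; exact: SX. Qed.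

Lemma zspanMz S x (a : int) : zspan S x -> zspan S (x *~ a).
Proof.
move=> [k [g [c [gS ->]]]]; exists k, g, (fun i => c i * a); split=> //.
by rewrite mulrz_suml; apply: eq_bigr => i _; rewrite mulrzA.
Qed.

Lemma zspanD S x y : zspan S x -> zspan S y -> zspan S (x + y).
Proof.
move=> [k [g [c [gS ->]]]] [l [g' [c' [gS' ->]]]].
exists (k + l)%N, (fun i => match split i with inl j => g j | inr j => g' j end),
  (fun i => match split i with inl j => c j | inr j => c' j end).
split=> [i|]; first by case: (split i).
rewrite big_split_ord; congr +%R; apply: eq_bigr => i _.
  by rewrite (unsplitK (inl i)).
by rewrite (unsplitK (inr i)).
Qed.

Lemma zspan_sum S (J : Type) (r : seq J) (p : pred J) (F : J -> M) :
  (forall j, p j -> zspan S (F j)) -> zspan S (\sum_(j <- r | p j) F j).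
Proof.
move=> SF; elim/big_ind: _ => //; last exact: zspanD.
by exists 0%N, (fun=> 0), (fun=> 0); split=> [[]//|]; rewrite big_ord0.
Qed.

End Spans.

Lemma unitriangular_unit (m : nat) (r : rel 'I_m) : (forall i, r i i) ->
  (forall i j, r i j -> (i <= j)%N) -> (\matrix_(i, j) (r i j)%:R : 'M[int]_m) \in unitmx.
Proof.
move=> rr rle; rewrite unitmxE -det_tr det_trig.
  rewrite big1 ?unitr1 // => i _; by rewrite !mxE rr.
apply/is_trig_mxP => i j ij; rewrite !mxE.
by case: (boolP (r j i)) => // /rle; rewrite leqNgt ij.
Qed.

(** * Vertices of a primitive Delzant zonotope *)

Section DelzantZonotope.
Variables (R : realType) (n : nat) (L : set 'rV[R]_n).
Variables (I : finType) (E : I -> 'rV[R]_n * 'rV[R]_n).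
Local Notation V := 'rV[R]_n.
Implicit Types (u v x y z f : V) (a K : {set I}).

Local Notation Z := (zonotope E [set: I]).
Local Notation en := (en E).
Local Notation wv := (wv E).
Local Notation vx a := (vtx E a [set: I]).

(** The edges of [Z] at the vertex [vx a] are the segments in [K]; they form a
    basis of the lattice with dual basis [g], and the cone they generate
    contains all the segments leaving [vx a]. *)
Record frame a K (g : I -> V) : Prop := Frame {
  frame_card : #|K| = n;
  frame_dual : forall i j, i \in K -> j \in K -> dot (g i) (wv a j) = (i == j)%:R;
  frame_lattice : forall j, j \in K -> dual L (g j);
  frame_expand : forall x, x = \sum_(j in K) dot (g j) x *: wv a j;
  frame_ge0 : forall i j, j \in K -> 0 <= dot (g j) (wv a i) }.

Hypothesis latL : lattice L.
Hypothesis famE : segment_family E.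
Hypothesis intE : integral L E.
Hypothesis pdZ : primitive_delzant L Z.

Let aZ : attains Z := @zonotope_attains _ _ _ E _.

Lemma E_nondeg i : (E i).1 != (E i).2.
Proof. by have [+ _] := famE; exact. Qed.

Lemma wv0 a i : wv a i != 0.
Proof. exact/wv_neq0/E_nondeg. Qed.

Lemma wv_lattice a i : L (wv a i).
Proof. by have [L1 L2] := intE i; rewrite /wv; case: ifP => _; exact: latticeB. Qed.

Lemma en_lattice a i : L (en a i).
Proof. by have [L1 L2] := intE i; rewrite /en; case: ifP. Qed.

Lemma vtx_lattice a K : L (vtx E a K).
Proof. by apply: lattice_sum => // i _; exact: en_lattice. Qed.

(** If only segments parallel to the [j]-th start along the face selected by
    [z], this face is an edge. Its only lattice points being its endpoints,
    there is no second parallel segment and the [j]-th one is primitive. *)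
Lemma primitive_edge f a z j : selects E f a [set: I] ->
  weakly_selects E z a [set: I] -> dot z (wv a j) = 0 ->
  (forall i, dot z (wv a i) = 0 -> exists c, wv a i = c *: wv a j) ->
  (forall i, dot z (wv a i) = 0 -> i = j) /\ edge_vectors L Z (vx a) (wv a j).
Proof.
move=> fa za zj zW; have [_ latv] := pdZ.
have vx_neq y : (vx a + y != vx a) = (y != 0).
  by rewrite -[X in _ != X]addr0 (inj_eq (addrI _)).
have [|ee ev ej el] := zonotope_edge E_nondeg (in_setT j) za zj.
  by move=> i _; exact: zW.
have strict s : face Z z (vx a + s *: wv a j) -> L (vx a + s *: wv a j) ->
    exists u, forall y, Z y -> y != vx a + s *: wv a j ->
      dot u (vx a + s *: wv a j) < dot u y.
  by move=> es Ls; apply: vertex_strict => //; apply: latv Ls; [exact: ee | exact: es].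
have fpos i : 0 < dot f (wv a i) by apply: fa; rewrite inE.
have unique i : dot z (wv a i) = 0 -> i = j.
  move=> zi; apply/eqP; apply: contraT => ij.
  have [c ci] := zW i zi.
  have c0 : 0 < c by have := fpos i; rewrite ci dotZr pmulr_lgt0.
  have [||u uP] := strict 1; rewrite ?scale1r //.
    by apply: latticeD => //; [exact: vtx_lattice | exact: wv_lattice].
  rewrite scale1r in uP.
  have u1 : dot u (wv a j) < 0.
    have := uP (vx a) (zonotope_vtx _ _ _); rewrite dotDr gtrDl; apply.
    by rewrite eq_sym vx_neq wv0.
  have Zij : Z (vx a + wv a j + wv a i).
    have := zonotope_vtx_sum E a (subsetT [set i; j]%SET).
    by rewrite big_setU1 ?inE //= big_set1 addrA addrAC.
  have := uP _ Zij; rewrite -[X in _ != X]addr0 (inj_eq (addrI _)) wv0 => /(_ isT).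
  by rewrite [X in _ < X]dotDr ltrDl ci dotZr pmulr_rgt0 // ltNge ltW.
split=> //; split; last first.
  exists (face Z z); split=> //; exists 1; first exact: ltr01.
  by rewrite scale1r.
split; [exact: wv_lattice | exact: wv0 | move=> t /andP[t0 t1] Lt].
have [||u uP] := strict t.
- apply: (face_eq ev); last by rewrite dotDr dotZr zj mulr0 addr0.
  by apply: zonotope_vtx_wv; rewrite ?inE // ltW //= ltW.
- by apply: latticeD => //; exact: vtx_lattice.
have t_wv s : s != 0 -> s *: wv a j != 0 by rewrite scaler_eq0 negb_or wv0 andbT.
have := uP (vx a) (zonotope_vtx _ _ _).
rewrite dotDr gtrDl dotZr pmulr_rlt0 // => ult; have : dot u (wv a j) < 0.
  by apply: ult; rewrite eq_sym vx_neq t_wv // gt_eqF.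
apply/negP; rewrite -leNgt; have := uP (vx a + wv a j) _.
rewrite !dotDr dotZr ltrD2l => ugt; apply: ltW.
suff : 0 < (1 - t) * dot u (wv a j) by rewrite pmulr_rgt0 // subr_gt0.
rewrite mulrBl mul1r subr_gt0; apply: ugt; first by case: ej.
rewrite (inj_eq (addrI _)) -subr_eq0 -[X in X - _]scale1r -scalerBl t_wv //.
by rewrite subr_eq0 gt_eqF.
Qed.

(** Conversely, all the segments along an edge of [Z] at [vx a] are parallel, so
    that there is only one of them. *)
Lemma edge_single f a z : selects E f a [set: I] ->
  weakly_selects E z a [set: I] -> affdim (face Z z) = 1%N ->
  forall y, face Z z y -> y != vx a ->
  exists i (s : R), [/\ 0 < s <= 1, y = vx a + s *: wv a i, dot z (wv a i) = 0,
    forall k, dot z (wv a k) = 0 -> k = i & edge_vectors L Z (vx a) (wv a i)].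
Proof.
move=> fa za d1 y /(zonotope_face _ za)[t [t01 t0 yE]] yv.
have [i ti] : exists i, t i != 0.
  apply: contrapT => /forallNP tz; case/eqP: yv; rewrite yE big1 ?addr0 // => i _.
  by have /negP/negPn/eqP -> := tz i; rewrite scale0r.
have zt k : t k != 0 -> dot z (wv a k) = 0.
  by move=> tk; have /eqP := t0 k (in_setT k); rewrite mulf_eq0 (negbTE tk) => /eqP.
have zi := zt i ti.
have [|uniq ev] := primitive_edge fa za zi.
  by move=> k zk; apply: (edge_parallel za d1) => //; exact: wv0.
exists i, (t i); split=> //.
  by rewrite lt_def ti /=; exact: t01.
rewrite yE (bigD1 i) //= big1 ?addr0 // => k /andP[_ ki].
have [->|/zt/uniq kE] := eqVneq (t k) 0; first by rewrite scale0r.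
by rewrite kE eqxx in ki.
Qed.

(** A minimal set of generators of the cone of all segments leaving [vx a]
    consists of edges, and contains every edge; so it is the basis of the
    lattice that the Delzant condition provides. *)
Lemma frame_exists f a : selects E f a [set: I] -> exists K g, frame a K g.
Proof.
move=> fa; have [[_ _ _ dz] _] := pdZ.
have [K [_ Kgen Kext]] := extreme_generators fa.
have gen i : cone (wv a) K (wv a i) by apply: Kgen; rewrite inE.
have ext j : j \in K -> exists z, [/\ weakly_selects E z a [set: I],
    dot z (wv a j) = 0 & forall i, dot z (wv a i) = 0 -> i = j].
  move=> /Kext[z [zj za zW]]; exists z; split=> //.
  by have [i|uniq _] := primitive_edge fa za zj; [apply: zW; rewrite inE | exact: uniq].
have wv_inj i j : j \in K -> wv a i = wv a j -> i = j.
  by move=> /ext[z [_ zj uniq]] ij; apply: uniq; rewrite ij.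
have edgeK w : edge_vectors L Z (vx a) w <-> exists2 j, j \in K & wv a j = w.
  split=> [[wprim [e [[[_ [z ez]] d1] ev [t t0 et]]]]|[j jK <-]]; last first.
    have [z [za zj uniq]] := ext j jK.
    have [i zi|_ //] := primitive_edge fa za zj.
    by exists 1; rewrite scale1r (uniq i zi).
  rewrite ez in ev et d1; have za := face_weakly_selects ev.
  have w0 : w != 0 by case: wprim.
  have [|i [s [/andP[s0 _] ws zi uniq [wi _]]]] := edge_single fa za d1 et.
    by rewrite -[X in _ != X]addr0 (inj_eq (addrI _)) scaler_eq0 (gt_eqF t0).
  have wE : w = wv a i.
    apply: (primitive_ray wprim wi (c := t^-1 * s)); rewrite ?mulr_gt0 ?invr_gt0 //.
    move/addrI: ws => ws; rewrite -scalerA -ws scalerA mulVf ?scale1r // gt_eqF //.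
  have [|k kK /uniq ki] := cone_support_inhabited _ (gen i) zi (wv0 a i).
    by move=> k _; rewrite za ?inE.
  by exists i; rewrite // -ki.
have winj : injective (fun i : 'I_#|K| => wv a (enum_val i)).
  by move=> i j /wv_inj ij; apply: enum_val_inj; apply: ij; exact: enum_valP.
have [|Kn [g [gd gL gx]]] := zbasis_dual latL winj.
  have := dz (vx a) (selects_vertex fa); congr zbasis.
  apply/seteqP; split=> [w /edgeK[j jK <-]|_ [i _ <-]]; last first.
    by apply/edgeK; exists (enum_val i) => //; exact: enum_valP.
  by exists (enum_rank_in jK j); rewrite // enum_rankK_in.
have /choice[G GP] j : exists y, forall i : 'I_#|K|, enum_val i = j -> y = g i.
  have [jK|jK] := boolP (j \in K); last first.
    by exists 0 => i ij; rewrite -ij enum_valP in jK.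
  by exists (g (enum_rank_in jK j)) => i ij; congr g; apply: enum_val_inj;
    rewrite enum_rankK_in.
have GE i : G (enum_val i) = g i by exact: GP.
have KE j : j \in K -> exists i : 'I_#|K|, enum_val i = j.
  by move=> jK; exists (enum_rank_in jK j); rewrite enum_rankK_in.
have Gd i j : i \in K -> j \in K -> dot (G i) (wv a j) = (i == j)%:R.
  move=> /KE[i' <-] /KE[j' <-]; rewrite GE gd.
  by rewrite (inj_eq enum_val_inj).
exists K, G; split=> //.
- by move=> j /KE[i <-]; rewrite GE.
- by move=> x; rewrite {1}(gx x) [RHS]big_enum_val; apply: eq_bigr => i _; rewrite GE.
- move=> i j jK; apply: cone_dot_ge0 (gen i) => k kK.
  by rewrite Gd // ler0n.
Qed.

(** * The faces of a primitive Delzant zonotope *)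

Section Frames.
Variables (f : V) (a K : {set I}) (g : I -> V).
Hypotheses (fa : selects E f a [set: I]) (fr : frame a K g).

Lemma frame_dot z x : dot z x = \sum_(j in K) dot z (wv a j) * dot (g j) x.
Proof.
rewrite {1}(frame_expand fr x) dot_sumr; apply: eq_bigr => j _.
by rewrite dotZr mulrC.
Qed.

Lemma frame_normal z : z = \sum_(j in K) dot z (wv a j) *: g j.
Proof.
apply: dot_inj => x; rewrite dotC frame_dot [RHS]dotC dot_suml.
by apply: eq_bigr => j _; rewrite dotZl.
Qed.

Lemma frame_weakly_selects z :
  (forall j, j \in K -> 0 <= dot z (wv a j)) -> weakly_selects E z a [set: I].
Proof.
move=> zK i _; rewrite frame_dot; apply: sumr_ge0 => j jK.
by rewrite mulr_ge0 ?zK ?(frame_ge0 fr).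
Qed.

Lemma frame_g_selects j : j \in K -> weakly_selects E (g j) a [set: I].
Proof. by move=> jK i _; exact: (frame_ge0 fr). Qed.

Lemma vx_wv j : Z (vx a + wv a j).
Proof.
by rewrite -[wv a j]scale1r; apply: zonotope_vtx_wv; rewrite ?inE // ler01 lexx.
Qed.

Lemma frame_face z x : weakly_selects E z a [set: I] ->
  face Z z x <-> Z x /\ forall j, j \in K -> 0 < dot z (wv a j) ->
    dot (g j) x = dot (g j) (vx a).
Proof.
move=> za; rewrite /face /= (zonotope_h za); split=> [[Zx]|[Zx gx]]; last first.
  split=> //; rewrite !(frame_dot z); apply: eq_bigr => j jK.
  have [->|zj] := eqVneq (dot z (wv a j)) 0; first by rewrite !mul0r.
  by rewrite gx // lt_def zj za ?inE.
rewrite !(frame_dot z) => /eqP; rewrite -subr_eq0 -sumrB => /eqP s0.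
have ge0 j : j \in K ->
    0 <= dot z (wv a j) * dot (g j) x - dot z (wv a j) * dot (g j) (vx a).
  move=> jK; rewrite -mulrBr mulr_ge0 ?za ?inE // subr_ge0.
  by apply: zonotope_vtx_min Zx; exact: frame_g_selects.
split=> // j jK zj; have /eqP := psumr_eq0P ge0 s0 jK.
by rewrite -mulrBr mulf_eq0 gt_eqF //= subr_eq0 => /eqP.
Qed.

Lemma frame_face_wv z j : weakly_selects E z a [set: I] -> dot z (wv a j) = 0 ->
  face Z z (vx a + wv a j).
Proof.
move=> za zj; apply: (face_eq (weakly_selects_face za)); first exact: vx_wv.
by rewrite dotDr zj addr0.
Qed.

Lemma frame_affdim z : weakly_selects E z a [set: I] ->
  affdim (face Z z) = #|[set j in K | dot z (wv a j) == 0]|.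
Proof.
move=> za; set K0 := [set j in K | _]%SET.
have K0P j : j \in K0 -> j \in K /\ dot z (wv a j) = 0.
  by rewrite inE => /andP[jK /eqP].
pose M : 'M[R]_(#|K0|, n) := \matrix_i wv a (enum_val i).
apply: (@affdim_span _ _ _ _ (vx a) M); first exact: weakly_selects_face.
- apply/row_freeP; exists (\matrix_(i, k) g (enum_val k) 0 i).
  apply/matrixP => i k; rewrite mxE.
  have [iK _] := K0P _ (enum_valP i); have [kK _] := K0P _ (enum_valP k).
  transitivity (dot (g (enum_val k)) (wv a (enum_val i))).
    by apply: eq_bigr => l _; rewrite !mxE mulrC.
  by rewrite (frame_dual fr) // (inj_eq enum_val_inj) mxE eq_sym.
- move=> i; rewrite rowK; apply: frame_face_wv => //.
  by have [] := K0P _ (enum_valP i).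
- move=> y /(frame_face _ za)[Zy gy]; rewrite (frame_expand fr (y - vx a)).
  apply: summx_sub => j jK; have [zj|zj] := eqVneq (dot z (wv a j)) 0.
    have jK0 : j \in K0 by rewrite inE jK zj eqxx.
    apply: scalemx_sub; have <- : row (enum_rank_in jK0 j) M = wv a j.
      by rewrite rowK enum_rankK_in.
    exact: row_sub.
  rewrite dotDr dotNr gy ?subrr ?scale0r ?sub0mx //.
  by rewrite lt_def zj za ?inE.
Qed.

Lemma frame_g_facet j : j \in K -> facet Z (face Z (g j)).
Proof.
move=> jK; split; first exact: attains_is_face.
rewrite frame_affdim; last exact: frame_g_selects.
rewrite -[RHS](frame_card fr) (cardsD1 j K) jK add1n; congr _.+1.
apply: eq_card => i; rewrite !inE.
have [iK|iK] := boolP (i \in K); rewrite /= ?andbF //.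
by rewrite andbT (frame_dual fr) // pnatr_eq0 eqb0 eq_sym.
Qed.

Lemma frame_facet G : facet Z G -> G (vx a) -> exists2 j, j \in K & G = face Z (g j).
Proof.
move=> [[_ [z Gz]] d1]; rewrite Gz in d1 *; move=> /face_weakly_selects za.
have : #|[set j in K | dot z (wv a j) == 0]|.+1 = #|K|.
  by rewrite (frame_card fr) -frame_affdim.
rewrite -(cardsID [set j | dot z (wv a j) == 0]%SET K).
have -> : [set j in K | dot z (wv a j) == 0]%SET = K :&: [set j | dot z (wv a j) == 0]%SET.
  by apply/setP => j; rewrite !inE.
rewrite -addn1 => /addnI/esym/eqP/cards1P[j Kj].
have : j \in [set j]%SET by rewrite inE.
rewrite -Kj !inE => /andP[zj jK]; exists j => //.
have zK k : k \in K -> 0 < dot z (wv a k) -> k = j.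
  move=> kK zk; apply/eqP; have : k \in [set j]%SET; last by rewrite inE.
  by rewrite -Kj !inE kK gt_eqF.
have gj := frame_g_selects jK.
apply/seteqP; split=> x.
  move=> /(frame_face _ za)[Zx gx]; apply/(frame_face _ gj); split=> // k kK.
  rewrite (frame_dual fr) //; case: eqVneq => [<- _|]; last by rewrite ltxx.
  by apply: gx => //; rewrite lt_def zj za ?inE.
move=> /(frame_face _ gj)[Zx gx]; apply/(frame_face _ za); split=> // k kK /(zK _ kK) ->.
by apply: gx; rewrite // (frame_dual fr) // eqxx ltr01.
Qed.

Lemma frame_g_primitive j : j \in K -> primitive (dual L) (g j).
Proof.
move=> jK; have gj : dot (g j) (wv a j) = 1 by rewrite (frame_dual fr) ?eqxx.
split; first exact: (frame_lattice fr).
  by apply: contra_eq_neq gj => ->; rewrite dot0l eq_sym oner_eq0.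
move=> t /andP[t0 t1] /(_ _ (wv_lattice a j)).
rewrite dotZl gj mulr1 => /intrP[k tk]; move: t0 t1; rewrite tk.
by rewrite ltr0z ltrz1; case: k {tk} => // -[].
Qed.

Lemma facet_normal_frame j : j \in K -> facet_normal L Z (face Z (g j)) = g j.
Proof.
move=> jK; apply: xget_unique => [|u [uprim uj]].
  by split; [exact: frame_g_primitive | by []].
have gja := frame_g_selects jK; have ua : weakly_selects E u a [set: I].
  by apply: face_weakly_selects; rewrite uj; exact: weakly_selects_face.
have uE : u = dot u (wv a j) *: g j.
  rewrite {1}(frame_normal u) (bigD1 j) //= big1 ?addr0 // => k /andP[kK kj].
  suff -> : dot u (wv a k) = 0 by rewrite scale0r.
  have gk : face Z (g j) (vx a + wv a k).
    by apply: frame_face_wv => //; rewrite (frame_dual fr) // eq_sym (negbTE kj).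
  move: gk; rewrite -uj => -[_]; rewrite (zonotope_h ua) dotDr -[RHS]addr0.
  by move/addrI.
apply: (primitive_ray uprim (frame_g_primitive jK) _ uE).
rewrite lt_def ua ?inE // andbT; apply/eqP => u0; case: uprim => _ /eqP + _.
by apply; rewrite uE u0 scale0r.
Qed.

End Frames.

Variables (m : nat) (F : 'I_m -> set V).
Hypothesis Finj : injective F.
Hypothesis Frange : range F = proper_face Z.
Hypothesis Fmono : forall i j, F i `<=` F j -> (i <= j)%N.

Definition nrm k : V := face_normal L Z (F k).
Definition offset k : R := h Z (nrm k).
Definition facets : {set 'I_m} := [set k | `[< facet Z (F k) >]]%SET.
Definition above k : {set 'I_m} := [set l in facets | `[< F k `<=` F l >]]%SET.
Definition facets_at a : {set 'I_m} := [set l in facets | `[< F l (vx a) >]]%SET.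

Lemma above_facets k : above k \subset facets.
Proof. by apply/subsetP => l; rewrite inE => /andP[]. Qed.

Lemma proper_index G : proper_face Z G -> exists k, F k = G.
Proof. by rewrite -Frange => -[k _ <-]; exists k. Qed.

Lemma F_proper k : proper_face Z (F k).
Proof. by rewrite -Frange; exists k. Qed.

Lemma F_sub k : F k `<=` Z.
Proof. by have [[_ [z ->]] _] := F_proper k; move=> x []. Qed.

Lemma F_functional a k : F k (vx a) ->
  exists2 z, F k = face Z z & weakly_selects E z a [set: I].
Proof.
have [[_ [z Fz]] _] := F_proper k; rewrite Fz => /face_weakly_selects za.
by exists z.
Qed.

Lemma F_vertex k : exists a f, selects E f a [set: I] /\ F k (vx a).
Proof.
have [[_ [z ->]] _] := F_proper k.
have [a [f [fa za]]] := weakly_selects_chamber E_nondeg z.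
by exists a, f; split=> //; exact: weakly_selects_face.
Qed.

Section AtVertex.
Variables (f : V) (a K : {set I}) (g : I -> V).
Hypotheses (fa : selects E f a [set: I]) (fr : frame a K g).

Lemma frame_proper_face z j : weakly_selects E z a [set: I] -> j \in K ->
  0 < dot z (wv a j) -> proper_face Z (face Z z).
Proof.
move=> za jK zj; split; first exact: attains_is_face.
move=> zZ; have := vx_wv a j; rewrite -zZ => -[_]; rewrite (zonotope_h za) dotDr.
by move/eqP; rewrite -subr_eq0 addrC addKr gt_eqF.
Qed.

Lemma frame_gj_neq i j : i \in K -> j \in K -> face Z (g i) `<=` face Z (g j) -> i = j.
Proof.
move=> iK jK ij; apply/eqP; apply: contraT => neq.
have : face Z (g j) (vx a + wv a j).
  apply/ij/frame_face_wv; first exact: (frame_g_selects fr iK).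
  by rewrite (frame_dual fr) // (negbTE neq).
move=> [_]; rewrite (zonotope_h (frame_g_selects fr jK)) dotDr (frame_dual fr) // eqxx.
by move/eqP; rewrite -subr_eq0 addrC addKr oner_eq0.
Qed.

Lemma facets_frame : exists kk : I -> 'I_m,
  [/\ forall j, j \in K -> F (kk j) = face Z (g j),
     {in K &, injective kk},
     facets_at a = kk @: K &
     forall j, j \in K -> facet_normal L Z (F (kk j)) = g j].
Proof.
have gpos j : j \in K -> dot (g j) (wv a j) = 1.
  by move=> jK; rewrite (frame_dual fr) ?eqxx.
have ex j : j \in K -> exists k, F k = face Z (g j).
  move=> jK; apply/proper_index/(frame_proper_face _ jK); last by rewrite gpos ?ltr01.
  exact: (frame_g_selects fr jK).
have /choice[kk kkP] j : exists k, j \in K -> F k = face Z (g j).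
  have [/ex[k kj]|_] := boolP (j \in K); first by exists k.
  have [K0|[i /ex[k _]]] := set_0Vmem K; last by exists k.
  by case/eqP: (wv0 a j); rewrite (frame_expand fr (wv a j)) K0 big_set0.
exists kk; split=> //.
- move=> i j iK jK ij; apply: frame_gj_neq => //.
  by rewrite -!kkP // ij.
- apply/setP => k; apply/idP/imsetP => [|[j jK ->]].
    rewrite !inE => /andP[/asboolP fk /asboolP ka].
    have [j jK kj] := frame_facet fr fk ka; exists j => //.
    by apply: Finj; rewrite kkP.
  rewrite !inE; apply/andP; split; apply/asboolP; rewrite kkP //.
    exact: (frame_g_facet fr jK).
  exact: weakly_selects_face (frame_g_selects fr jK).
- by move=> j jK; rewrite kkP // (facet_normal_frame fr jK).
Qed.

Lemma above_frame kk k z : (forall j, j \in K -> F (kk j) = face Z (g j)) ->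
  facets_at a = kk @: K -> F k = face Z z -> weakly_selects E z a [set: I] ->
  above k = kk @: [set j in K | 0 < dot z (wv a j)].
Proof.
move=> kkF kkK kz za; apply/setP => l; apply/idP/imsetP => [|[j + ->]].
  rewrite inE => /andP[lf /asboolP kl].
  have : l \in facets_at a.
    by rewrite inE lf; apply/asboolP/kl; rewrite kz; exact: weakly_selects_face.
  rewrite kkK => /imsetP[j jK lj]; exists j; rewrite // inE jK lt_def za ?inE // andbT.
  apply/eqP => zj; have : F l (vx a + wv a j).
    by apply: kl; rewrite kz; exact: frame_face_wv.
  rewrite lj kkF // => -[_]; rewrite (zonotope_h (frame_g_selects fr jK)) dotDr.
  rewrite (frame_dual fr) // eqxx.
  by move/eqP; rewrite -subr_eq0 addrC addKr oner_eq0.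
rewrite inE => /andP[jK zj]; have : kk j \in facets_at a by rewrite kkK imset_f.
rewrite inE => /andP[kf _]; rewrite inE kf; apply/asboolP; rewrite kz kkF // => x.
move=> /(frame_face fr _ za)[Zx gx]; apply/(frame_face fr _ (frame_g_selects fr jK)).
split=> // i iK; rewrite (frame_dual fr) //; case: eqVneq => [<- _|]; last by rewrite ltxx.
exact: gx.
Qed.

End AtVertex.

Lemma facet_index G : facet Z G -> exists k, F k = G.
Proof.
move=> [fG dG]; apply: proper_index; split=> // GZ.
have [[_ dZ _ _] _] := pdZ; move: dG; rewrite GZ -[RHS]dZ.
by move=> /eqP; rewrite eqn_leq ltnn.
Qed.

Lemma face_normal_sum k :
  nrm k = \sum_(l in above k) facet_normal L Z (F l).
Proof.
rewrite /nrm /face_normal (reindex_fsbig F [set` above k]); last first.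
  split=> [l /=|l l' _ _|G /= [fG kG]]; first 2 last.
  - have [l lG] := facet_index fG; exists l => //=.
    by rewrite !inE lG; apply/andP; split; apply/asboolP.
  - by rewrite !inE => /andP[/asboolP fl /asboolP kl].
  - exact: Finj.
rewrite -(@bigfs _ _ _ _ (index_enum 'I_m)) ?index_enum_uniq // => l _.
by rewrite mem_index_enum.
Qed.

Lemma at_vertex_pre f a : selects E f a [set: I] -> exists K g kk,
  [/\ frame a K g, forall j, j \in K -> F (kk j) = face Z (g j),
      {in K &, injective kk}, facets_at a = kk @: K &
      forall j, j \in K -> facet_normal L Z (F (kk j)) = g j].
Proof.
move=> fa; have [K [g fr]] := frame_exists fa.
have [kk [kkF kki kkK kkn]] := facets_frame fr.
by exists K, g, kk.
Qed.

Lemma above_self l : l \in facets -> above l = [set l]%SET.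
Proof.
move=> lf; have [a [f [fa la]]] := F_vertex l.
have [K [g [kk [fr kkF kki kkK kkn]]]] := at_vertex_pre fa.
have : l \in facets_at a by rewrite inE lf; apply/asboolP.
rewrite kkK => /imsetP[j jK lj].
rewrite lj (above_frame fr kkF kkK (kkF j jK) (frame_g_selects fr jK)).
rewrite -imset_set1.
suff -> : [set i in K | 0 < dot (g j) (wv a i)]%SET = [set j]%SET by [].
apply/setP => i; rewrite !inE.
have [iK|iK] := boolP (i \in K); last by case: eqVneq => // ij; rewrite ij jK in iK.
by rewrite (frame_dual fr) // ltr0n lt0b eq_sym.
Qed.

Lemma nrm_facet l : l \in facets -> nrm l = facet_normal L Z (F l).
Proof. by move=> lf; rewrite face_normal_sum above_self // big_set1. Qed.

Lemma nrm_sum k : nrm k = \sum_(l in above k) nrm l.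
Proof.
rewrite {1}face_normal_sum; apply: eq_bigr => l lk; rewrite nrm_facet //.
exact: (subsetP (above_facets k)).
Qed.

Lemma at_vertex f a : selects E f a [set: I] -> exists K g kk,
  [/\ frame a K g, forall j, j \in K -> F (kk j) = face Z (g j),
      {in K &, injective kk}, facets_at a = kk @: K &
      forall j, j \in K -> nrm (kk j) = g j].
Proof.
move=> fa; have [K [g [kk [fr kkF kki kkK kkn]]]] := at_vertex_pre fa.
exists K, g, kk; split=> // j jK; rewrite nrm_facet ?kkn //.
have : kk j \in facets_at a by rewrite kkK imset_f.
by rewrite inE => /andP[].
Qed.

Lemma face_nrm_facet l : l \in facets -> face Z (nrm l) = F l.
Proof.
move=> lf; have [a [f [fa la]]] := F_vertex l.
have [K [g [kk [fr kkF kki kkK kkn]]]] := at_vertex fa.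
have : l \in facets_at a by rewrite inE lf; apply/asboolP.
by rewrite kkK => /imsetP[j jK ->]; rewrite kkn // kkF.
Qed.

Definition vertex_cell_at a d := [/\ cell L nrm facets offset (facets_at a) (vx a) d,
  forall k, k \in facets_at a -> exists i, d k = wv a i &
  forall i k, k \in facets_at a -> 0 <= dot (nrm k) (wv a i)].

(** The facets at a vertex, with the segments of the edges leaving it as dual
    basis. *)
Lemma cell_at f a : selects E f a [set: I] -> exists d, vertex_cell_at a d.
Proof.
move=> fa; have [K [g [kk [fr kkF kki kkK kkn]]]] := at_vertex fa.
have /choice[d dP] k : exists y, forall j, j \in K -> kk j = k -> y = wv a j.
  have [[j [jK jk]]|nj] := pselect (exists j, j \in K /\ kk j = k).
    by exists (wv a j) => i iK ik; congr wv; apply: kki; rewrite ?ik.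
  by exists 0 => j jK jk; case: nj; exists j.
have kP k : k \in facets_at a -> exists j, [/\ j \in K, k = kk j, d k = wv a j &
    nrm k = g j].
  rewrite kkK => /imsetP[j jK ->]; exists j; rewrite kkn //; split=> //.
  exact: dP.
exists d; split.
- split.
  + by apply/subsetP => k; rewrite inE => /andP[].
  + move=> k l /kP[i [iK -> _ ->]] /kP[j [jK -> -> _]].
    by rewrite (frame_dual fr) // (inj_in_eq kki).
  + move=> w; rewrite kkK big_imset //= {1}(frame_normal fr w).
    by apply: eq_bigr => j jK; rewrite kkn // (dP _ j).
  + by move=> k /kP[j [_ _ -> _]]; exact: wv_lattice.
  + move=> k /kP[j [jK _ _ kg]]; rewrite /offset kg.
    by rewrite (zonotope_h (frame_g_selects fr jK)).
  + move=> k kf ka; rewrite lt_def attains_h ?andbT //; last exact: zonotope_vtx.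
    apply: contra ka => /eqP kh; rewrite inE kf; apply/asboolP.
    by rewrite -face_nrm_facet //; split; [exact: zonotope_vtx | ].
- by move=> k /kP[j [_ _ -> _]]; exists j.
- by move=> i k /kP[j [jK _ _ ->]]; exact: (frame_ge0 fr).
Qed.

Definition vertex_cells : set {set 'I_m} :=
  [set c | exists a f, selects E f a [set: I] /\ c = facets_at a].

Lemma zonotope_system : simple_system L nrm facets offset vertex_cells Z.
Proof.
have cover w : exists a f, [/\ selects E f a [set: I],
    weakly_selects E w a [set: I] & cone nrm (facets_at a) w].
  have [a [f [fa wa]]] := weakly_selects_chamber E_nondeg w.
  exists a, f; split=> //; have [d [cl dwv _]] := cell_at fa.
  by apply/(coneP cl) => k /dwv[i ->]; apply: wa; rewrite inE.
split.
- apply/seteqP; split=> x; first by move=> Zx k _; exact: attains_h.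
  move=> /= xA; have [[pZ _ _ _] _] := pdZ.
  apply/(polytope_halfspaces _ pZ) => w; have [a [f [fa wa wc]]] := cover w.
  have [d [cl _ _]] := cell_at fa; rewrite (zonotope_h wa).
  exact: (cone_cell_le cl wc).
- move=> _ [a [f [fa ->]]]; have [d [cl _ _]] := cell_at fa.
  by exists (vx a), d.
- move=> w; have [a [f [fa wa wc]]] := cover w.
  by exists (facets_at a) => //; exists a, f.
Qed.

Lemma weakly_selects_cone f a z : selects E f a [set: I] ->
  weakly_selects E z a [set: I] <-> cone nrm (facets_at a) z.
Proof.
move=> fa; have [d [cl dwv ge0]] := cell_at fa; split=> [za|[l l0 ->] i _].
  by apply/(coneP cl) => k /dwv[i ->]; apply: za; rewrite inE.
by rewrite dot_suml; apply: sumr_ge0 => k kc; rewrite dotZl mulr_ge0 ?l0 ?ge0.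
Qed.

Lemma above_sub a k : F k (vx a) -> above k \subset facets_at a.
Proof.
move=> ka; apply/subsetP => l; rewrite !inE => /andP[lf /asboolP kl].
by rewrite lf; apply/asboolP/kl.
Qed.

Lemma facets_at_F a k : k \in facets_at a -> F k (vx a).
Proof. by rewrite inE => /andP[_ /asboolP]. Qed.

(** In the dual basis at a vertex of the face, a functional that selects the face
    is a positive combination of the normals of the facets above it. *)
Lemma F_above k x :
  F k x <-> Z x /\ forall l, l \in above k -> dot (nrm l) x = offset l.
Proof.
have [a [f [fa ka]]] := F_vertex k.
have [K [g [kk [fr kkF kki kkK kkn]]]] := at_vertex fa.
have [z kz za] := F_functional ka; rewrite (above_frame fr kkF kkK kz za) kz.
rewrite (frame_face fr _ za); split=> -[Zx gx]; split=> //.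
  move=> l /imsetP[j + ->]; rewrite inE => /andP[jK zj].
  by rewrite /offset kkn // gx // (zonotope_h (frame_g_selects fr jK)).
move=> j jK zj; rewrite -kkn // gx; last by apply: imset_f; rewrite inE jK.
by rewrite /offset kkn // (zonotope_h (frame_g_selects fr jK)).
Qed.

Lemma above_sub_F k l : above l \subset above k <-> F k `<=` F l.
Proof.
split=> [lk x /F_above[Zx kx]|kl].
  by apply/F_above; split=> // i /(subsetP lk); exact: kx.
apply/subsetP => i; rewrite !inE => /andP[fi /asboolP li].
by rewrite fi; apply/asboolP => x /kl/li.
Qed.

Lemma face_nrm k : face Z (nrm k) = F k.
Proof.
have [a [f [fa ka]]] := F_vertex k; have /F_above[Zx kx] := ka.
have [_ fP] := face_sum zonotope_system (above_facets k) Zx kx.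
apply/seteqP; split=> x; rewrite nrm_sum.
  by move=> /fP/F_above.
by move=> /F_above/fP.
Qed.

(** The sum of the normals in [B] selects the face that [B] cuts out. *)
Lemma above_surj f a (B : {set 'I_m}) : selects E f a [set: I] ->
  B \subset facets_at a -> B != set0 -> exists2 k, above k = B & F k (vx a).
Proof.
move=> fa Ba /set0Pn[l lB].
have [K [g [kk [fr kkF kki kkK kkn]]]] := at_vertex fa.
pose z := \sum_(i in B) nrm i.
have zwv j : j \in K -> dot z (wv a j) = (kk j \in B)%:R.
  move=> jK; rewrite /z dot_suml.
  have inner i : i \in B -> dot (nrm i) (wv a j) = (i == kk j)%:R.
    move=> /(subsetP Ba); rewrite kkK => /imsetP[j' j'K ->].
    by rewrite kkn // (frame_dual fr) // (inj_in_eq kki).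
  rewrite (eq_bigr _ inner); have [jB|jB] := boolP (kk j \in B).
    by rewrite (bigD1 (kk j)) //= eqxx big1 ?addr0 // => i /andP[_ /negbTE ->].
  by rewrite big1 // => i iB; case: eqVneq => // ij; rewrite -ij iB in jB.
have za : weakly_selects E z a [set: I].
  by apply: (frame_weakly_selects fr) => j jK; rewrite zwv // ler0n.
have [j jK lj] : exists2 j, j \in K & l = kk j.
  by have := subsetP Ba _ lB; rewrite kkK => /imsetP.
have [k kz] : exists k, F k = face Z z.
  apply/proper_index/(frame_proper_face za jK).
  by rewrite zwv // -lj lB ltr01.
exists k; last by rewrite kz; exact: weakly_selects_face.
rewrite (above_frame fr kkF kkK kz za); apply/setP => i; apply/imsetP/idP.
  by move=> [j' + ->]; rewrite inE => /andP[j'K]; rewrite zwv // ltr0n lt0b.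
move=> iB; have := subsetP Ba _ iB; rewrite kkK => /imsetP[j' j'K ij].
by exists j'; rewrite // inE j'K zwv // -ij iB ltr01.
Qed.

Lemma above_neq0 k : above k != set0.
Proof.
have [[_ [z kz]] kZ] := F_proper k; apply/eqP => k0; apply: kZ.
apply/seteqP; split=> x; first exact: F_sub.
by move=> Zx; apply/F_above; split=> // l; rewrite k0 inE.
Qed.

Lemma card_above k : (affdim (F k) + #|above k| = n)%N.
Proof.
have [a [f [fa ka]]] := F_vertex k.
have [K [g [kk [fr kkF kki kkK kkn]]]] := at_vertex fa.
have [z kz za] := F_functional ka; rewrite (above_frame fr kkF kkK kz za) kz.
rewrite (frame_affdim fr za) card_in_imset; last first.
  by move=> i j; rewrite !inE => /andP[iK _] /andP[jK _]; exact: kki.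
rewrite -[RHS](frame_card fr) -(cardsID [set j | dot z (wv a j) == 0]%SET K).
congr (_ + _)%N; apply: eq_card => j; rewrite !inE; first by rewrite andbC.
have [jK|//] := boolP (j \in K); last by rewrite andbF.
by rewrite lt_def za ?inE //= !andbT.
Qed.

(** * The normal fan of an omnitruncation *)

Section Omnitruncation.
Variables (eps : 'I_m -> R) (S : nat -> set V).
Hypothesis S0 : S 0%N = Z.
Hypothesis Sstep : forall i : 'I_m,
  0 < eps i < gap (S i) (F i `&` S i) (nrm i) /\
  S i.+1 = truncation (S i) (nrm i) (eps i).

Definition active k : {set 'I_m} := facets :|: [set j : 'I_m | (j < k)%N].
Definition remaining k (c : {set 'I_m}) : {set 'I_m} := [set j in c | (k <= j)%N]%SET.

(** After the faces with index below [k] have been truncated, a vertex is given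
    by a chain of truncated faces together with facets of [Z] whose
    intersection contains the chain and is not yet truncated. *)
Record stage k b (C : set {set 'I_m}) : Prop := Stage {
  stage_system : simple_system L nrm (active k) b C (S k);
  stage_sub : S k `<=` Z;
  stage_offset : forall j : 'I_m, (k <= j)%N -> b j = offset j;
  stage_chain : forall c i j, C c -> i \in c -> j \in c -> (i < k)%N ->
    if (j < k)%N then F i `<=` F j \/ F j `<=` F i else F i `<=` F j;
  stage_vertex : forall c, C c -> exists a f, selects E f a [set: I] /\
    forall j, j \in c -> F j (vx a);
  stage_untruncated : forall c (l : 'I_m), C c -> (l < k)%N ->
    ~~ (above l \subset remaining k c);
  stage_face : forall l : 'I_m, (k <= l)%N -> exists2 c, C c & above l \subset c }.

Lemma stage0 : stage 0 offset vertex_cells.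
Proof.
split=> //.
- have -> : active 0 = facets by apply/setP => j; rewrite !inE orbF.
  by rewrite S0; exact: zonotope_system.
- by rewrite S0.
- move=> _ [a [f [fa ->]]]; exists a, f; split=> // j.
  exact: facets_at_F.
- move=> l _; have [a [f [fa la]]] := F_vertex l.
  exists (facets_at a); first by exists a, f.
  exact: (above_sub la).
Qed.

Section Step.
Variables (k : nat) (b : 'I_m -> R) (C : set {set 'I_m}).
Hypotheses (st : stage k b C) (km : (k < m)%N).

Let t : 'I_m := Ordinal km.

Lemma mem_active j : j \in active k -> (k <= j)%N -> j \in facets.
Proof. by move=> /setUP[//|]; rewrite inE ltnNge => /negbTE ->. Qed.

Lemma cell_active c : C c -> c \subset active k.
Proof.
by move=> Cc; have [x [d cl]] := system_cell (stage_system st) Cc; exact: cell_sub cl.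
Qed.

(** The facets of [Z] left in a cell containing those through [F t] meet in a
    face inside [F t]; all such faces but [F t] have been truncated. *)
Lemma remaining_above c : C c -> above t \subset c -> remaining k c = above t.
Proof.
move=> Cc tc; have [a [f [fa ca]]] := stage_vertex st Cc.
have tB : above t \subset remaining k c.
  apply/subsetP => l lt; rewrite inE (subsetP tc) //=.
  apply: (Fmono (i := t)); apply/above_sub_F.
  rewrite above_self ?sub1set //.
  exact: (subsetP (above_facets _)) lt.
have [|| l lB _] := above_surj (B := remaining k c) fa.
- apply/subsetP => j; rewrite inE => /andP[jc kj].
  rewrite inE; apply/andP; split; last exact/asboolP/ca.
  by apply: (mem_active _ kj); exact: (subsetP (cell_active Cc)).
- have /set0Pn[l lt] := above_neq0 t.
  by apply/set0Pn; exists l; exact: (subsetP tB).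
have := tB; rewrite -lB => /above_sub_F/Fmono.
rewrite leq_eqVlt => /orP[/eqP lt|lt]; first by congr above; exact: val_inj.
by have := stage_untruncated st Cc lt; rewrite lB subxx.
Qed.

Lemma cell_truncated_facet c : C c -> t \in c -> above t = [set t]%SET.
Proof.
move=> Cc tc; apply: above_self; apply: (@mem_active t); last exact: leqnn.
exact: (subsetP (cell_active Cc)).
Qed.

(** The cells that contain the facets through [F t] are subdivided at [F t]; in
    such a cell all truncated faces lie in [F t] and all facets left contain it,
    so that adding [F t] keeps a chain. *)
Lemma stage_next : exists b' C', stage k.+1 b' C'.
Proof.
have [tgap tS] := Sstep t; have [c0 Cc0 tc0] := stage_face st (leqnn k : (k <= t)%N).
have le_above l : l \in above t -> (k <= l)%N.
  move=> lt; apply: (Fmono (i := t)); apply/above_sub_F.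
  rewrite above_self ?sub1set //.
  exact: (subsetP (above_facets _)) lt.
have tA : t \notin active k \/ above t = [set t]%SET.
  have [tA|tA] := boolP (t \in active k); last by left.
  by right; apply: above_self; apply: (mem_active tA); exact: leqnn.
have FP y : (F t `&` S k) y <->
    S k y /\ forall j, j \in above t -> dot (nrm j) y = b j.
  split=> [[/F_above[_ ty] Sy]|[Sy ty]].
    by split=> // j jt; rewrite ty // (stage_offset st) ?le_above.
  split=> //; apply/F_above; split=> [|j jt]; first exact: (stage_sub st).
  by rewrite ty // (stage_offset st) ?le_above.
have sys := stellar_system (stage_system st) (latticeB latL) Cc0 tc0 (above_neq0 t)
  (nrm_sum t) tA FP tgap.
have lt_k1 (j : 'I_m) : j != t -> (j < k.+1)%N = (j < k)%N.
  by move=> jt; rewrite ltnS leq_eqVlt (inj_eq val_inj j t) (negbTE jt).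
have rem_new c g : remaining k.+1 (t |: (c :\ g)) \subset remaining k c :\ g.
  apply/subsetP => j; rewrite !inE => /andP[jc kj].
  have jt : j != t by apply: contraTneq kj => ->; rewrite ltnn.
  by move: jc; rewrite (negbTE jt) /= (ltnW kj) andbT.
exists (stellar_offset b (above t) t (eps t)), (stellar_cells C (above t) t); split.
- rewrite tS; have -> // : active k.+1 = t |: active k.
  apply/setP => j; rewrite !inE; have [->|jt] := eqVneq j t.
    by rewrite ltnSn orbT.
  by rewrite lt_k1.
- by rewrite tS => y [/(stage_sub st)].
- move=> j kj; rewrite /stellar_offset; case: eqVneq => [jt|_].
    by rewrite jt ltnn in kj.
  by apply: (stage_offset st); exact: ltnW.
- move=> c i j [[Cc tc]|[c1 [g [Cc1 tc1 gt ->]]]].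
    have ct l : l \in c -> l != t.
      apply: contraTneq => ->; apply: contraNN tc => tc.
      by rewrite (cell_truncated_facet Cc tc) sub1set.
    move=> ic jc; rewrite !lt_k1 ?ct //; exact: (stage_chain st Cc).
  have old l l' : l \in c1 -> l' \in c1 -> (l < k)%N -> _ := @stage_chain _ _ _ st c1 l l' Cc1.
  have below l : l \in c1 -> (l < k)%N -> F l `<=` F t.
    move=> lc lk x lx; apply/F_above; split; first exact: (F_sub lx).
    move=> i' i't; have i'c := subsetP tc1 _ i't.
    have := old _ _ lc i'c lk; rewrite ltnNge le_above //= => /(_ _ lx)/F_above[_].
    apply; rewrite above_self ?in_set1 //.
    exact: (subsetP (above_facets _)) i't.
  have notg l : l != g -> l \in c1 -> l != t.
    move=> lg lc; apply: contraNneq lg => lt; rewrite lt in lc *.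
    by move: gt; rewrite (cell_truncated_facet Cc1 lc) inE eq_sym.
  rewrite !in_setU1 => /orP[/eqP -> | /setD1P[ig ic]] /orP[/eqP -> | /setD1P[jg jc]].
  + by move=> _; rewrite ltnSn; left.
  + move=> _; rewrite lt_k1 ?notg //; case: ltnP => [jk|kj]; first by right; exact: below.
    have : j \in remaining k c1 by rewrite inE jc.
    by rewrite (remaining_above Cc1 tc1) inE => /andP[_ /asboolP].
  + by rewrite ltnSn lt_k1 ?notg // => ik; left; exact: below.
  + by rewrite !lt_k1 ?notg //; exact: old.
- move=> c [[Cc _]|[c1 [g [Cc1 tc1 gt ->]]]]; first exact: (stage_vertex st Cc).
  have [a [f [fa ca]]] := stage_vertex st Cc1; exists a, f; split=> // j.
  rewrite in_setU1 => /orP[/eqP ->|/setD1P[_ /ca//]].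
  apply/F_above; split=> [|l lt]; first exact: zonotope_vtx.
  have lc := subsetP tc1 _ lt; have /F_above[_] := ca _ lc; apply.
  by rewrite above_self ?in_set1 //; exact: (subsetP (above_facets _)) lt.
- move=> c l [[Cc tc]|[c1 [g [Cc1 tc1 gt ->]]]].
    have [-> _|jt] := eqVneq l t.
      apply: contraNN tc => /subset_trans; apply.
      by apply/subsetP => j; rewrite inE => /andP[].
    rewrite lt_k1 // => lk; apply: contraNN (stage_untruncated st Cc lk).
    move=> /subset_trans; apply; apply/subsetP => j.
    by rewrite !inE => /andP[-> /ltnW].
  have [-> _|lt] := eqVneq l t.
    apply/negP => /subsetP/(_ g gt)/(subsetP (rem_new _ _)).
    by rewrite !inE eqxx.
  rewrite lt_k1 // => lk; apply: contraNN (stage_untruncated st Cc1 lk).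
  move=> /subset_trans; apply; apply: subset_trans (rem_new _ _) _.
  exact: subsetDl.
- move=> l kl; have [c Cc lc] := stage_face st (ltnW kl).
  have [tc|tc] := boolP (above t \subset c); last by exists c => //; left.
  have /subsetPn[g gt gl] : ~~ (above t \subset above l).
    by apply/negP => /above_sub_F/Fmono; rewrite leqNgt kl.
  exists (t |: (c :\ g)); first by right; exists c, g.
  apply: subset_trans (subsetUr _ _).
  by rewrite subsetD1 lc gl.
Qed.

End Step.

Lemma stage_exists k : (k <= m)%N -> exists b C, stage k b C.
Proof.
elim: k => [|k IH] km; first by exists offset, vertex_cells; exact: stage0.
by have [b [C st]] := IH (ltnW km); exact: stage_next st km.
Qed.

(** Once all faces are truncated, no condition on the remaining facets is left:
    the cells are just chains of faces through a vertex. *)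
Theorem omnitruncation_system : exists b C,
  simple_system L nrm [set: 'I_m]%SET b C (S m) /\
  forall c, C c ->
    (forall i j, i \in c -> j \in c -> F i `<=` F j \/ F j `<=` F i) /\
    exists a f, selects E f a [set: I] /\ forall j, j \in c -> F j (vx a).
Proof.
have [b [C st]] := stage_exists (leqnn m); exists b, C; split=> [|c Cc].
  have <- : active m = [set: 'I_m]%SET by apply/setP => j; rewrite !inE ltn_ord orbT.
  exact: stage_system st.
split; last exact: (stage_vertex st Cc).
by move=> i j ic jc; have := stage_chain st Cc ic jc (ltn_ord i); rewrite ltn_ord.
Qed.

End Omnitruncation.

(** * The polytope attached to a face *)

Lemma dot_wv_eq0 z a b i : dot z (wv a i) = 0 -> dot z (wv b i) = 0.
Proof. by have [->|->] := wv_eq_or_opp E b a i; rewrite // dotNr => ->; rewrite oppr0. Qed.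

(** Choosing a functional that vanishes on one segment and on no segment that is
    not parallel to it, one sees that every segment is an edge of [Z]. *)
Lemma no_parallel i j a b (c : R) : wv a i = c *: wv b j -> i = j.
Proof.
move=> ij; pose x0 := wv b j.
have x00 : 0 < dot x0 x0.
  rewrite lt_def dot_self_ge0 andbT; apply/eqP => /dot_self_eq0 /eqP.
  exact/negP/wv0.
pose pr y := y - (dot x0 y / dot x0 x0) *: x0.
pose v l := if pr (wv b l) == 0 then x0 else pr (wv b l).
have [l|y yP] := generic_functional (w := v).
  by rewrite /v; case: ifPn => // _; exact: wv0.
pose z := pr y.
have zpr x : dot z x = dot y (pr x).
  by rewrite /z /pr !dotBE (dotC y x0); ring.
have [a' [f' [fa za]]] := weakly_selects_chamber E_nondeg z.
have zj : dot z x0 = 0.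
  by rewrite zpr /pr divff ?gt_eqF // scale1r subrr dot0r.
have par l : dot z (wv a' l) = 0 -> exists c, wv a' l = c *: wv a' j.
  move=> /(dot_wv_eq0 b); rewrite zpr => /eqP yl.
  have : pr (wv b l) == 0.
    by apply: contraTT yl => nz; have := yP l; rewrite /v (negbTE nz).
  rewrite subr_eq0 => /eqP; set c' := _ / _ => le.
  have [->|->] := wv_eq_or_opp E a' b l; have [->|->] := wv_eq_or_opp E a' b j.
  - by exists c'.
  - by exists (- c'); rewrite scaleNr scalerN opprK.
  - by exists (- c'); rewrite scaleNr -le.
  - by exists c'; rewrite scalerN -le.
have [uniq _] := primitive_edge fa za (dot_wv_eq0 a' zj) par.
apply/uniq/(@dot_wv_eq0 z a a').
by rewrite ij dotZr zj mulr0.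
Qed.

Lemma cell_cone a d i : vertex_cell_at a d ->
  cone d (facets_at a) (wv a i).
Proof.
move=> [cl _ ge0]; exists (fun j => dot (nrm j) (wv a i)) => [j|]; first exact: ge0.
exact: cell_expand cl _.
Qed.

(** A segment on which some supporting functional vanishes exclusively is an
    edge, hence a vector of the dual basis. *)
Lemma edge_dual a d z i : vertex_cell_at a d ->
  weakly_selects E z a [set: I] -> dot z (wv a i) = 0 ->
  (forall k, dot z (wv a k) = 0 -> k = i) ->
  exists2 j, j \in facets_at a & d j = wv a i.
Proof.
move=> cld za zi uniq; have [_ dwv _] := cld.
have [|j jc] := cone_support_inhabited _ (cell_cone i cld) zi (wv0 a i).
  by move=> j /dwv[i' ->]; rewrite za ?inE.
by have [i' ji'] := dwv j jc; rewrite ji' => /uniq ii'; exists j; rewrite // ji' ii'.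
Qed.

Lemma nrm_dual a d j k : cell L nrm facets offset (facets_at a) (vx a) d ->
  F k (vx a) -> j \in facets_at a -> dot (nrm k) (d j) = (j \in above k)%:R.
Proof.
move=> cl ka jc; rewrite nrm_sum dot_suml.
have sub := subsetP (above_sub ka).
have [jk|jk] := boolP (j \in above k).
  rewrite (bigD1 j) //= (cell_dual cl) // eqxx big1 ?addr0 // => l /andP[/sub lc lj].
  by rewrite (cell_dual cl) // (negbTE lj).
rewrite big1 // => l lk; rewrite (cell_dual cl (sub _ lk) jc).
by case: eqVneq => // lj; rewrite -lj lk in jk.
Qed.

(** An edge that leaves the face at a vertex is dual to one of the facets through
    the face, whose normals add up to the one of the face. *)
Lemma delta_eq1 k : delta L Z (F k) = 1.
Proof.
have low x : F k x -> dot (nrm k) x = h Z (nrm k) by rewrite -face_nrm => -[].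
rewrite /delta /gap -/(nrm k); set X := [set _ | y in _].
suff -> : X = [set 1] by rewrite inf1.
have X1 r : X r -> r = 1.
  move=> [y [Vy nFy [v [e [Vv Fv [[_ [z ez]] d1] ev ey]]]] <-].
  have [a [f [fa va]]] := vertex_selects E_nondeg Vv.
  rewrite va in Fv ev; rewrite ez in ev ey d1.
  have za := face_weakly_selects ev.
  have yv : y != vx a by apply: contra_notN nFy => /eqP ->.
  have [i [s [/andP[s0 s1] yE zi uniq _]]] :=
    edge_single fa za d1 ey yv.
  have [d cld] := cell_at fa; have [cl dwv ge0] := cld.
  have [j jc ji] := edge_dual cld za zi uniq.
  have s1E : s = 1.
    apply/eqP; rewrite eq_le s1 leNgt; apply/negP => slt.
    have [w wP] := vertex_strict aZ Vy.
    have := wP _ (zonotope_vtx E a _); rewrite eq_sym yv => /(_ isT).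
    rewrite yE dotDr gtrDl dotZr pmulr_rlt0 // => wi.
    have := wP _ (vx_wv a i); rewrite yE (inj_eq (addrI _)) -subr_eq0.
    rewrite -[X in X - _]scale1r -scalerBl scaler_eq0 subr_eq0 negb_or gt_eqF //=.
    rewrite wv0 => /(_ isT); rewrite !dotDr dotZr ltrD2l => lt.
    have : 0 < (1 - s) * dot w (wv a i) by lra.
    by rewrite pmulr_rgt0 ?subr_gt0 // ltNge ltW.
  have yd : y = vx a + d j by rewrite yE s1E scale1r ji.
  rewrite /= yd dotDr low // addrC addKr (nrm_dual cl Fv jc).
  have [//|jk] := boolP (j \in above k); case: nFy.
  rewrite -face_nrm; apply: (face_eq (x := vx a)); first by rewrite face_nrm.
    by rewrite yd ji; exact: vx_wv.
  by rewrite yd dotDr (nrm_dual cl Fv jc) (negbTE jk) addr0.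
apply/seteqP; split=> [r /X1//|_ ->].
have [a [f [fa ka]]] := F_vertex k.
have [d [cl _ _]] := cell_at fa.
have [j jk] := set0Pn _ (above_neq0 k).
have jc := subsetP (above_sub ka) _ jk.
have [t [t0 Sy Vy [e [ee ex ey]]]] := cell_edge
  (zonotope_system) cl jc.
have uy : dot (nrm k) (vx a + t *: d j) = h Z (nrm k) + t.
  by rewrite dotDr dotZr low // (nrm_dual cl ka jc) jk mulr1.
have Xy : X (dot (nrm k) (vx a + t *: d j) - h Z (nrm k)).
  exists (vx a + t *: d j) => //; split=> //.
    by move=> /low/eqP; rewrite uy -subr_eq0 addrC addKr gt_eqF.
  by exists (vx a), e; split=> //; exact: selects_vertex fa.
by have := Xy; rewrite (X1 _ Xy).
Qed.

Section IncidentSegments.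
Variable k : 'I_m.

(** The segments parallel to the face, the choice of endpoints that selects it,
    and, among the other segments, those that start an edge at the base point. *)
Definition along : {set I} := [set i | dot (nrm k) (wv set0 i) == 0]%SET.
Definition side : {set I} := orient E (nrm k).
Definition base : V := vtx E side (~: along).
Definition incident : {set I} := [set i in ~: along | `[< exists e : set V,
  [/\ edge (zonotope E (~: along)) e, e base & parallel (E i) e] >]]%SET.

Lemma alongP a i : (i \in along) = (dot (nrm k) (wv a i) == 0).
Proof. by rewrite inE; apply/eqP/eqP; exact: dot_wv_eq0. Qed.

Lemma side_selects W : weakly_selects E (nrm k) side W.
Proof. exact: orient_selects. Qed.

Lemma side_pos i : i \in ~: along -> 0 < dot (nrm k) (wv side i).
Proof.
rewrite inE (alongP side) lt_def => -> /=.
by apply: (@side_selects [set: I]); rewrite inE.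
Qed.

Lemma face_side a i : F k (vx a) -> i \in ~: along -> (i \in a) = (i \in side).
Proof.
rewrite -face_nrm => /face_weakly_selects ka ia; apply/eqP; apply: contraT => neq.
have := side_pos ia; rewrite ltNge -oppr_ge0 -dotNr -(wv_opp E neq) ka ?inE //.
Qed.

Lemma face_wv a i : F k (vx a) -> i \in ~: along -> wv a i = wv side i.
Proof. by move=> ka ia; apply: wv_same; exact: face_side. Qed.

Lemma weakly_selects_F a :
  weakly_selects E (nrm k) a [set: I] -> F k (vx a).
Proof. by move=> ka; rewrite -face_nrm; exact: weakly_selects_face. Qed.

Lemma vx_split a K : vx a = vtx E a K + vtx E a (~: K).
Proof.
rewrite /vtx (big_setID K) /= setTI; congr +%R.
by apply: eq_bigl => i; rewrite !inE andbT.
Qed.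

(** An incident segment spans an extreme ray: the edge that defines it is
    selected by a functional that is positive on all the other segments. *)
Lemma incident_functional i : i \in incident -> exists z,
  [/\ i \in ~: along, dot z (wv side i) = 0 &
     forall r, r \in ~: along -> r != i -> 0 < dot z (wv side r)].
Proof.
rewrite inE => /andP[ia /asboolP[e [[[_ [z ez]] d1] be pe]]].
rewrite ez in be d1 pe; have za := face_weakly_selects be.
have [i0 i0a zi0] : exists2 i0, i0 \in ~: along & dot z (wv side i0) = 0.
  apply: contrapT => nz.
  have sz : selects E z side (~: along).
    move=> r ra; rewrite lt_def za // andbT; apply/eqP => zr; apply: nz.
    by exists r.
  suff : affdim (face (zonotope E (~: along)) z) = 0%N by rewrite d1.
  rewrite (selects_face sz); apply: (@affdim_span _ _ _ 0 base 0) => //.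
  - by rewrite /row_free mxrank0.
  - by case.
  - by move=> y ->; rewrite subrr sub0mx.
have e1 : face (zonotope E (~: along)) z (base + wv side i0).
  apply: (face_eq be); last by rewrite dotDr zi0 addr0.
  by rewrite -[wv side i0]scale1r; apply: zonotope_vtx_wv; rewrite // ler01 lexx.
have [c] := pe _ _ be e1; rewrite addrC addKr => i0E.
have ii0 : i0 = i.
  have dE : (E i).2 - (E i).1 = wv set0 i by rewrite /wv inE.
  by rewrite dE in i0E; exact: no_parallel i0E.
subst i0; exists z; split=> // r ra ri; rewrite lt_def za // andbT; apply/eqP => zr.
have [c' rE] := edge_parallel za d1 ra ia zr zi0 (wv0 _ _).
by rewrite (no_parallel rE) eqxx in ri.
Qed.

Lemma incidentP z i : i \in ~: along -> weakly_selects E z side (~: along) ->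
  dot z (wv side i) = 0 ->
  (forall r, r \in ~: along -> dot z (wv side r) = 0 ->
     exists c, wv side r = c *: wv side i) -> i \in incident.
Proof.
move=> ia za zi par.
have [ee eb _ el] := zonotope_edge E_nondeg ia za zi par.
rewrite inE ia; apply/asboolP; exists (face (zonotope E (~: along)) z); split=> //.
move=> x y /el[s ->] /el[t ->].
have -> : vtx E side (~: along) + t *: wv side i -
    (vtx E side (~: along) + s *: wv side i) = (t - s) *: wv side i.
  by rewrite opprD addrACA subrr add0r scalerBl.
rewrite /wv; case: ifP => _; last by exists (t - s).
by exists (s - t); rewrite -[(E i).1 - _]opprB scalerN -scaleNr opprB.
Qed.

(** The edges of [Z] that leave the face at one of its vertices are among the
    incident segments: the sum of the other normals at this vertex vanishes on
    no further segment. *)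
Lemma dual_incident a d j : vertex_cell_at a d ->
  F k (vx a) -> j \in above k -> exists2 i, i \in incident & d j = wv side i.
Proof.
move=> [cl dwv ge0] ka jk; have jc := subsetP (above_sub ka) _ jk.
have [i ji] := dwv j jc.
have ui : dot (nrm k) (wv a i) = 1 by rewrite -ji (nrm_dual cl ka jc) jk.
have ia : i \in ~: along by rewrite inE (alongP a) ui oner_eq0.
exists i; last by rewrite ji face_wv.
pose z := \sum_(l in facets_at a :\ j) nrm l.
have zE y : dot z y = \sum_(l in facets_at a :\ j) dot (nrm l) y by rewrite /z dot_suml.
have zge0 r : 0 <= dot z (wv a r).
  by rewrite zE; apply: sumr_ge0 => l; rewrite in_setD1 => /andP[_ lc]; exact: ge0.
have zpar r : dot z (wv a r) = 0 -> exists c, wv a r = c *: wv a i.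
  rewrite zE => /psumr_eq0P z0; exists (dot (nrm j) (wv a r)).
  rewrite {1}(cell_expand cl (wv a r)) (big_setD1 j jc) /= big1 ?addr0 ?ji //.
  move=> l lc; rewrite z0 ?scale0r // => l'.
  by rewrite in_setD1 => /andP[_ l'c]; exact: ge0.
apply: (incidentP (z := z)) => //.
- by move=> r ra; rewrite -(face_wv ka ra).
- rewrite -(face_wv ka ia) zE big1 // => l; rewrite in_setD1 => /andP[lj lc].
  by rewrite -ji (cell_dual cl) // (negbTE lj).
- by move=> r ra; rewrite -(face_wv ka ra) -(face_wv ka ia); exact: zpar.
Qed.

(** The functional of an incident segment, pushed slightly into the interior of
    the normal cone of the face, selects a vertex of the face at which the
    segment is an edge. *)
Lemma incident_height i : i \in incident -> dot (nrm k) (wv side i) = 1.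
Proof.
move=> /incident_functional[z [ia zi zpos]].
have [r|e e0 eP] := @small_step R I
    (fun r => if r \in along then 1 else dot (nrm k) (wv side r))
    (fun r => if r \in along then 0 else dot z (wv side r)).
  by left; case: (boolP (r \in along)) => // ra; apply: side_pos; rewrite inE ra.
have [a [f [fa wa]]] := weakly_selects_chamber E_nondeg (nrm k + e *: z).
have same r : r \in ~: along -> wv a r = wv side r.
  move=> ra; have := wa r (in_setT r); have := eP r.
  rewrite inE in ra; rewrite (negbTE ra).
  have [->//|->] := wv_eq_or_opp E a side r; rewrite !dotBE => lo hi; exfalso; lra.
have ka : F k (vx a).
  apply: weakly_selects_F => // r _; have [ra|ra] := boolP (r \in along).
    by move: ra; rewrite (alongP a) => /eqP ->.
  have ra' : r \in ~: along by rewrite inE.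
  by rewrite same // ltW // side_pos.
have za : weakly_selects E z a [set: I].
  move=> r _; have [ra|ra] := boolP (r \in along).
    have := wa r (in_setT r); move: ra; rewrite (alongP a) !dotBE => /eqP ->.
    by rewrite add0r pmulr_rge0.
  have ra' : r \in ~: along by rewrite inE.
  rewrite same //; have [->|ri] := eqVneq r i; first by rewrite zi.
  exact/ltW/zpos.
have [d cld] := cell_at fa; have [cl dwv ge0] := cld.
have wi : wv a i = wv side i by exact: same.
have ui := side_pos ia; rewrite -wi in ui zi *.
have zd j : j \in facets_at a -> 0 <= dot z (d j).
  by move=> /dwv[i' ->]; rewrite za ?inE.
have ci := cone_support zd (cell_cone i cld) zi.
have [j jc [jw zj]] : exists2 j, j \in facets_at a &
    0 < dot (nrm k) (d j) /\ dot z (d j) = 0.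
  apply: contrapT => nj; move: ui; rewrite ltNge -oppr_ge0 -dotNl.
  rewrite (cone_dot_ge0 _ ci) // => j; rewrite inE => /andP[jc /eqP zj].
  rewrite dotNl oppr_ge0 leNgt; apply/negP => uj; apply: nj.
  by exists j.
have [i1 ji1] := dwv j jc; rewrite ji1 in jw zj.
have i1a : i1 \in ~: along by rewrite inE (alongP a) gt_eqF.
have i1i : i1 = i.
  apply/eqP; apply: contraT => ne; have := zpos i1 i1a ne.
  by rewrite -same // zj ltxx.
move: jw; rewrite -i1i -ji1 (nrm_dual cl ka jc).
by case: (j \in above k); rewrite ?ltxx.
Qed.

(** The extreme generators of the cone of the segments leaving [base] span edges
    of the zonotope at this point. *)
Lemma incident_cone i : i \in ~: along -> cone (wv side) incident (wv side i).
Proof.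
have [K [Ka Kgen Kext]] := extreme_generators side_pos.
move=> /Kgen; apply: cone_trans => r rK; apply: cone_mem.
have [z [zr za zW]] := Kext r rK.
exact: (incidentP (z := z)) (subsetP Ka _ rK) za zr zW.
Qed.

Lemma incident_sub : incident \subset ~: along.
Proof. by apply/subsetP => i; rewrite inE => /andP[]. Qed.

Lemma card_incident : (#|above k| <= #|incident|)%N.
Proof.
have [a [f [fa ka]]] := F_vertex k.
have [d cld] := cell_at fa; have [cl dwv ge0] := cld.
have /choice[g gP] j : exists i, j \in above k -> i \in incident /\ d j = wv side i.
  have [jk|jk] := boolP (j \in above k).
    by have [i iI ji] := dual_incident cld ka jk; exists i.
  have [j0 /(dual_incident cld ka)[i _ _]] := set0Pn _ (above_neq0 k).
  by exists i.
rewrite -(card_in_imset (f := g) (D := above k)).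
  apply: subset_leq_card; apply/subsetP => _ /imsetP[j jk ->].
  by have [] := gP j jk.
move=> i j ik jk gij; have [_ di] := gP i ik; have [_ dj] := gP j jk.
have sub := subsetP (above_sub ka).
have := cell_dual cl (sub _ ik) (sub _ jk); rewrite dj -gij -di.
rewrite (cell_dual cl) ?sub // eqxx.
by case: eqVneq => // _ /eqP; rewrite oner_eq0.
Qed.

Lemma incident_neq0 : incident != set0.
Proof.
rewrite -card_gt0; apply: leq_trans card_incident.
by rewrite card_gt0 above_neq0.
Qed.

(** The polytope G(Z, F k); since the incident segments have height one, the
    half-space becomes a condition on their coefficients. *)
Definition face_polytope : set V :=
  truncated_zonotope (wv side) incident (vtx E side incident).

Lemma face_polytopeE : face_polytope = [set x | zonotope E incident x /\
  dot (nrm k) (vtx E side incident) + delta L Z (F k) <= dot (nrm k) x].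
Proof.
have sum (t : I -> R) : dot (nrm k) (\sum_(i in incident) t i *: wv side i) =
    \sum_(i in incident) t i.
  rewrite dot_sumr; apply: eq_bigr => i iI.
  by rewrite dotZr incident_height // mulr1.
rewrite delta_eq1.
apply/seteqP; split=> x /=.
  move=> [t [t01 t1 ->]]; split; last by rewrite dotDr sum lerD2l.
  by apply/(zonotopeP _ side); exists t.
move=> [/(zonotopeP _ side)[t [t01 ->]]]; rewrite dotDr sum lerD2l => t1.
by exists t.
Qed.

Lemma face_decomposition : F k = [set x + base | x in zonotope E along].
Proof.
rewrite -face_nrm; apply/seteqP; split=> x.
  move=> /(zonotope_face _ (@side_selects _))[t [t01 t0 ->]].
  exists (vtx E side along + \sum_(i in along) t i *: wv side i).
    apply/(zonotopeP _ side); exists t; split=> // i _; exact: t01 (in_setT i).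
  rewrite (vx_split side along) -/base addrAC; congr (_ + _ + _).
  rewrite [RHS](big_setID along) /= setTI [X in _ + X]big1 ?addr0 //.
  move=> i /setDP[_ ia].
  have /eqP := t0 i (in_setT i); rewrite mulf_eq0 -(alongP side).
  by rewrite (negbTE ia) orbF => /eqP ->; rewrite scale0r.
move=> [y /(zonotopeP _ side)[t [t01 ->]] <-].
apply/(zonotope_face _ (@side_selects _)).
exists (fun i => if i \in along then t i else 0); split=> [i _|i _|].
- by case: ifP => [/t01//|_]; rewrite lexx ler01.
- by case: ifP; rewrite ?mul0r // (alongP side) => /eqP ->; rewrite mulr0.
- rewrite (vx_split side along) -/base [in LHS]addrAC; congr (_ + _ + _).
  rewrite [RHS](big_setID along) /= setTI [X in _ = _ + X]big1 ?addr0.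
    by apply: eq_bigr => i ->.
  by move=> i /setDP[_ /negbTE ->]; rewrite scale0r.
Qed.

End IncidentSegments.

Lemma zonotope_upper z b W x : weakly_selects E z b W -> zonotope E W x ->
  dot z x <= dot z (vtx E b W) + \sum_(i in W) dot z (wv b i).
Proof.
move=> zb /(zonotopeP _ b)[t [t01 ->]]; rewrite dotDr lerD2l dot_sumr.
apply: ler_sum => i iW; rewrite dotZr; have /andP[t0 t1] := t01 i iW.
by rewrite ler_piMl // zb.
Qed.

(** The data defining the polytope of a face are determined by the face: the
    segments parallel to it by its widths, and the endpoints by the functional
    that selects it. *)
Lemma is_G_unique k X : is_G L E (F k) X -> X = face_polytope k.
Proof.
move=> [W [q [qE Vp FW ->]]].
have low x : F k x -> dot (nrm k) x = h Z (nrm k) by rewrite -face_nrm => -[].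
have Wal : W \subset along k.
  apply/subsetP => i iW; rewrite (alongP _ (side k)).
  pose p := \sum_(i in ~: W) q i.
  have F1 : F k (vtx E (side k) W + p).
    by rewrite FW; exists (vtx E (side k) W) => //; exact: zonotope_vtx.
  have F2 : F k (vtx E (side k) W + wv (side k) i + p).
    rewrite FW; exists (vtx E (side k) W + wv (side k) i) => //.
    by rewrite -[wv _ i]scale1r; apply: zonotope_vtx_wv; rewrite // ler01 lexx.
  have := low _ F1; rewrite -(low _ F2) !dotDr; lra.
have WE : W = along k.
  apply/eqP; rewrite eqEsubset Wal; apply/subsetP => i ial.
  apply: contraT => iW; pose z := wv set0 i.
  pose b := orient E z; have zb K : weakly_selects E z b K by exact: orient_selects.
  pose p := \sum_(i in ~: W) q i.
  have inW K : K \subset along k -> F k (vtx E b (along k) + \sum_(j in K) wv b j + base k).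
    move=> KA; rewrite face_decomposition.
    exists (vtx E b (along k) + \sum_(j in K) wv b j) => //.
    exact: zonotope_vtx_sum.
  have := inW _ (sub0set _); have := inW _ (subxx _).
  rewrite big_set0 addr0 FW => -[x2 x2W x2E] -[x1 x1W x1E].
  have := zonotope_upper (zb W) x2W; have := zonotope_vtx_min (zb W) x1W.
  have x21 : x2 - x1 = \sum_(j in along k) wv b j.
    have -> : x2 - x1 = (x2 + p) - (x1 + p) by rewrite opprD addrACA subrr addr0.
    by rewrite x2E x1E; apply/rowP => l; rewrite !mxE; ring.
  move=> lo hi; have : dot z (x2 - x1) <= \sum_(j in W) dot z (wv b j).
    by rewrite dotDr dotNr; lra.
  rewrite x21 dot_sumr (big_setID W) /= (setIidPr Wal) gerDl leNgt.
  move=> /negP; case; rewrite (bigD1 i) ?inE ?iW //=; last by rewrite inE in ial.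
  rewrite ltr_pwDl //; last by apply: sumr_ge0 => j _; exact: (zb [set: I]%SET).
  rewrite lt_def (zb [set: I]%SET) ?inE // andbT; apply/eqP => zi.
  have := dot_wv_eq0 set0 zi => /dot_self_eq0/eqP.
  by apply/negP; exact: wv0.
subst W; have qside i : i \in ~: along k -> q i = en (side k) i.
  move=> ia; pose p := \sum_(i in ~: along k) q i.
  have qd j : j \in ~: along k ->
      q j - en (side k) j = 0 \/ q j - en (side k) j = wv (side k) j.
    rewrite in_setC => /qE[] ->; rewrite /en /wv; case: (j \in side k);
    by rewrite ?subrr; auto.
  have qge j : j \in ~: along k -> 0 <= dot (nrm k) (q j - en (side k) j).
    by move=> ja; case: (qd j ja) => ->; rewrite ?dot0r // ltW // side_pos.
  have F1 : F k (vtx E (side k) (along k) + p).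
    by rewrite FW; exists (vtx E (side k) (along k)) => //; exact: zonotope_vtx.
  have F2 : F k (vtx E (side k) (along k) + base k).
    rewrite face_decomposition.
    by exists (vtx E (side k) (along k)) => //; exact: zonotope_vtx.
  have s0 : \sum_(j in ~: along k) dot (nrm k) (q j - en (side k) j) = 0.
    rewrite -dot_sumr sumrB dotDr dotNr -/p -/(vtx E (side k) (~: along k)) -/(base k).
    have := low _ F1; rewrite -(low _ F2) !dotDr; lra.
  have := psumr_eq0P qge s0 ia; case: (qd i ia) => [/eqP|-> /eqP].
    by rewrite subr_eq0 => /eqP.
  by rewrite gt_eqF // side_pos.
have pE : \sum_(i in ~: along k) q i = base k by apply: eq_bigr.
have UE : [set i in ~: along k | `[< exists e : set V,
    [/\ edge (zonotope E (~: along k)) e, e (\sum_(i in ~: along k) q i) &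
        parallel (E i) e] >]]%SET = incident k by rewrite pE.
rewrite UE (face_polytopeE).
have -> // : \sum_(i in incident k) q i = vtx E (side k) (incident k).
apply: eq_bigr => i /(subsetP (incident_sub _)); exact: qside.
Qed.

Lemma is_G_face_polytope k : is_G L E (F k) (face_polytope k).
Proof.
exists (along k), (en (side k)); split.
- by move=> i _; rewrite /en; case: ifP; [right | left].
- apply: (selects_vertex (u := nrm k)) => i ia; exact: side_pos.
- exact: face_decomposition.
- exact: face_polytopeE.
Qed.

(** The part of the support function of the polytope of [F k] that is linear on
    the normal cones of [Z]; the remaining part is supported on the normal cones
    of the vertices of [F k]. *)
Definition zonotope_part k z : R := dot z (vtx E (side k) (incident k)) +
  \sum_(i in incident k) Num.min (dot z (wv (side k) i)) 0.
Definition face_part k z : R := h (face_polytope k) z - zonotope_part k z.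

Lemma face_part_eq0 k z i : i \in incident k -> dot z (wv (side k) i) <= 0 ->
  face_part k z = 0.
Proof.
move=> iI zi; pose A := [set i in incident k | dot z (wv (side k) i) <= 0]%SET.
have AI : A \subset incident k by apply/subsetP => r; rewrite inE => /andP[].
have A0 : A != set0 by apply/set0Pn; exists i; rewrite inE iI.
rewrite /face_part /zonotope_part /face_polytope (h_corner _ AI A0).
- rewrite /corner dotDr [dot z (\sum_(r in A) _)]dot_sumr.
  rewrite [\sum_(r in incident k) _](big_setID A) /= (setIidPr AI).
  rewrite [X in _ - (_ + (_ + X))]big1 ?addr0.
    rewrite [X in _ - (_ + X)](eq_bigr (fun r => dot z (wv (side k) r))) ?subrr //.
    by move=> r; rewrite inE => /andP[_ zr]; apply/min_idPl.
  move=> r /setDP[rI]; rewrite inE rI -ltNge => zr.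
  by apply/min_idPr/ltW.
- by move=> r; rewrite inE => /andP[].
- by move=> r rI; rewrite inE rI /= -ltNge => /ltW.
Qed.

Lemma face_part_min k z i : i \in incident k -> 0 <= dot z (wv (side k) i) ->
  (forall r, r \in incident k -> dot z (wv (side k) i) <= dot z (wv (side k) r)) ->
  face_part k z = dot z (wv (side k) i).
Proof.
move=> iI zi imin; rewrite /face_part /zonotope_part /face_polytope.
rewrite (h_corner1 _ iI) // => [|r rI _]; last exact: le_trans zi (imin r rI).
rewrite big1 => [|r rI]; last by apply/min_idPr/(le_trans zi)/imin.
by rewrite /corner big_set1 dotDr addr0 addrC addKr.
Qed.

Lemma nrm_weakly_selects a j : F j (vx a) -> weakly_selects E (nrm j) a [set: I].
Proof. by rewrite -face_nrm; exact: face_weakly_selects. Qed.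

(** On the cone spanned by the normals of a chain of faces through [vx a], the
    face part of [F k] adds up the coefficients of the faces inside [F k]: if
    [vx a] lies on [F k], it is the smallest of the coordinates belonging to the
    facets through [F k], and the smallest face of the chain that is not inside
    [F k] misses one of these facets. *)
Lemma face_part_chain k a f (c : {set 'I_m}) (l : 'I_m -> R) : selects E f a [set: I] ->
  (forall j, j \in c -> F j (vx a)) ->
  (forall i j, i \in c -> j \in c -> F i `<=` F j \/ F j `<=` F i) ->
  (forall j, j \in c -> 0 <= l j) ->
  face_part k (\sum_(j in c) l j *: nrm j) =
    \sum_(j in c | `[< F j `<=` F k >]) l j.
Proof.
move=> fa ca chain l0; set z := \sum_(j in c) _.
have za : weakly_selects E z a [set: I].
  move=> i _; rewrite dot_suml; apply: sumr_ge0 => j jc.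
  by rewrite dotZl mulr_ge0 ?l0 // (nrm_weakly_selects (ca _ jc)) ?inE.
have [ka|nka] := pselect (F k (vx a)); last first.
  rewrite [RHS]big1; last first.
    by move=> j /andP[jc /asboolP jk]; case: nka; apply/jk/ca.
  have [i ia neq] : exists2 i, i \in ~: along k & (i \in a) != (i \in side k).
    apply: contrapT => same; apply: nka; apply: weakly_selects_F => i _.
    have [ial|ial] := boolP (i \in along k).
      by move: ial; rewrite (alongP _ a) => /eqP ->.
    have [/wv_same ->|neq] := eqVneq (i \in a) (i \in side k).
      exact: (@side_selects _ [set: I]%SET).
    by case: same; exists i; rewrite // in_setC.
  have zi : dot z (wv (side k) i) <= 0.
    by rewrite -oppr_ge0 -dotNr -(wv_opp E neq) za ?inE.
  have [s sI zs] : exists2 s, s \in incident k & dot z (wv (side k) s) <= 0.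
    apply: contrapT => ns; have pos s : s \in incident k -> 0 < dot z (wv (side k) s).
      by move=> sI; rewrite ltNge; apply/negP => zs; apply: ns; exists s.
    have pos0 s sI := ltW (pos s sI); have ci := incident_cone ia.
    have zi0 : dot z (wv (side k) i) = 0.
      by apply/le_anti; rewrite zi (cone_dot_ge0 pos0 ci).
    have [s sI zs] := cone_support_inhabited pos0 ci zi0 (wv0 _ _).
    by have := pos s sI; rewrite zs ltxx.
  exact: face_part_eq0 sI zs.
have [d cld] := cell_at fa; have [cl dwv ge0] := cld.
set S := \sum_(j in c | _) l j.
have zd r : r \in facets_at a -> dot z (d r) = \sum_(j in c) l j * (r \in above j)%:R.
  move=> rc; rewrite dot_suml; apply: eq_bigr => j jc.
  by rewrite dotZl (nrm_dual cl (ca _ jc) rc).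
have inside j : `[< F j `<=` F k >] = (above k \subset above j).
  by apply/asboolP/idP => /above_sub_F.
have SE : S = \sum_(j in c) l j * (above k \subset above j)%:R.
  rewrite /S big_mkcondr; apply: eq_bigr => j _.
  by rewrite inside; case: ifP; rewrite ?mulr1 ?mulr0.
have subk := subsetP (above_sub ka).
have Sle r : r \in above k -> S <= dot z (d r).
  move=> rk; rewrite SE zd ?subk //; apply: ler_sum => j jc.
  by rewrite ler_wpM2l ?l0 // ler_nat; case: (boolP (_ \subset _)) => // /subsetP ->.
have [r0 r0k r0P] : exists2 r, r \in above k &
    forall j, j \in c -> (r \in above j) = (above k \subset above j).
  have [[j1 j1P]|nj] := pselect (exists j, (j \in c) && ~~ (above k \subset above j)).
    have [j0 /andP[j0c /subsetPn[r rk rj0]] jmin] := arg_minnP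
      (P := fun j => (j \in c) && ~~ (above k \subset above j)) (fun j : 'I_m => j : nat) j1P.
    exists r => // j jc; have [/subsetP ->//|jk] := boolP (above k \subset above j).
    apply: contraNF rj0; have [jj0|/above_sub_F/subsetP] := chain _ _ jc j0c; last exact.
    suff -> : j = j0 by [].
    by apply/val_inj/eqP; rewrite eqn_leq (Fmono jj0) jmin // jc jk.
  have [r rk] := set0Pn _ (above_neq0 k); exists r => // j jc.
  have [/subsetP ->//|jk] := boolP (above k \subset above j).
  by case: nj; exists j; rewrite jc.
have r0S : dot z (d r0) = S.
  by rewrite SE zd ?subk //; apply: eq_bigr => j /r0P ->.
have [i0 i0I di0] := dual_incident cld ka r0k.
have S0 : 0 <= S by apply: sumr_ge0 => j /andP[jc _]; exact: l0.
rewrite -r0S di0; apply: face_part_min => //; first by rewrite -di0 r0S.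
move=> i iI; rewrite -di0 r0S.
have ia := subsetP (incident_sub _) _ iI.
have wi := face_wv ka ia.
have ui := incident_height iI; rewrite -wi in ui *.
have uE : \sum_(r in above k) dot (nrm r) (wv a i) = 1.
  by rewrite -dot_suml -nrm_sum.
rewrite (cell_expand cl (wv a i)) dot_sumr.
rewrite (big_setID (above k)) /= (setIidPr (above_sub ka)).
rewrite -[S]addr0 lerD //.
  rewrite -[S]mul1r -uE mulr_suml; apply: ler_sum => r rk.
  by rewrite dotZr ler_wpM2l ?Sle // ge0 // subk.
apply: sumr_ge0 => r /setDP[rc _]; have [i' ri'] := dwv r rc.
by rewrite dotZr mulr_ge0 ?ge0 // ri' za ?inE.
Qed.

Lemma face_part_nrm k j :
  face_part k (nrm j) = (`[< F j `<=` F k >])%:R.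
Proof.
have [a [f [fa ja]]] := F_vertex j.
have := face_part_chain k (c := [set j]%SET) (l := fun=> 1) fa.
rewrite big_set1 scale1r => ->.
- rewrite big_mkcondr big_set1; by case: asboolP.
- by move=> i; rewrite inE => /eqP ->.
- by move=> i i'; rewrite !inE => /eqP -> /eqP ->; left.
- by move=> i _; rewrite ler01.
Qed.

(** On the normal cone of a vertex of [Z] all the functionals of the segments
    have constant sign. *)
Lemma zonotope_part_linear k a f : selects E f a [set: I] -> exists2 y, L y &
  forall z, cone nrm (facets_at a) z -> zonotope_part k z = dot z y.
Proof.
move=> fa; exists (vtx E (side k) (incident k) + \sum_(i in incident k)
    (if (i \in a) == (i \in side k) then 0 else wv (side k) i)).
  apply: latticeD => //; first exact: vtx_lattice.
  apply: lattice_sum => // i _; case: ifP => _; first exact: lattice0.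
  exact: wv_lattice.
move=> z /(weakly_selects_cone _ fa) za.
rewrite /zonotope_part dotDr [X in _ = _ + X]dot_sumr; congr +%R.
apply: eq_bigr => i _; have := za i (in_setT i).
case: eqVneq => [/wv_same ->|/wv_opp ->] zi; first by rewrite dot0r; apply/min_idPr.
by apply/min_idPl; move: zi; rewrite dotNr oppr_ge0.
Qed.

(** * The basis of the deformation space *)

Section Basis.
Variables (P : set V) (off : 'I_m -> R) (C : set {set 'I_m}).
Hypothesis sysP : simple_system L nrm [set: 'I_m]%SET off C P.
Hypothesis chainP : forall c, C c ->
  (forall i j, i \in c -> j \in c -> F i `<=` F j \/ F j `<=` F i) /\
  exists a f, selects E f a [set: I] /\ forall j, j \in c -> F j (vx a).

Lemma nrm_dual_lattice j : dual L (nrm j).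
Proof.
move=> x Lx; rewrite nrm_sum dot_suml.
apply: rpred_sum => l lj; have [a [f [fa la]]] := F_vertex l.
have [K [g [kk [fr kkF kki kkK kkn]]]] := at_vertex fa.
have lf := subsetP (above_facets _) _ lj.
have : l \in facets_at a by rewrite inE lf; apply/asboolP.
by rewrite kkK => /imsetP[i iK ->]; rewrite kkn //; exact: (frame_lattice fr iK).
Qed.

Lemma PL_refine (f : V -> R^o) : PL (normal_fan Z) f -> PL (normal_fan P) f.
Proof.
move=> /(PL_cells zonotope_system) fZ; apply/(PL_cells sysP) => c /chainP[_ [a [f' [fa ca]]]].
have [|y fy] := fZ (facets_at a); first by exists a, f'.
exists y => z [l l0 zE]; apply: fy.
apply/(weakly_selects_cone _ fa) => i _.
rewrite zE dot_suml; apply: sumr_ge0 => j jc; rewrite dotZl mulr_ge0 ?l0 //.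
by rewrite (nrm_weakly_selects (ca _ jc)) ?inE.
Qed.

Lemma zonotope_part_PLint k :
  PLint L (normal_fan Z) (zonotope_part k : V -> R^o).
Proof.
apply/(PLint_cells zonotope_system) => _ [a [f [fa ->]]].
exact: (zonotope_part_linear k fa).
Qed.

Lemma face_part_PL k : PL (normal_fan P) (face_part k : V -> R^o).
Proof.
apply/(PL_cells sysP) => c Cc; have [chain [a [f [fa ca]]]] := chainP Cc.
have [x [d cl]] := system_cell sysP Cc.
exists (\sum_(j in c | `[< F j `<=` F k >]) d j) => z zc; rewrite dot_sumr.
rewrite {1}(cell_span cl z); apply: face_part_chain fa ca chain _ => //.
exact: (coneP cl z).1.
Qed.

Lemma face_polytope_h k : (h (face_polytope k) : V -> R^o) =
  (zonotope_part k : V -> R^o) + (face_part k : V -> R^o).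
Proof. by apply/funext => z; rewrite fctE /= /face_part addrC subrK. Qed.

Lemma PL_lspan (fan : set (set V)) X :
  X `<=` PL fan -> lspan X `<=` PL fan.
Proof.
move=> XP _ [k [g [c [gX ->]]]] D Dfan.
have /choice[x xP] i : exists x, forall u, D u -> g i u = dot u x.
  by have [x gx] := XP _ (gX i) D Dfan; exists x.
exists (\sum_i c i *: x i) => u Du; rewrite fct_sumE dot_sumr.
by apply: eq_bigr => i _; rewrite dotZr -xP.
Qed.

Lemma PLint_zspan (fan : set (set V)) X :
  X `<=` PLint L fan -> zspan X `<=` PLint L fan.
Proof.
move=> XP _ [k [g [c [gX ->]]]] D Dfan.
have /choice[x xP] i : exists x, L x /\ forall u, D u -> g i u = dot u x.
  by have [x Lx gx] := XP _ (gX i) D Dfan; exists x.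
exists (\sum_i x i *~ c i).
  by apply: lattice_sum => // i _; apply: latticeMz => //; have [] := xP i.
move=> u Du; rewrite fct_sumE dot_sumr; apply: eq_bigr => i _.
have [_ gx] := xP i; rewrite -!scaler_int dotZr -gx //.
Qed.

Lemma face_polytope_PL k : PL (normal_fan P) (h (face_polytope k) : V -> R^o).
Proof.
rewrite face_polytope_h; apply: (PL_lspan (X := PL (normal_fan P))) => //.
apply: lspanD; apply: lspan_gen; last exact: face_part_PL.
exact/PL_refine/PLint_PL/zonotope_part_PLint.
Qed.

Lemma codim_facets k : (1 < n - affdim (F k))%N = (k \notin facets).
Proof.
have := card_above k => nE.
have -> : (n - affdim (F k))%N = #|above k| by rewrite -{1}nE addKn.
have := above_neq0 k; rewrite -card_gt0 => a0.
have -> : (k \in facets) = (#|above k| == 1)%N.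
  apply/idP/eqP => [kf|a1].
    by rewrite (above_self kf) cards1.
  rewrite inE; apply/asboolP; split; last by rewrite -[RHS]nE a1 addn1.
  by have [] := F_proper k.
by rewrite ltn_neqAle a0 andbT eq_sym.
Qed.

Lemma G_familyP X : G_family L E X <-> exists2 k, k \notin facets & X = face_polytope k.
Proof.
split=> [[G [Gp cod GX]]|[k kf ->]].
  have [k kG] := proper_index Gp; rewrite -kG in cod GX.
  exists k; first by rewrite -codim_facets.
  exact: (is_G_unique GX).
exists (F k); split; first exact: F_proper.
  by rewrite codim_facets.
exact: is_G_face_polytope.
Qed.

Lemma face_polytope_deformation k : deformation P (face_polytope k).
Proof.
apply: deformation_of_PL.
- exact: system_finitely_attained sysP.
- apply: truncated_zonotope_polytope.
  exact: incident_neq0.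
- exact: face_polytope_PL.
Qed.

Lemma face_polytope_indecomposable k : k \notin facets ->
  indecomposable (face_polytope k).
Proof.
move=> kf; apply: (truncated_zonotope_indecomposable (u := nrm k)).
- by move=> i; exact: incident_height.
- apply: leq_trans (card_incident k).
  have := card_above k => nE.
  by move: kf; rewrite -codim_facets -{1}nE addKn.
move=> s /incident_functional[z [sa zs zpos]].
exists z; split=> // r rI; apply: zpos; exact: (subsetP (incident_sub _)).
Qed.

(** The values of the face parts at the rays, by [face_part_value]. *)
Definition inclusion : 'M[int]_m := \matrix_(j, k) (`[< F j `<=` F k >])%:R.

Lemma inclusion_unit : inclusion \in unitmx.
Proof.
apply: (unitriangular_unit (r := fun j k => `[< F j `<=` F k >])).
  by move=> i; apply/asboolP.
by move=> i j /asboolP; exact: Fmono.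
Qed.

Lemma face_part_value j k : face_part k (nrm j) = (inclusion j k)%:~R.
Proof.
rewrite face_part_nrm // mxE.
by case: asboolP.
Qed.

(** A facet lies in no other proper face. *)
Lemma inclusion_facet j k : j \in facets -> inclusion j k = (j == k)%:R.
Proof.
move=> jf; rewrite mxE; have [<-|jk] := eqVneq; first by case: asboolP => // -[].
case: asboolP => // sub; case/eqP: jk; apply: Finj; apply/seteqP; split=> //.
apply/above_sub_F.
rewrite (above_self jf) sub1set.
have := sub => /above_sub_F.
have [l lk] := set0Pn _ (above_neq0 k).
move=> /subsetP/(_ l lk); rewrite (above_self jf).
by rewrite in_set1 => /eqP <-.
Qed.

(** Values at the rays of the fan of [P] that vanish at the facets are attained
    by a unique combination of the face parts of the faces of codimension
    greater than one; it is integral if the values are. *)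
Lemma face_parts_solve (v : 'I_m -> R) : (forall j, j \in facets -> v j = 0) ->
  exists c : 'I_m -> R, [/\ forall k, k \in facets -> c k = 0,
    forall j, \sum_k c k * face_part k (nrm j) = v j &
    (forall j, v j \is a Num.int) -> forall k, c k \is a Num.int].
Proof.
move=> v0; pose M : 'M[R]_m := map_mx intr inclusion.
pose cv : 'cV[R]_m := map_mx intr (invmx inclusion) *m \col_j v j.
have McV : M *m cv = \col_j v j.
  by rewrite mulmxA -map_mxM mulmxV ?inclusion_unit // map_mx1 mul1mx.
have solve j : \sum_k cv k 0 * face_part k (nrm j) = v j.
  have := congr1 (fun A : 'cV[R]_m => A j 0) McV; rewrite !mxE => <-.
  by apply: eq_bigr => k _; rewrite face_part_value mulrC [M j k]mxE.
exists (fun k => cv k 0); split=> // [k kf|vint k].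
  rewrite -(v0 k kf) -solve (bigD1 k) //= big1 => [|l lk].
    by rewrite addr0 face_part_value inclusion_facet // eqxx mulr1.
  by rewrite face_part_value inclusion_facet // eq_sym (negbTE lk) mulr0.
rewrite mxE; apply: rpred_sum => j _; rewrite !mxE; apply: rpredM; last exact: vint.
exact: intr_int.
Qed.

Lemma face_parts_free (c : 'I_m -> R) :
  (forall j, \sum_k c k * face_part k (nrm j) = 0) -> forall k, c k = 0.
Proof.
move=> c0 k; pose M : 'M[R]_m := map_mx intr inclusion.
have Mc0 : M *m (\col_j c j) = 0.
  apply/colP => j; rewrite !mxE -[RHS](c0 j); apply: eq_bigr => l _.
  by rewrite !mxE face_part_value mulrC mxE.
have : map_mx intr (invmx inclusion) *m (M *m (\col_j c j)) = 0 :> 'cV[R]_m.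
  by rewrite Mc0 mulmx0.
rewrite mulmxA -map_mxM mulVmx ?inclusion_unit // map_mx1 mul1mx.
by move=> /colP/(_ k); rewrite !mxE.
Qed.

Variable T : set (set V).
Hypothesis basT : indecomposable_basis Z T.

Let T_def Q : T Q -> polytope Q.
Proof. by have [[TZ _] _] := basT; move=> /TZ[]. Qed.

Let T_span : lspan (support_functions T) = PL (normal_fan Z).
Proof. by have [[_ [_ ->]] _] := basT. Qed.

Let G := G_family L E.

Let T_sub : support_functions T `<=` support_functions (G `|` T).
Proof. by move=> _ [Q TQ <-]; exists Q => //; right. Qed.

Let G_gen k : k \notin facets ->
  support_functions (G `|` T) (h (face_polytope k) : V -> R^o).
Proof.
by move=> kf; exists (face_polytope k) => //; left; apply/G_familyP; exists k.
Qed.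

Lemma basis_deformation : G `|` T `<=` deformation P.
Proof.
move=> Q [/G_familyP[k kf ->]|TQ]; first exact: face_polytope_deformation.
apply: deformation_of_PL.
- exact: system_finitely_attained sysP.
- exact: T_def.
- by apply: PL_refine; rewrite -T_span; apply: lspan_gen; exists Q.
Qed.

Lemma basis_indecomposable : G `|` T `<=` indecomposable (n := n).
Proof.
move=> Q [/G_familyP[k kf ->]|TQ]; first exact: face_polytope_indecomposable.
by have [_] := basT; exact.
Qed.

(** A function that is linear on the cones of [P] is the sum of one that is
    linear on the cones of [Z], with the same values at the facets, and of a
    combination of face parts. *)
Lemma PL_decomposition (f : V -> R^o) : PL (normal_fan P) f ->
  exists (c : 'I_m -> R) (g : V -> R^o),
    [/\ PL (normal_fan Z) g, forall k, k \in facets -> c k = 0,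
       f = g + \sum_k c k *: (face_part k : V -> R^o) &
       PLint L (normal_fan P) f ->
         PLint L (normal_fan Z) g /\ forall k, c k \is a Num.int].
Proof.
move=> fP; have [g [gZ gv gint]] := PL_interpolation zonotope_system latL (fun j => f (nrm j)).
have [j jf|c [c0 cv cint]] := @face_parts_solve (fun j => f (nrm j) - g (nrm j)).
  have [a [f' [fa ja]]] := F_vertex j.
  rewrite (gv (facets_at a)) ?subrr //; first by exists a, f'.
  by rewrite inE jf; apply/asboolP.
exists c, g; split=> //.
  apply: (PL_ext sysP) => //.
    apply: (PL_lspan (X := PL (normal_fan P))) => //.
    apply: lspanD; first exact/lspan_gen/PL_refine.
    by apply: lspan_sum => k _; exact/lspanZ/lspan_gen/face_part_PL.
  move=> j _; rewrite fctE fct_sumE -[LHS](subrK (g (nrm j))) addrC; congr +%R.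
  exact/esym/cv.
move=> fint; have fv j : f (nrm j) \is a Num.int.
  exact: (PLint_int sysP fint (nrm_dual_lattice j)).
have gi := gint fv; split=> //; apply: cint => j; apply: rpredB; first exact: fv.
exact: (PLint_int zonotope_system gi (nrm_dual_lattice j)).
Qed.

Lemma face_part_E k : (face_part k : V -> R^o) =
  (h (face_polytope k) : V -> R^o) - (zonotope_part k : V -> R^o).
Proof. by []. Qed.

Lemma basis_lspan : lspan (support_functions (G `|` T)) = PL (normal_fan P).
Proof.
apply/seteqP; split=> f.
  apply: PL_lspan => _ [Q [/G_familyP[k kf ->]|TQ] <-]; first exact: face_polytope_PL.
  by apply: PL_refine; rewrite -T_span; apply: lspan_gen; exists Q.
move=> /PL_decomposition[c [g [gZ c0 -> _]]].
have spanZ (f' : V -> R^o) : PL (normal_fan Z) f' -> lspan (support_functions (G `|` T)) f'.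
  by rewrite -T_span; exact: lspan_mono.
apply: lspanD; first exact: spanZ.
apply: lspan_sum => k _; have [kf|kf] := boolP (k \in facets).
  by rewrite c0 // scale0r -[X in lspan _ X](scale0r g); apply: lspanZ; exact: spanZ.
apply: lspanZ; rewrite face_part_E; apply: lspanD; first exact/lspan_gen/G_gen.
by rewrite -scaleN1r; apply/lspanZ/spanZ/PLint_PL/zonotope_part_PLint.
Qed.

Lemma basis_zspan : zspan (support_functions T) = PLint L (normal_fan Z) ->
  zspan (support_functions (G `|` T)) = PLint L (normal_fan P).
Proof.
move=> Tz.
have refine (f : V -> R^o) : PLint L (normal_fan Z) f -> PLint L (normal_fan P) f.
  move=> fZ; apply: (PLint_of_values sysP latL); first exact/PL_refine/(PLint_PL fZ).
  by move=> j _; exact: (PLint_int zonotope_system fZ (nrm_dual_lattice j)).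
apply/seteqP; split=> f.
  apply: PLint_zspan => _ [Q [/G_familyP[k kf ->]|TQ] <-]; last first.
    by apply: refine; rewrite -Tz; apply: zspan_gen; exists Q.
  apply: (PLint_of_values sysP latL); first exact: face_polytope_PL.
  move=> j _; rewrite face_polytope_h fctE; apply: rpredD.
    exact: (PLint_int zonotope_system (zonotope_part_PLint k) (nrm_dual_lattice j)).
  by rewrite /= face_part_value intr_int.
move=> fint; have [c [g [gZ c0 fE /(_ fint)[gint cint]]]] := PL_decomposition (PLint_PL fint).
rewrite fE.
have spanZ (f' : V -> R^o) : PLint L (normal_fan Z) f' -> zspan (support_functions (G `|` T)) f'.
  by rewrite -Tz; exact: zspan_mono.
apply: zspanD; first exact: spanZ.
apply: zspan_sum => k _; have [kf|kf] := boolP (k \in facets).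
  by rewrite c0 // scale0r -[X in zspan _ X](mulr0z g); apply: zspanMz; exact: spanZ.
have /intrP[t ->] := cint k; rewrite scaler_int; apply: zspanMz.
rewrite face_part_E; apply: zspanD; first exact/zspan_gen/G_gen.
by rewrite -mulrN1z; apply/zspanMz/spanZ/zonotope_part_PLint.
Qed.

Lemma combination_split (M : lmodType R) k (g : 'I_k -> M) (c : 'I_k -> R)
    (cs : 'I_m -> R) (A : {set 'I_k}) (x y : 'I_m -> M) :
  \sum_i c i *: g i = 0 -> \sum_(i in ~: A) c i *: g i = \sum_l cs l *: x l ->
  \sum_l cs l *: (x l - y l) = \sum_(i in A) - c i *: g i + \sum_l - cs l *: y l.
Proof.
move=> s0 sA; under eq_bigr do rewrite scalerBr.
rewrite sumrB -sA; congr (_ + _).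
  apply/eqP; rewrite -subr_eq0 -sumrN; apply/eqP; rewrite -[RHS]s0.
  rewrite [RHS](bigID (mem A)) /= addrC; congr (_ + _).
    by apply: eq_bigl => i; rewrite inE.
  by apply: eq_bigr => i _; rewrite scaleNr opprK.
by rewrite -sumrN; apply: eq_bigr => l _; rewrite scaleNr.
Qed.

(** Modulo functions that are linear on the cones of [Z], a vanishing
    combination is a vanishing combination of face parts; these are free. *)
Lemma basis_free : lfree (support_functions (G `|` T)).
Proof.
have [[_ [Tfree _]] _] := basT.
move=> k g c ginj gS s0.
pose A := [set i | `[< support_functions T (g i) >]]%SET.
have /choice[s sP] i : exists s : option 'I_m, i \notin A ->
    exists k, [/\ s = Some k, k \notin facets & g i = (h (face_polytope k) : V -> R^o)].
  have [iA|iA] := boolP (i \in A); first by exists None.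
  have [Q [/G_familyP[l lf ->]|TQ] Qg] := gS i.
    by exists (Some l) => _; exists l.
  by case/negP: iA; rewrite inE; apply/asboolP; exists Q.
pose cs l := \sum_(i in ~: A | s i == Some l) c i.
have hsum : \sum_(i in ~: A) c i *: g i =
    \sum_l cs l *: (h (face_polytope l) : V -> R^o).
  rewrite [RHS](eq_bigr (fun l => \sum_(i in ~: A | s i == Some l)
      c i *: (h (face_polytope l) : V -> R^o))); last by move=> l _; rewrite scaler_suml.
  rewrite (exchange_big_dep (mem (~: A))) /=; last by move=> l i _ /andP[].
  apply: eq_bigr => i iA; have iA' : i \notin A by rewrite inE in iA.
  have [l [sl _ ->]] := sP i iA'; rewrite (big_pred1 l) // => l'.
  by rewrite iA sl /= (inj_eq Some_inj) eq_sym.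
pose phi : V -> R^o := \sum_l cs l *: (face_part l : V -> R^o).
have phiE j : phi (nrm j) = \sum_l cs l * face_part l (nrm j).
  by rewrite /phi fct_sumE.
have phiZ : PL (normal_fan Z) phi.
  have -> : phi = \sum_(i in A) - c i *: g i +
      \sum_l - cs l *: (zonotope_part l : V -> R^o).
    exact (combination_split (M := (V -> R^o : lmodType R))
      (x := fun l => h (face_polytope l) : V -> R^o)
      (fun l => zonotope_part l : V -> R^o) s0 hsum).
  apply: (PL_lspan (X := PL (normal_fan Z))) => //; apply: lspanD.
    apply: lspan_sum => i; rewrite inE => /asboolP [Q TQ <-].
    apply/lspanZ/lspan_gen; rewrite -T_span; apply: lspan_gen.
    by exists Q.
  by apply: lspan_sum => l _; apply/lspanZ/lspan_gen/PLint_PL/zonotope_part_PLint.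
have cs_facet l : l \in facets -> cs l = 0.
  move=> lf; rewrite /cs big1 // => i /andP[]; rewrite inE => /sP[l' [-> lf' _]].
  by move=> /eqP[ll']; rewrite ll' lf in lf'.
have phi0 : phi = 0.
  apply: (PL_ext zonotope_system) => // [D _|j jf]; first by exists 0 => u _; rewrite dot0r.
  rewrite phiE big1 // => l _; rewrite face_part_value inclusion_facet //.
  by case: eqVneq => [<-|_]; rewrite ?mulr0 // cs_facet ?mul0r.
have cs0 : forall l, cs l = 0.
  by apply: face_parts_free => j; rewrite -phiE phi0.
have cA0 i : i \notin A -> c i = 0.
  move=> iA; have [l [sl lf gl]] := sP i iA; rewrite -[RHS](cs0 l) /cs (bigD1 i) /=.
    rewrite big1 ?addr0 // => j /andP[/andP[jA /eqP sj] ji].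
    rewrite inE in jA; have [l' [sl' _ gl']] := sP j jA.
    case/eqP: ji; apply: ginj; rewrite gl gl'; congr (h (face_polytope _)).
    by move: sl'; rewrite sj => -[].
  by rewrite inE iA sl eqxx.
move=> i; have [iA|/cA0//] := boolP (i \in A).
apply: (lfree_family Tfree ginj (A := A)) => //.
  by move=> j; rewrite inE => /asboolP.
move: s0; rewrite (bigID (mem A)) /= [X in _ + X]big1 ?addr0 // => j /cA0 ->.
by rewrite scale0r.
Qed.

End Basis.
End DelzantZonotope.

(** * The basis theorem *)

Theorem theorem7p15 (R : realType) (n : nat) (L : set 'rV[R]_n)
    (I : finType) (E : I -> 'rV[R]_n * 'rV[R]_n)
    (P : set 'rV[R]_n) (T : set (set 'rV[R]_n)) :
  let Z := zonotope E [set: I]%SET in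
  lattice L ->
  segment_family E ->
  integral L E ->
  primitive_delzant L Z ->
  omnitruncation L Z P ->
  indecomposable_basis Z T ->
  indecomposable_basis P (G_family L E `|` T) /\
  (integral_basis L Z T -> integral_basis L P (G_family L E `|` T)).
Proof.
move=> Z latL famE intE pdZ [m [F [eps [S [Finj Frange Fmono [S0 ->] step]]]]] basT.
have [off [C [sysP chainP]]] :=
  omnitruncation_system latL famE intE pdZ Finj Frange Fmono S0 step.
have polybasis : polytopal_basis (S m) (G_family L E `|` T).
  split.
    exact: (basis_deformation latL famE intE pdZ Finj Frange Fmono sysP chainP basT).
  split.
    exact: (basis_free latL famE intE pdZ Finj Frange Fmono basT).
  exact: (basis_lspan latL famE intE pdZ Finj Frange Fmono sysP chainP basT).
split.
  by split=> //; exact: (basis_indecomposable latL famE intE pdZ Finj Frange basT).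
move=> [_ Tz]; split=> //.
exact: (basis_zspan latL famE intE pdZ Finj Frange Fmono sysP chainP Tz).
Qed.
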